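(* Let $d\in(-1/2,1/2)\setminus\{0\}$ and let $\{X_k\}_{k\in\mathbb{Z}}$ be a $q$-variate FARIMA process with spectral density $w(e^{i\theta})=|1-e^{i\theta}|^{-2d}g(e^{i\theta})g(e^{i\theta})^*$, where the entries of $g(z)$ are rational functions of $z$ with no poles on $\overline{\mathbb{D}}$ and $\det g$ has no zeros on $\overline{\mathbb{D}}$. Then, as $n\to\infty$, $$v_n=v_\infty+\frac{d^2}{n}v_\infty+O(n^{-2}),\qquad \tilde v_n=\tilde v_\infty+\frac{d^2}{n}\tilde v_\infty+O(n^{-2}).$$
   Context: $\overline{\mathbb{D}}$ is the closed unit disk and $\mathbb{T}$ the unit circle. $O(n^{-2})$ for matrices is understood in norm. A $q$-variate stationary process $\{X_k\}_{k\in\mathbb{Z}}$ ($q\in\mathbb{N}$) is a $\mathbb{C}^q$-valued, centered, weakly stationary process on a probability space; it has spectral density $w$ if $w\in L_1^{q\times q}(\mathbb{T})$ is positive-semidefinite-Hermitian-valued and $E[X_mX_n^*]=\int_{-\pi}^{\pi}e^{-i(m-n)\theta}w(e^{i\theta})\frac{d\theta}{2\pi}$. A $q$-variate FARIMA process is a $q$-variate stationary process with spectral density of the form in the claim. Let $M$ be the closed linear span in $L^2(\Omega,\mathcal F,P)$ of all entries of all $X_k$ (inner product $E[x\overline y]$). For a set of integers $K$, $P_K^\perp$ is the orthogonal projection of $M$ onto the orthogonal complement of the closed linear span of the entries of $X_k$, $k\in K$, applied entrywise to $\mathbb{C}^q$-valued vectors with entries in $M$. For such vectors, $\langle x,y\rangle:=E[xy^*]\in\mathbb{C}^{q\times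 q}$. Forward and backward finite prediction error covariances: for $n\ge1$, $$v_n:=\langle P_{[-n,-1]}^\perp X_0,P_{[-n,-1]}^\perp X_0\rangle,\qquad \tilde v_n:=\langle P_{[-n,-1]}^\perp X_{-(n+1)},P_{[-n,-1]}^\perp X_{-(n+1)}\rangle.$$ Forward and backward infinite prediction error covariances: $$v_\infty:=\langle P_{(-\infty,-1]}^\perp X_0,P_{(-\infty,-1]}^\perp X_0\rangle,\qquad \tilde v_\infty:=\langle P_{[1,\infty)}^\perp X_0,P_{[1,\infty)}^\perp X_0\rangle.$$ *)

(* Defs.v *)
From HB Require Import structures.
From mathcomp Require Import all_boot all_order all_algebra.
From mathcomp Require Import all_classical all_reals all_analysis.
From mathcomp Require Import complex.
Set Implicit Arguments.
Unset Strict Implicit.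
Unset Printing Implicit Defensive.
Import Order.TTheory GRing.Theory Num.Theory.
Import numFieldNormedType.Exports.
Local Open Scope classical_set_scope.
Local Open Scope complex_scope.
Local Open Scope sesquilinear_scope.
Local Open Scope ring_scope.

(* MathComp-Analysis integrates real-valued functions only, so the integral of
   a complex-valued function is taken on real and imaginary parts. *)
Section ComplexIntegral.
Context {d : measure_display} {T : measurableType d} {R : realType}.
Variables (mu : {measure set T -> \bar R}) (D : set T).

Definition cintegrable (f : T -> R[i]) : Prop :=
  mu.-integrable D (EFin \o (@complex.Re R \o f)) /\
  mu.-integrable D (EFin \o (@complex.Im R \o f)).

Definition cintegral (f : T -> R[i]) : R[i] :=
  (\int[mu]_(x in D) complex.Re (f x)) +i* (\int[mu]_(x in D) complex.Im (f x)).

Definition mxintegral (m n : nat) (F : T -> 'M[R[i]]_(m, n)) : 'M[R[i]]_(m, n) :=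
  \matrix_(i, j) cintegral (fun x => F x i j).

End ComplexIntegral.

(* Elements of L^2(P) are represented by functions; the predicates below are
   all invariant under almost sure equality. *)
Section L2.
Context {d : measure_display} {T : measurableType d} {R : realType}.
Variable P : probability T R.
Implicit Types (x y z : T -> R[i]) (S : set (T -> R[i])).

Definition L2 : set (T -> R[i]) :=
  [set x : T -> R[i] | @complex.Re R \o x \in Lfun P 2%:E /\ @complex.Im R \o x \in Lfun P 2%:E].

Definition inner x y : R[i] := cintegral P setT (fun t => x t * (y t)^*).

Definition L2_closure S : set (T -> R[i]) :=
  [set y | L2 y /\ forall e : R[i], 0 < e ->
     exists2 z, S z & inner (fun t => y t - z t) (fun t => y t - z t) < e ^+ 2].

(* An almost sure class has many representatives, of which one is chosen. *)
Definition orth_proj S x : T -> R[i] :=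
  xget (fun=> 0) [set y | S y /\
    forall z, S z -> inner (fun t => x t - y t) z = 0].

Definition gram (q : nat) (x y : T -> 'cV[R[i]]_q) : 'M[R[i]]_q :=
  mxintegral P setT (fun t => x t *m (y t)^t*).

End L2.

Section Process.
Context {d : measure_display} {T : measurableType d} {R : realType} {q : nat}.
Variables (P : probability T R) (X : int -> T -> 'cV[R[i]]_q).

Definition stationary_process : Prop :=
  [/\ forall k i, L2 P (fun t => X k t i 0),
      forall k, mxintegral P setT (X k) = 0 &
      forall m n h, gram P (X (m + h)) (X (n + h)) = gram P (X m) (X n)].

Definition cis (theta : R) : R[i] := cos theta +i* sin theta.

(* [w] is used only through its values on the unit circle. *)
Definition has_spectral_density (w : R[i] -> 'M[R[i]]_q) : Prop :=
  [/\ forall i j, cintegrable (@lebesgue_measure R) `[- pi, pi]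
        (fun theta => w (cis theta) i j),
      {ae @lebesgue_measure R, forall theta, theta \in `[- pi, pi] ->
        w (cis theta) \is hermsymmx /\
        forall u : 'cV[R[i]]_q, 0 <= (u^t* *m w (cis theta) *m u) 0 0} &
      forall m n : int, gram P (X m) (X n) =
        ((2 * pi)^-1)%:C *: mxintegral (@lebesgue_measure R) `[- pi, pi]
          (fun theta => cis (- ((m - n)%:~R * theta)) *: w (cis theta))].

Definition lin_span (K : set int) : set (T -> R[i]) :=
  [set y | exists (s : seq (int * 'I_q)) (c : int * 'I_q -> R[i]),
     (forall p, p \in s -> K p.1) /\
     y = fun t => \sum_(p <- s) c p * X p.1 t p.2 0].

Definition closed_span (K : set int) : set (T -> R[i]) :=
  L2_closure P (lin_span K).

Definition orth_compl (K : set int) : set (T -> R[i]) :=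
  [set y | closed_span setT y /\
     forall z, closed_span K z -> inner P y z = 0].

Definition Pperp (K : set int) (x : T -> 'cV[R[i]]_q) : T -> 'cV[R[i]]_q :=
  fun t => \col_i orth_proj P (orth_compl K) (fun s => x s i 0) t.

Definition error_cov (K : set int) (k : int) : 'M[R[i]]_q :=
  gram P (Pperp K (X k)) (Pperp K (X k)).

Definition fwd_cov (n : nat) : 'M[R[i]]_q :=
  error_cov [set k | - n%:Z <= k <= -1] 0.

Definition bwd_cov (n : nat) : 'M[R[i]]_q :=
  error_cov [set k | - n%:Z <= k <= -1] (- n.+1%:Z).

Definition fwd_cov_infty : 'M[R[i]]_q := error_cov [set k | k <= -1] 0.

Definition bwd_cov_infty : 'M[R[i]]_q := error_cov [set k | 1 <= k] 0.

End Process.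

Section Farima.
Context {R : realType}.

(* As [p] and [r] are coprime, the poles of [p / r] are the roots of [r]. *)
Definition rational_on_closed_disk (f : R[i] -> R[i]) : Prop :=
  exists p r : {poly R[i]},
    [/\ coprimep p r,
        forall z : R[i], `|z| <= 1 -> ~~ root r z &
        forall z, ~~ root r z -> f z = p.[z] / r.[z]].

(* The value at [z = 1], where [powR] returns 0, is irrelevant: it only
   affects [theta = 0]. *)
Definition farima_density (q : nat) (delta : R) (g : R[i] -> 'M[R[i]]_q)
    (z : R[i]) : 'M[R[i]]_q :=
  (complex.Re `|1 - z| `^ (- (2 * delta)))%:C *: (g z *m (g z)^t*).

End Farima.

(* Main.v *)
Require Import Defs.
From HB Require Import structures.
From mathcomp Require Import all_boot all_order all_algebra.
From mathcomp Require Import all_classical all_reals all_analysis.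
From mathcomp Require Import measurable_realfun complex ring lra zify.
Set Implicit Arguments.
Unset Strict Implicit.
Unset Printing Implicit Defensive.
Import Order.TTheory GRing.Theory Num.Theory.
Import numFieldNormedType.Exports.
Local Open Scope classical_set_scope.
Local Open Scope complex_scope.
Local Open Scope ring_scope.

(* Spectrally, X is white noise seen through |1 - z|^(-d) g(z). For the scalar
   weight |1 - z|^(-2d) the orthogonal polynomials phi_n are explicit: their Verblunsky
   coefficients are d / (n - d), so the scalar prediction error is
   gamma_0 prod_(k <= n) (1 - (d / (k - d))^2) = c (1 + d^2 / n) + O(n^-2).
   To handle g = N / rho with N a polynomial matrix, the truncated power series t of
   phi_m / det N gives the trial predictor with coefficients t g(0) rho adj N, whose
   transfer function is (phi_m + z^(m+1) s) g(0) with s of bounded degree and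
   coefficients O(1/m). Its covariance is c (1 + d^2 / n) g(0) g(0)^* + O(n^-2), and it
   is orthogonal to the past up to O(1/n), so by Pythagoras the optimal covariance
   differs from it by O(n^-2). Letting n tend to infinity identifies the main term
   with the infinite prediction error. Backward prediction is forward prediction for
   the conjugate variable, after a spectral factor of w analytic in that variable has
   been obtained by reversing polynomials and moving zeros across the circle. *)

(** The obstacle is that 1 / det N is not a polynomial. Truncating the series of phi_m / det N
    leaves an overshoot beyond degree m; its coefficients are O(1/m), and so is the failure of phi_m
    to be orthogonal to the monomials just past degree m, whence cross terms O(m^-2). The trial
    predictor need only be optimal to first order because its error enters the covariance squared.
    That first-order estimate must be relative to the L^2 norm of the tested combination f of past
    values, whereas tail estimates use the coefficients of f. These are recovered by dividing the
    transfer function by N / rho and taking unweighted Fourier coefficients, which the weighted L^2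
    norm controls because |d| < 1/2 makes the inverse weight integrable too. No Gamma function
    appears: differentiating the weight times sin(t/2) e^(i(k+1/2)t) gives a two-term recursion for
    the moments, and all closed forms are finite products checked by induction. The constants
    precede the choice of time indexing, so one estimate serves both the backward windows, which
    move with n, and the fixed indexings that exhaust an infinite past or future. *)

Local Notation normc := (@Normc.normc _).
Local Notation CRe := (@complex.Re _).
Local Notation CIm := (@complex.Im _).

(** * Complex numbers and complex integrals *)

Section ComplexModulus.
Context {R : realType}.
Implicit Types x y z : R[i].

Lemma conjE x : x^* = CRe x -i* CIm x.
Proof. by case: x. Qed.

Lemma CReD x y : CRe (x + y) = CRe x + CRe y.
Proof. by case: x; case: y. Qed.

Lemma CImD x y : CIm (x + y) = CIm x + CIm y.
Proof. by case: x; case: y. Qed.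

Lemma CReN x : CRe (- x) = - CRe x.
Proof. by case: x. Qed.

Lemma CImN x : CIm (- x) = - CIm x.
Proof. by case: x. Qed.

Lemma CReM x y : CRe (x * y) = CRe x * CRe y - CIm x * CIm y.
Proof. by case: x; case: y. Qed.

Lemma CImM x y : CIm (x * y) = CRe x * CIm y + CIm x * CRe y.
Proof. by case: x => a b; case: y => c e /=; rewrite addrC. Qed.

Lemma complex_eqP x y : CRe x = CRe y -> CIm x = CIm y -> x = y.
Proof. by case: x => a b; case: y => c e /= -> ->. Qed.

Lemma CRe_sum I (s : seq I) (P : pred I) (F : I -> R[i]) :
  CRe (\sum_(i <- s | P i) F i) = \sum_(i <- s | P i) CRe (F i).
Proof. by apply: (big_morph CRe CReD). Qed.

Lemma normc_ge0 x : 0 <= normc x.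
Proof. by case: x => a b; exact: sqrtr_ge0. Qed.

Lemma normc_eq0 x : (normc x == 0) = (x == 0).
Proof.
by apply/eqP/eqP => [/Normc.eq0_normc//|->]; exact: Normc.normc0.
Qed.

Lemma normcD x y : normc (x + y) <= normc x + normc y.
Proof. exact: le_normcD. Qed.

Lemma normcB x y : normc (x - y) <= normc x + normc y.
Proof. by rewrite -(normcN y); exact: normcD. Qed.

Lemma normcX x n : normc (x ^+ n) = normc x ^+ n.
Proof.
elim: n => [|n ih]; first by rewrite !expr0 Normc.normc1.
by rewrite !exprS Normc.normcM ih.
Qed.

Lemma normc_sum I (s : seq I) (P : pred I) (F : I -> R[i]) :
  normc (\sum_(i <- s | P i) F i) <= \sum_(i <- s | P i) normc (F i).
Proof.
elim/big_rec2: _ => [|i b a _ le_ab]; first by rewrite Normc.normc0.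
by rewrite (le_trans (normcD _ _))// lerD2l.
Qed.

Lemma normc_conj x : normc x^* = normc x.
Proof. by case: x => a b /=; rewrite sqrrN. Qed.

Lemma normc_real (a : R) : normc a%:C = `|a|.
Proof. by rewrite /= expr0n addr0 sqrtr_sqr. Qed.

Lemma CRe_norm x : CRe `|x| = normc x.
Proof. by case: x. Qed.

Lemma normr_normc x : `|x| = (normc x)%:C.
Proof. by case: x. Qed.

Lemma sqr_normcE x : normc x ^+ 2 = CRe x ^+ 2 + CIm x ^+ 2.
Proof. by case: x => a b /=; rewrite sqr_sqrtr// addr_ge0 ?sqr_ge0. Qed.

Lemma mulc_conj x : x * x^* = (normc x ^+ 2)%:C.
Proof.
rewrite conjE; apply: complex_eqP; rewrite ?CReM ?CImM sqr_normcE/=; ring.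
Qed.

Lemma Re_le_normc x : `|CRe x| <= normc x.
Proof.
by case: x => a b /=; rewrite -sqrtr_sqr ler_wsqrtr// lerDl sqr_ge0.
Qed.

Lemma Im_le_normc x : `|CIm x| <= normc x.
Proof.
by case: x => a b /=; rewrite -sqrtr_sqr ler_wsqrtr// lerDr sqr_ge0.
Qed.

Lemma normc_le_ReIm x : normc x <= `|CRe x| + `|CIm x|.
Proof.
rewrite -(@ler_pXn2r _ 2)// ?nnegrE ?addr_ge0 ?normc_ge0//.
by rewrite sqr_normcE sqrrD !real_normK ?num_real// lerD2r lerDl mulrn_wge0// mulr_ge0.
Qed.

End ComplexModulus.

Section ComplexIntegration.
Context {disp : measure_display} {T : measurableType disp} {R : realType}.
Variables (mu : {measure set T -> \bar R}) (D : set T).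
Hypothesis mD : measurable D.
Implicit Types (f g : T -> R[i]) (c : R[i]).

Lemma cintegrable_ext f g : {in D, f =1 g} ->
  cintegrable mu D f -> cintegrable mu D g.
Proof.
move=> fg [fr fi]; split.
  by apply: eq_integrable fr => // x xD /=; rewrite fg.
by apply: eq_integrable fi => // x xD /=; rewrite fg.
Qed.

Lemma eq_cintegral f g : {in D, f =1 g} -> cintegral mu D f = cintegral mu D g.
Proof.
by move=> fg; congr Complex; apply: eq_Rintegral => x xD; rewrite fg.
Qed.

Lemma cintegrableD f g : cintegrable mu D f -> cintegrable mu D g ->
  cintegrable mu D (fun x => f x + g x).
Proof.
move=> [fr fi] [gr gi]; split.
  by apply: eq_integrable (integrableD mD fr gr) => // x _ /=; rewrite CReD.
by apply: eq_integrable (integrableD mD fi gi) => // x _ /=; rewrite CImD.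
Qed.

Lemma cintegralD f g : cintegrable mu D f -> cintegrable mu D g ->
  cintegral mu D (fun x => f x + g x) = cintegral mu D f + cintegral mu D g.
Proof.
move=> [fr fi] [gr gi]; apply: complex_eqP; rewrite ?CReD ?CImD /=.
  by rewrite -RintegralD//; apply: eq_Rintegral => x _; rewrite CReD.
by rewrite -RintegralD//; apply: eq_Rintegral => x _; rewrite CImD.
Qed.

Lemma cintegrable0 : cintegrable mu D (fun=> 0).
Proof. by split; apply: eq_integrable (integrable0 mu D). Qed.

Lemma cintegral0 : cintegral mu D (fun=> 0) = 0.
Proof. by rewrite /cintegral/= !Rintegral_cst// !mul0r. Qed.

Let Rintegral_lin (a b : R) (u v : T -> R) : mu.-integrable D (EFin \o u) ->
  mu.-integrable D (EFin \o v) ->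
  \int[mu]_(x in D) (a * u x + b * v x) =
  a * \int[mu]_(x in D) u x + b * \int[mu]_(x in D) v x.
Proof.
move=> iu iv; rewrite RintegralD ?RintegralZl//; by [exact: integrableZl mD a _ iu|exact: integrableZl mD b _ iv].
Qed.

Lemma cintegralZ c f : cintegrable mu D f ->
  cintegral mu D (fun x => c * f x) = c * cintegral mu D f.
Proof.
move=> [fr fi]; apply: complex_eqP; rewrite ?CReM ?CImM /= -?mulNr -Rintegral_lin//;
  by apply: eq_Rintegral => x _; rewrite ?CReM ?CImM ?mulNr.
Qed.

Lemma cintegrable_sum I (s : seq I) (P : pred I) (F : I -> T -> R[i]) :
  (forall i, P i -> cintegrable mu D (F i)) ->
  cintegrable mu D (fun x => \sum_(i <- s | P i) F i x).
Proof.
move=> iF; elim: s => [|i s ih].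
  by apply: cintegrable_ext cintegrable0 => x _; rewrite big_nil.
have [Pi|nPi] := boolP (P i).
  by apply: cintegrable_ext (cintegrableD (iF _ Pi) ih) => x _; rewrite big_cons Pi.
by apply: cintegrable_ext ih => x _; rewrite big_cons (negbTE nPi).
Qed.

Lemma cintegral_sum I (s : seq I) (P : pred I) (F : I -> T -> R[i]) :
  (forall i, P i -> cintegrable mu D (F i)) ->
  cintegral mu D (fun x => \sum_(i <- s | P i) F i x) =
  \sum_(i <- s | P i) cintegral mu D (F i).
Proof.
move=> iF; elim: s => [|i s ih].
  by rewrite big_nil; apply: etrans cintegral0; apply: eq_cintegral => x _; rewrite big_nil.
rewrite big_cons; case: ifPn => [Pi|nPi].
  rewrite -ih -cintegralD//; last exact: cintegrable_sum.
    by apply: eq_cintegral => x _; rewrite big_cons Pi.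
  exact: iF.
by rewrite -ih; apply: eq_cintegral => x _; rewrite big_cons (negbTE nPi).
Qed.

Lemma cintegral_conj f : cintegrable mu D f ->
  cintegral mu D (fun x => (f x)^*) = (cintegral mu D f)^*.
Proof.
move=> [fr fi]; rewrite [RHS]conjE; apply: complex_eqP => /=.
  by apply: eq_Rintegral => x _; rewrite conjE.
rewrite -mulN1r -RintegralZl//; apply: eq_Rintegral => x _.
by rewrite conjE/= mulN1r.
Qed.

Lemma cintegral_real (u : T -> R) :
  cintegral mu D (fun x => (u x)%:C) = (\int[mu]_(x in D) u x)%:C.
Proof.
apply: complex_eqP => /=; first by apply: eq_Rintegral.
by rewrite Rintegral_cst// mul0r.
Qed.

(* The factor 2 avoids the sharp modulus inequality. *)
Lemma normc_cintegral f (u : T -> R) : cintegrable mu D f ->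
  mu.-integrable D (EFin \o u) -> (forall x, D x -> normc (f x) <= u x) ->
  normc (cintegral mu D f) <= 2 * \int[mu]_(x in D) u x.
Proof.
move=> [fr fi] iu fu; rewrite (le_trans (normc_le_ReIm _))// mulr2n mulrDl mul1r.
apply: lerD => /=; (apply: le_trans; first exact: le_normr_Rintegral);
  apply: le_Rintegral => //; first [exact: integrable_norm | move=> x Dx];
  by rewrite (le_trans _ (fu _ Dx))// ?Re_le_normc ?Im_le_normc.
Qed.

End ComplexIntegration.

(** * Square-integrable complex random variables *)

Section L2Theory.
Context {disp : measure_display} {T : measurableType disp} {R : realType}.
Variable P : probability T R.
Implicit Types (x y z : T -> R[i]) (c : R[i]).

Lemma Lfun2P (u : T -> R) : u \in Lfun P 2%:E <->
  measurable_fun setT u /\ P.-integrable setT (EFin \o (fun t => u t ^+ 2)).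
Proof.
split => [u2|[mu iu]].
  split; last exact: Lfun2_integrable_sqr.
  by move: u2; rewrite inE => /andP[]; rewrite inE.
rewrite inE; apply/andP; split; rewrite inE//= /finite_norm unlock poweR_lty//.
under eq_integral => t _ do rewrite abse_EFin poweR_EFin powR_mulrn// real_normK ?num_real//.
exact: integrable_lty.
Qed.

Lemma Lfun2_ext (u v : T -> R) : u =1 v -> u \in Lfun P 2%:E -> v \in Lfun P 2%:E.
Proof. by move=> /funext->. Qed.

Lemma Lfun2_lin (a b : R) (u v : T -> R) :
  u \in Lfun P 2%:E -> v \in Lfun P 2%:E ->
  (fun t => a * u t + b * v t) \in Lfun P 2%:E.
Proof.
have l12 : 1 <= 2 :> R by rewrite ler1n.
move=> /(Lfun_scale a l12) u2 /(Lfun_scale b l12) v2.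
apply: Lfun2_ext ((@Lfun_addr_closed _ _ _ P 2%:E (lee1n 2)).2 _ _ u2 v2) => t.
by rewrite [LHS]/GRing.add/= [u t * a]mulrC [v t * b]mulrC.
Qed.

Lemma L2D x y : L2 P x -> L2 P y -> L2 P (fun t => x t + y t).
Proof.
move=> [xr xi] [yr yi]; split.
  apply: Lfun2_ext (Lfun2_lin 1 1 xr yr) => t.
  rewrite !mul1r; exact: (esym (CReD (x t) (y t))).
apply: Lfun2_ext (Lfun2_lin 1 1 xi yi) => t.
rewrite !mul1r; exact: (esym (CImD (x t) (y t))).
Qed.

Lemma L2Z c x : L2 P x -> L2 P (fun t => c * x t).
Proof.
move=> [xr xi]; split.
  apply: Lfun2_ext (Lfun2_lin (CRe c) (- CIm c) xr xi) => t.
  by rewrite mulNr /= CReM.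
apply: Lfun2_ext (Lfun2_lin (CRe c) (CIm c) xi xr) => t.
exact: (esym (CImM c (x t))).
Qed.

Lemma L2_0 : L2 P (fun=> 0).
Proof.
by split; rewrite (_ : _ \o _ = (cst 0 : T -> R)) ?Lfun_cst//; apply/funext.
Qed.

Lemma L2B x y : L2 P x -> L2 P y -> L2 P (fun t => x t - y t).
Proof.
move=> Lx Ly; rewrite (_ : (fun t => _) = (fun t => x t + -1 * y t)).
  exact: L2D Lx (L2Z _ Ly).
by apply/funext => t; rewrite mulN1r.
Qed.

Lemma L2_sum I (s : seq I) (F : I -> T -> R[i]) :
  (forall i, L2 P (F i)) -> L2 P (fun t => \sum_(i <- s) F i t).
Proof.
move=> LF; elim: s => [|i s ih].
  by under eq_fun do rewrite big_nil; exact: L2_0.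
by under eq_fun do rewrite big_cons; exact: L2D.
Qed.

Lemma cintegrable_inner x y : L2 P x -> L2 P y ->
  cintegrable P setT (fun t => x t * (y t)^*).
Proof.
move=> [xr xi] [yr yi].
have iM (u v : T -> R) : u \in Lfun P 2%:E -> v \in Lfun P 2%:E ->
    P.-integrable setT (EFin \o (u \* v)).
  by move=> u2 v2; apply/Lfun1_integrable; exact: Lfun2_mul_Lfun1.
split.
  apply: eq_integrable (integrableD measurableT (iM _ _ xr yr) (iM _ _ xi yi)) => //.
  by move=> t _ /=; rewrite conjE CReM/= mulrN opprK.
apply: eq_integrable (integrableB measurableT (iM _ _ xi yr) (iM _ _ xr yi)) => //.
by move=> t _ /=; rewrite conjE CImM/= mulrN [in RHS]addrC.
Qed.

Definition nrm2 x : R := CRe (inner P x x).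

Lemma innerC x y : L2 P x -> L2 P y -> inner P y x = (inner P x y)^*.
Proof.
move=> Lx Ly; rewrite /inner -cintegral_conj; last 2 first.
- exact: measurableT.
- exact: cintegrable_inner.
by apply: eq_cintegral => t _; rewrite rmorphM/= conjCK mulrC.
Qed.

Lemma innerDl x y z : L2 P x -> L2 P y -> L2 P z ->
  inner P (fun t => x t + y t) z = inner P x z + inner P y z.
Proof.
move=> Lx Ly Lz; rewrite -cintegralD//; last 2 first.
- exact: cintegrable_inner.
- exact: cintegrable_inner.
by apply: eq_cintegral => t _; rewrite mulrDl.
Qed.

Lemma innerZl c x z : L2 P x -> L2 P z ->
  inner P (fun t => c * x t) z = c * inner P x z.
Proof.
move=> Lx Lz; rewrite -cintegralZ//; last exact: cintegrable_inner.
by apply: eq_cintegral => t _; rewrite mulrA.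
Qed.

Lemma inner0l z : inner P (fun=> 0) z = 0.
Proof.
rewrite -[RHS](cintegral0 P measurableT).
by apply: eq_cintegral => t _; rewrite mul0r.
Qed.

Lemma innerBl x y z : L2 P x -> L2 P y -> L2 P z ->
  inner P (fun t => x t - y t) z = inner P x z - inner P y z.
Proof.
move=> Lx Ly Lz; rewrite -[- inner P y z]mulN1r -innerZl// -innerDl//; last exact: L2Z.
by congr inner; apply/funext => t; rewrite mulN1r.
Qed.

Lemma innerBr x y z : L2 P x -> L2 P y -> L2 P z ->
  inner P z (fun t => x t - y t) = inner P z x - inner P z y.
Proof.
move=> Lx Ly Lz; rewrite innerC//; last exact: L2B.
by rewrite innerBl// rmorphB/= -!innerC//.
Qed.

Lemma innerZr c x z : L2 P x -> L2 P z ->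
  inner P z (fun t => c * x t) = c^* * inner P z x.
Proof.
move=> Lx Lz; rewrite innerC//; last exact: L2Z.
by rewrite innerZl// rmorphM/= -innerC.
Qed.

Lemma inner_suml I (s : seq I) (c : I -> R[i]) (F : I -> T -> R[i]) z :
  (forall i, L2 P (F i)) -> L2 P z ->
  inner P (fun t => \sum_(i <- s) c i * F i t) z = \sum_(i <- s) c i * inner P (F i) z.
Proof.
move=> LF Lz; elim: s => [|i s ih].
  by rewrite big_nil; apply: etrans (inner0l z); congr inner; apply/funext => t; rewrite big_nil.
rewrite big_cons -ih -innerZl// -innerDl//; last 2 first.
- exact: L2Z.
- by apply: L2_sum => j; exact: L2Z.
by congr inner; apply/funext => t; rewrite big_cons.
Qed.

Lemma inner_sumr I (s : seq I) (c : I -> R[i]) (F : I -> T -> R[i]) z :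
  (forall i, L2 P (F i)) -> L2 P z ->
  inner P z (fun t => \sum_(i <- s) c i * F i t) =
  \sum_(i <- s) (c i)^* * inner P z (F i).
Proof.
move=> LF Lz; rewrite innerC//; last by apply: L2_sum => j; exact: L2Z.
rewrite inner_suml// rmorph_sum/=; apply: eq_bigr => i _.
by rewrite rmorphM/= -innerC.
Qed.

Lemma nrm2E x : nrm2 x = \int[P]_t (normc (x t) ^+ 2).
Proof.
by rewrite /nrm2 /= ; apply: eq_Rintegral => t _; rewrite mulc_conj.
Qed.

Lemma nrm2_ge0 x : 0 <= nrm2 x.
Proof. by rewrite nrm2E; apply: Rintegral_ge0 => t _; rewrite sqr_ge0. Qed.

Lemma innerxx x : inner P x x = (nrm2 x)%:C.
Proof.
rewrite nrm2E -cintegral_real; last exact: measurableT.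
by apply: eq_cintegral => t _; rewrite mulc_conj.
Qed.

Lemma nrm2B x y : L2 P x -> L2 P y ->
  nrm2 (fun t => x t - y t) = nrm2 x - 2 * CRe (inner P x y) + nrm2 y.
Proof.
move=> Lx Ly; have LB := L2B Lx Ly.
rewrite /nrm2 innerBl// !innerBr// (innerC Lx Ly) conjE !(CReD, CReN)/=; ring.
Qed.

Lemma nrm2Z c x : L2 P x -> nrm2 (fun t => c * x t) = normc c ^+ 2 * nrm2 x.
Proof.
move=> Lx; have LZ := L2Z c Lx.
rewrite /nrm2 innerZl// innerC// innerZl// rmorphM/= -innerC//.
by rewrite mulrA mulc_conj CReM/= mul0r subr0.
Qed.

(** Positivity of [nrm2] of x - k <x, y> y for every real k; the best k is the inverse of
    [nrm2 y]. *)
Lemma inner_CS x y : L2 P x -> L2 P y ->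
  normc (inner P x y) ^+ 2 <= nrm2 x * nrm2 y.
Proof.
move=> Lx Ly; set s := normc _ ^+ 2.
have key (k : R) : 0 <= nrm2 x - 2 * k * s + k ^+ 2 * s * nrm2 y.
  have LZ := L2Z (k%:C * inner P x y) Ly.
  have := nrm2_ge0 (fun t => x t - k%:C * inner P x y * y t).
  rewrite nrm2B// nrm2Z// Normc.normcM normc_real exprMn real_normK ?num_real// -/s.
  rewrite innerZr// (_ : _^* * _ = (k * s)%:C); first by rewrite /= mulrA.
  rewrite rmorphM -mulrA [in RHS]rmorphM; congr (_ * _).
    by rewrite /= conjE/= oppr0.
  by rewrite /= /s -mulc_conj mulrC.
have s0 : 0 <= s by rewrite sqr_ge0.
have := nrm2_ge0 y; rewrite le_eqVlt => /orP[/eqP y0|y0].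
  rewrite -y0 mulr0 leNgt; apply/negP => s1.
  (* Since [nrm2 y] vanishes here, the quadratic in k is affine; this k gives it the value -1. *)
  have := key ((nrm2 x + 1) / (2 * s)).
  rewrite -y0 (_ : _ + _ = -1); last by field; rewrite gt_eqF.
  by rewrite ler0N1.
have := key (nrm2 y)^-1.
rewrite (_ : _ + _ = nrm2 x - s / nrm2 y); last by field; rewrite gt_eqF.
by rewrite subr_ge0 ler_pdivrMr.
Qed.

Lemma inner_null x y : L2 P x -> L2 P y -> nrm2 y = 0 -> inner P x y = 0.
Proof.
move=> Lx Ly y0; have := inner_CS Lx Ly; rewrite y0 mulr0 => h.
by apply/eqP; rewrite -normc_eq0 -sqrf_eq0 eq_le h sqr_ge0.
Qed.

End L2Theory.

(** * Completeness of L^2 *)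

Section RieszFischer.
Context {disp : measure_display} {T : measurableType disp} {R : realType}.
Variable P : probability T R.

Let sqnorm (u : T -> R) : R := \int[P]_t (u t ^+ 2).

Let Lfun2B (u v : T -> R) : u \in Lfun P 2%:E -> v \in Lfun P 2%:E ->
  (fun t => u t - v t) \in Lfun P 2%:E.
Proof.
move=> u2 v2; apply: Lfun2_ext (Lfun2_lin 1 (-1) u2 v2) => t.
by rewrite mul1r mulN1r.
Qed.

Let Lfun2_meas (u : T -> R) : u \in Lfun P 2%:E -> measurable_fun setT u.
Proof. by move=> /Lfun2P[]. Qed.

Let integral_sq (u : T -> R) : u \in Lfun P 2%:E ->
  (\int[P]_t (u t ^+ 2)%:E)%E = (sqnorm u)%:E.
Proof.
move=> /Lfun2P[_ iu]; rewrite /sqnorm /Rintegral fineK//.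
exact: integrable_fin_num.
Qed.

(** AM-GM: |u| <= u^2 / (2 e) + e / 2, integrated against a probability. *)
Let integral_abs_le (u : T -> R) (e : R) : 0 < e -> u \in Lfun P 2%:E ->
  sqnorm u <= e ^+ 2 -> (\int[P]_t `|u t|%:E <= e%:E)%E.
Proof.
move=> e0 u2 ue; have /Lfun2P[mu iu] := u2.
apply: (@le_trans _ _ (\int[P]_t ((2 * e)^-1%:E * (u t ^+ 2)%:E + (e / 2)%:E)))%E.
  apply: ge0_le_integral => //.
  - by apply/measurable_EFinP; exact: measurableT_comp.
  - apply: emeasurable_funD => //.
    by apply: measurable_funeM; exact: measurable_int iu.
  - move=> t _; rewrite -EFinM -EFinD lee_fin -(real_normK (num_real (u t))) -subr_ge0.
    set a := `|u t|.
    rewrite (_ : _ - _ = (2 * e)^-1 * (a - e) ^+ 2); last by field; rewrite gt_eqF.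
    by rewrite mulr_ge0 ?sqr_ge0// invr_ge0 mulr_ge0// ltW.
rewrite integralD//; last 2 first.
- exact: integrableZl.
- exact: finite_measure_integrable_cst.
rewrite integralZl//= integral_sq// integral_cst//.
rewrite [X in ((e / 2)%:E * X)%E](_ : _ = 1%E) ?mule1; last exact: probability_setT.
rewrite -EFinM -EFinD lee_fin -lerBrDr.
rewrite (_ : e - e / 2 = (2 * e)^-1 * e ^+ 2); last by field; rewrite gt_eqF.
by rewrite ler_wpM2l// invr_ge0 mulr_ge0// ltW.
Qed.

(** The L^1 norms of the increments sum to at most 1, so the sum of their moduli is integrable,
    hence finite almost everywhere, and the telescoping series converges there. *)
Let rapid_cvg_ae (w : nat -> T -> R) : (forall j, w j \in Lfun P 2%:E) ->
  (forall j, sqnorm (fun t => w j.+1 t - w j t) <= (1 / (2 ^ j.+1)%:R) ^+ 2) ->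
  exists A, [/\ measurable A, P A = 0%E & forall t, ~ A t -> cvgn (w ^~ t)].
Proof.
move=> w2 we; pose D j t := w j.+1 t - w j t.
have D2 j : D j \in Lfun P 2%:E by exact: Lfun2B.
have mD j : measurable_fun setT (fun t => `|D j t|%:E).
  by apply/measurable_EFinP; apply: measurableT_comp => //; exact: Lfun2_meas.
pose G t := (\sum_(0 <= j <oo) `|D j t|%:E)%E.
have iG : (\int[P]_t G t <= 1%:E)%E.
  rewrite integral_nneseries//.
  apply: le_trans (epsilon_trick0 xpredT (@ler01 R)).
  apply: lee_nneseries => [j _ _|j _]; first exact: integral_ge0.
  by apply: (integral_abs_le _ (D2 j) (we j)); rewrite divr_gt0// ltr0n expn_gt0.
have G0 t : (0 <= G t)%E by apply: nneseries_ge0.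
have mG : measurable_fun setT G by apply: ge0_emeasurable_sum.
have : P.-integrable setT G.
  apply/integrableP; split => //.
  under eq_integral do rewrite gee0_abs//.
  by rewrite (le_lt_trans iG)// ltry.
move=> /(integrable_ae measurableT) [A [mA PA sA]].
exists A; split => // t At.
have Gt : G t \is a fin_num.
  by apply: contrapT => nG; apply: At; apply: sA => /=; move/(_ I).
have cD : cvgn [normed series (D ^~ t)].
  apply: nondecreasing_is_cvgn.
    by apply: nondecreasing_series => *; exact: normr_ge0.
  exists (fine (G t)) => _ [n _ <-].
  rewrite -lee_fin fineK// /series/= -sumEFin.
  exact: (@nneseries_lim_ge _ _ xpredT 0 n).
have /cvg_ex[l cl] := normed_cvg cD.
have sE : w ^~ t = (fun n => w 0%N t + series (D ^~ t) n).
  apply/funext => n; rewrite (_ : D ^~ t = telescope (w ^~ t))// telescopeK/=.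
  by rewrite addrC subrK.
by rewrite sE; apply: is_cvgD; [exact: is_cvg_cst|apply/cvg_ex; exists l].
Qed.

(** Riesz-Fischer: an almost surely convergent subsequence supplies the limit, and Fatou's lemma
    turns the Cauchy bound into a bound on the distance to it. *)
Lemma Lfun2_complete (u : nat -> T -> R) : (forall n, u n \in Lfun P 2%:E) ->
  (forall e, 0 < e -> exists N, forall m n, (N <= m)%N -> (N <= n)%N ->
    \int[P]_t ((u m t - u n t) ^+ 2) <= e) ->
  exists2 v, v \in Lfun P 2%:E &
    forall e, 0 < e -> exists N, forall n, (N <= n)%N ->
      \int[P]_t ((u n t - v t) ^+ 2) <= e.
Proof.
move=> u2 uC.
have e0 j : 0 < (1 / (2 ^ j.+1)%:R) ^+ 2 :> R.
  by rewrite exprn_gt0// divr_gt0// ltr0n expn_gt0.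
have /choice[k kP] j : exists N, forall m n, (N <= m)%N -> (N <= n)%N ->
  \int[P]_t ((u m t - u n t) ^+ 2) <= (1 / (2 ^ j.+1)%:R) ^+ 2 := uC _ (e0 j).
(* Summing the [k i] makes the extraction nondecreasing and at least [k j]; adding [j] makes it tend
   to infinity. *)
pose kk j := (\sum_(i < j.+1) k i + j)%N.
have le_kk j : (k j <= kk j)%N by rewrite /kk big_ord_recr/= -addnA addnCA leq_addr.
have kkS j : (kk j <= kk j.+1)%N.
  by rewrite /kk [in leqRHS]big_ord_recr/= leq_add// leq_addr.
have kk_ge j : (j <= kk j)%N by rewrite leq_addl.
pose w j := u (kk j).
have w2 j : w j \in Lfun P 2%:E by exact: u2.
have [|A [mA PA wcvg]] := @rapid_cvg_ae w w2.
  by move=> j; apply: kP => //; exact: leq_trans (kkS j).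
(* Putting 0 on the null set gives convergence everywhere, hence a measurable limit. *)
pose v' j t : R := w j t * \1_(~` A) t.
have mv' j : measurable_fun setT (v' j).
  by apply: measurable_funM; [exact: Lfun2_meas|apply: measurable_indic; exact: measurableC].
pose v t := limn (v' ^~ t).
have v'v t : v' ^~ t @ \oo --> v t.
  apply/cvg_ex; have [At|/[dup] nAt /wcvg /cvg_ex[l cl]] := pselect (A t).
    exists 0; rewrite (_ : v' ^~ t = fun=> 0); first exact: cvg_cst.
    by apply/funext => j; rewrite /v' indicE memNset ?mulr0//= => /(_ At).
  exists l; rewrite (_ : v' ^~ t = w ^~ t)//.
  by apply/funext => j; rewrite /v' indicE mem_set ?mulr1.
have mv : measurable_fun setT v.
  by apply: (@measurable_fun_cvg _ _ _ setT v') => // t _; exact: v'v.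
have bound e : 0 < e -> exists N, forall n, (N <= n)%N ->
    (\int[P]_t ((u n t - v t) ^+ 2)%:E <= e%:E)%E.
  move=> /uC[N uN]; exists N => n Nn.
  pose f j t := ((u n t - v' j t) ^+ 2)%:E.
  have mf j : measurable_fun setT (f j).
    apply/measurable_EFinP; apply: measurable_funX; apply: measurable_funB => //.
    exact: Lfun2_meas.
  have fv t : limn_einf (f ^~ t) = ((u n t - v t) ^+ 2)%:E.
    apply: (cvg_limn_einf_sup _).1; apply: cvg_EFin; first exact: nearW.
    rewrite /comp/=.
    apply: (@cvg_comp _ _ _ (fun j => u n t - v' j t) (fun x : R => x ^+ 2)).
      by apply: cvgB; [exact: cvg_cst|exact: v'v].
    exact: exprn_continuous.
  under eq_integral do rewrite -fv.
  apply: le_trans (fatou _ measurableT mf _) _.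
    by move=> j t _; rewrite lee_fin sqr_ge0.
  rewrite limn_einf_lim; apply: lime_le; first exact: is_cvg_einfs.
  near=> j; apply: (@le_trans _ _ (\int[P]_t f j t)%E).
    by apply: ereal_inf_lbound; exists j => /=.
  rewrite (_ : (\int[P]_t f j t)%E = (\int[P]_t ((u n t - w j t) ^+ 2)%:E)%E).
    rewrite integral_sq; last by exact: Lfun2B.
    rewrite lee_fin; apply: uN => //; apply: leq_trans (kk_ge j).
    by near: j; exact: nbhs_infty_ge.
  apply: ae_eq_integral => //.
    by apply/measurable_EFinP/measurable_funX/measurable_funB; exact: Lfun2_meas.
  exists A; split => // t /= nft; apply: contrapT => nAt; apply: nft => _.
  by rewrite /f /v' indicE mem_set ?mulr1.
have v2 : v \in Lfun P 2%:E.
  have [N /(_ N (leqnn N)) bN] := bound 1 ltr01.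
  have uv2 : (fun t => u N t - v t) \in Lfun P 2%:E.
    have muv : measurable_fun setT (fun t => u N t - v t).
      by apply: measurable_funB => //; exact: Lfun2_meas.
    apply/Lfun2P; split => //; apply/integrableP; split.
      by apply/measurable_EFinP; exact: measurable_funX.
    under eq_integral => t _ do rewrite gee0_abs ?lee_fin ?sqr_ge0//.
    by rewrite (le_lt_trans bN)// ltry.
  by apply: Lfun2_ext (Lfun2B (u2 N) uv2) => t; rewrite opprB addrC subrK.
exists v => // e /bound[N bN]; exists N => n /bN.
by rewrite integral_sq ?lee_fin//; exact: Lfun2B.
Unshelve. all: by end_near.
Qed.

Lemma L2_complete (y : nat -> T -> R[i]) : (forall n, L2 P (y n)) ->
  (forall e, 0 < e -> exists N, forall m n, (N <= m)%N -> (N <= n)%N ->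
    nrm2 P (fun t => y m t - y n t) <= e) ->
  exists2 z, L2 P z & forall e, 0 < e -> exists N, forall n, (N <= n)%N ->
    nrm2 P (fun t => y n t - z t) <= e.
Proof.
move=> Ly yC.
have nrm2RI x : L2 P x ->
    nrm2 P x = \int[P]_t (CRe (x t) ^+ 2) + \int[P]_t (CIm (x t) ^+ 2).
  move=> [/Lfun2P[_ xr] /Lfun2P[_ xi]]; rewrite nrm2E -RintegralD//.
  by apply: eq_Rintegral => t _; rewrite sqr_normcE.
have sq_ge0 (u : T -> R) : 0 <= \int[P]_t (u t ^+ 2).
  by apply: Rintegral_ge0 => t _; exact: sqr_ge0.
have [|e e0|vr vr2 vrP] := @Lfun2_complete (fun n t => CRe (y n t)).
- by move=> n; case: (Ly n).
- have [N yN] := yC _ e0; exists N => m n Nm Nn; apply: le_trans (yN _ _ Nm Nn).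
  rewrite nrm2RI; last exact: L2B.
  under eq_Rintegral do rewrite -CReN -CReD.
  by rewrite lerDl sq_ge0.
have [|e e0|vi vi2 viP] := @Lfun2_complete (fun n t => CIm (y n t)).
- by move=> n; case: (Ly n).
- have [N yN] := yC _ e0; exists N => m n Nm Nn; apply: le_trans (yN _ _ Nm Nn).
  rewrite nrm2RI; last exact: L2B.
  under eq_Rintegral do rewrite -CImN -CImD.
  by rewrite lerDr sq_ge0.
have Lz : L2 P (fun t => vr t +i* vi t) by split.
exists (fun t => vr t +i* vi t) => // e e0.
have e20 : 0 < e / 2 by rewrite divr_gt0.
have [N1 rP] := vrP _ e20; have [N2 iP] := viP _ e20.
exists (maxn N1 N2) => n; rewrite geq_max => /andP[N1n N2n].
rewrite nrm2RI; last exact: L2B.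
rewrite [e]splitr lerD//.
  by under eq_Rintegral do rewrite CReD CReN/=; exact: rP.
by under eq_Rintegral do rewrite CImD CImN/=; exact: iP.
Qed.

End RieszFischer.

(** * Linear prediction *)

Section Projections.
Context {disp : measure_display} {T : measurableType disp} {R : realType}.
Variable P : probability T R.

(** Gram-Schmidt, one generator at a time: [v k] is replaced by its residual [v'] against the other
    generators. *)
Lemma finite_projection (I : eqType) (v : I -> T -> R[i]) (s : seq I) :
  (forall i, L2 P (v i)) -> uniq s -> forall x, L2 P x ->
  exists c : I -> R[i], forall j, j \in s ->
    inner P (fun t => x t - \sum_(i <- s) c i * v i t) (v j) = 0.
Proof.
move=> Lv; elim: s => [|k s ih] /=; first by exists (fun=> 0).
move=> /andP[ks us] x Lx.
have LS (c : I -> R[i]) : L2 P (fun t => \sum_(i <- s) c i * v i t).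
  by apply: L2_sum => i; exact: L2Z.
have [b bP] := ih us _ (Lv k); have [c cP] := ih us _ Lx.
pose v' t := v k t - \sum_(i <- s) b i * v i t.
have Lv' : L2 P v' by exact: L2B.
(* If [v'] is null the quotient takes the default value 0, and [lv'] still holds because
   [inner P x v'] then vanishes. *)
pose l := inner P x v' / inner P v' v'.
have Lx' : L2 P (fun t => x t - \sum_(i <- s) c i * v i t) by exact: L2B.
have Llv : L2 P (fun t => l * v' t) by exact: L2Z.
have v'v j : j \in s -> inner P (v j) v' = 0.
  by move=> js; rewrite innerC// bP// rmorph0.
have lv' : l * inner P v' v' = inner P x v'.
  rewrite /l; have [n0|n0] := eqVneq (nrm2 P v') 0.
    by rewrite (inner_null Lx Lv' n0) !mul0r.
  rewrite mulfVK// innerxx; apply: contra n0 => /eqP[->].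
  by [].
exists (fun i => if i == k then l else c i - l * b i) => j.
rewrite (_ : (fun t => _) =
    (fun t => (x t - \sum_(i <- s) c i * v i t) - l * v' t)); last first.
  apply/funext => t; rewrite big_cons eqxx /v'.
  rewrite (eq_big_seq (fun i => c i * v i t - l * (b i * v i t))); last first.
    move=> i si; case: eqP => [ik|_]; last by rewrite mulrBl mulrA.
    by rewrite -ik si in ks.
  rewrite sumrB -mulr_sumr; ring.
have js0 i : i \in s ->
    inner P (fun t => x t - \sum_(i <- s) c i * v i t - l * v' t) (v i) = 0.
  move=> si; rewrite innerBl// cP// innerZl// bP// mulr0 subrr.
  by [].
have v'0 : inner P (fun t => x t - \sum_(i <- s) c i * v i t - l * v' t) v' = 0.
  rewrite innerBl// innerZl// lv' innerBl// inner_suml// big_seq big1 ?subr0 ?subrr//.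
  by move=> i si; rewrite v'v// mulr0.
rewrite inE => /orP[/eqP->|]; last exact: js0.
rewrite (_ : v k = fun t => v' t + \sum_(i <- s) b i * v i t); last first.
  by apply/funext => t; rewrite subrK.
have Ly : L2 P (fun t => x t - \sum_(i <- s) c i * v i t - l * v' t) by exact: L2B.
rewrite innerC//; last exact: L2D.
rewrite innerDl// rmorphD/= -innerC// v'0 add0r inner_suml// rmorph_sum/=.
rewrite big_seq big1// => i si; rewrite rmorphM/= -innerC// js0// mulr0.
by [].
Qed.

Variables (q : nat) (X : int -> T -> 'cV[R[i]]_q).
Hypothesis LX : forall k i, L2 P (fun t => X k t i 0).
Implicit Types (K : set int) (x y z : T -> R[i]).

(** In [lin_span] the coefficient is a function of the generator. With a list of
    coefficient-generator pairs, sums become concatenations; repeated generators are merged by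
    adding their coefficients. *)
Lemma lin_spanP K y : lin_span X K y <->
  exists2 s : seq (R[i] * (int * 'I_q)), (forall p, p \in s -> K p.2.1) &
    y = fun t => \sum_(p <- s) p.1 * X p.2.1 t p.2.2 0.
Proof.
split=> [[s [c [sK ->]]]|[s sK ->]].
  exists [seq (c p, p) | p <- s]; first by move=> _ /mapP[p ps ->]; exact: sK.
  by apply/funext => t; rewrite big_map.
exists (undup (map snd s)), (fun p => \sum_(r <- s | r.2 == p) r.1); split.
  by move=> p; rewrite mem_undup => /mapP[r rs ->]; exact: sK.
apply/funext => t.
under [RHS]eq_bigr => p _ do rewrite mulr_suml.
rewrite [RHS](exchange_big_dep predT)//=; apply: eq_big_seq => r rs.
rewrite (eq_bigl (pred1 r.2)); last by move=> p /=; rewrite eq_sym.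
rewrite -big_filter filter_pred1_uniq ?undup_uniq ?mem_undup ?map_f//.
by rewrite big_seq1.
Qed.

Lemma lin_span_L2 K y : lin_span X K y -> L2 P y.
Proof. by move=> /lin_spanP[s _ ->]; apply: L2_sum => p; exact: L2Z. Qed.

Lemma lin_spanD K y z : lin_span X K y -> lin_span X K z ->
  lin_span X K (fun t => y t + z t).
Proof.
move=> /lin_spanP[s sK ->] /lin_spanP[r rK ->]; apply/lin_spanP.
exists (s ++ r); first by move=> p; rewrite mem_cat => /orP[/sK|/rK].
by apply/funext => t; rewrite big_cat.
Qed.

Lemma lin_spanZ K c y : lin_span X K y -> lin_span X K (fun t => c * y t).
Proof.
move=> /lin_spanP[s sK ->]; apply/lin_spanP.
exists [seq (c * p.1, p.2) | p <- s].
  by move=> _ /mapP[p ps ->] /=; exact: sK.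
by apply/funext => t; rewrite big_map mulr_sumr; apply: eq_bigr => p _; rewrite mulrA.
Qed.

Lemma lin_spanB K y z : lin_span X K y -> lin_span X K z ->
  lin_span X K (fun t => y t - z t).
Proof.
move=> yK /(lin_spanZ (-1)) zK.
rewrite (_ : (fun t => _) = fun t => y t + -1 * z t); first exact: lin_spanD.
by apply/funext => t; rewrite mulN1r.
Qed.

Lemma lin_span_gen K k i : K k -> lin_span X K (fun t => X k t i 0).
Proof.
move=> kK; apply/lin_spanP; exists [:: (1, (k, i))].
  by move=> p; rewrite inE => /eqP->.
by apply/funext => t; rewrite big_seq1 mul1r.
Qed.

Lemma lin_spanS K L y : K `<=` L -> lin_span X K y -> lin_span X L y.
Proof.
by move=> KL /lin_spanP[s sK ->]; apply/lin_spanP; exists s => // p /sK /KL.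
Qed.

Lemma lin_span_ortho K y z : L2 P y ->
  (forall k i, K k -> inner P y (fun t => X k t i 0) = 0) ->
  lin_span X K z -> inner P y z = 0.
Proof.
move=> Ly yX /lin_spanP[s sK ->].
rewrite (inner_sumr s (fun p => p.1) (F := fun p t => X p.2.1 t p.2.2 0))//.
by rewrite big_seq big1// => p ps; rewrite yX ?mulr0//; exact: sK.
Qed.

(** Cauchy-Schwarz: <y, z> = <y, z - z'> for every z' in S, and z' can be taken arbitrarily close to
    z. *)
Lemma closure_ortho (S : set (T -> R[i])) y z : (forall z, S z -> L2 P z) ->
  L2 P y -> (forall z, S z -> inner P y z = 0) -> L2_closure P S z -> inner P y z = 0.
Proof.
move=> LS Ly yS [Lz zS]; apply/eqP; rewrite -normc_eq0 eq_le normc_ge0 andbT.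
rewrite leNgt; apply/negP => a0; set a := normc _ in a0.
pose e := a / (nrm2 P y + 1).
have y0 := nrm2_ge0 P y.
have e0 : 0 < e by rewrite divr_gt0// ltr_wpDl.
have [|z' Sz'] := zS e%:C; first by rewrite ltcR.
have Lzz : L2 P (fun t => z t - z' t) by apply: L2B => //; exact: LS.
rewrite innerxx -rmorphXn/= ltcR => dz.
have := inner_CS Ly Lzz; rewrite innerBr//; last exact: LS.
rewrite (yS z')// subr0 -/a.
apply/negP; rewrite -ltNge.
apply: (@le_lt_trans _ _ (nrm2 P y * e ^+ 2)); first by rewrite ler_wpM2l// ltW.
rewrite /e; move: (nrm2 P y) y0 => N N0.
have N1 : 0 < N + 1 by rewrite ltr_wpDl.
rewrite -subr_gt0 (_ : _ - _ = a ^+ 2 * (N ^+ 2 + N + 1) / (N + 1) ^+ 2); last first.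
  by field; rewrite gt_eqF.
by rewrite divr_gt0// ?exprn_gt0// mulr_gt0 ?exprn_gt0// ltr_wpDl// addr_ge0// sqr_ge0.
Qed.

Lemma nrm2BC x y : nrm2 P (fun t => x t - y t) = nrm2 P (fun t => y t - x t).
Proof. by rewrite !nrm2E; apply: eq_Rintegral => t _; rewrite -normcN opprB. Qed.

(** The property by which [orth_proj] chooses its value on the complement, so that a residual
    obtained by other means can stand in for the chosen one. *)
Definition is_residual K x y := orth_compl P X K y /\
  forall z, orth_compl P X K z -> inner P (fun t => x t - y t) z = 0.

Lemma residualI K x y : L2 P x -> closed_span P X setT y ->
  (forall k i, K k -> inner P y (fun t => X k t i 0) = 0) ->
  closed_span P X K (fun t => x t - y t) -> is_residual K x y.
Proof.
move=> Lx yT yX xyK; have Ly : L2 P y by case: yT.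
have yK z : closed_span P X K z -> inner P y z = 0.
  apply: closure_ortho => //; first exact: lin_span_L2.
  by move=> z'; exact: lin_span_ortho.
split=> [//|z [[Lz _] zK]].
by rewrite innerC ?zK ?rmorph0//; case: xyK.
Qed.

(** Two residuals of the same variable differ by an element of the complement that is orthogonal to
    it, hence null; inner products do not see which one [orth_proj] has picked. *)
Lemma residual_inner K x x' y y' : L2 P x -> L2 P x' ->
  is_residual K x y -> is_residual K x' y' ->
  inner P (orth_proj P (orth_compl P X K) x) (orth_proj P (orth_compl P X K) x') =
  inner P y y'.
Proof.
have aux x0 y0 : L2 P x0 -> is_residual K x0 y0 ->
    let p := orth_proj P (orth_compl P X K) x0 in
    L2 P p /\ nrm2 P (fun t => p t - y0 t) = 0.
  move=> Lx yR p; have pR : is_residual K x0 p by apply: xgetPex; exists y0.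
  have Ly : L2 P y0 by case: yR => -[[]].
  have Lp : L2 P p by case: pR => -[[]].
  split=> //; suff -> : nrm2 P (fun t => p t - y0 t) =
     CRe (inner P (fun t => x0 t - y0 t) p - inner P (fun t => x0 t - p t) p -
          (inner P (fun t => x0 t - y0 t) y0 - inner P (fun t => x0 t - p t) y0)).
    have [Oy hy] := yR; have [Op hp] := pR.
    by rewrite (hy _ Op) (hp _ Op) (hy _ Oy) (hp _ Oy) !subr0.
  rewrite /nrm2 innerBl//; last exact: L2B.
  rewrite !innerBr// !innerBl//; congr CRe; ring.
move=> Lx Lx' yR yR'.
have [Lp np] := aux _ _ Lx yR; have [Lp' np'] := aux _ _ Lx' yR'.
have Ly : L2 P y by case: yR => -[[]].
have Ly' : L2 P y' by case: yR' => -[[]].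
move: Lp np Lp' np'; set p := orth_proj _ _ x; set p' := orth_proj _ _ x'.
move=> Lp np Lp' np'.
have h : inner P (fun t => p t - y t) p' = 0.
  by rewrite innerC ?inner_null ?rmorph0//; exact: L2B.
have h' : inner P y (fun t => p' t - y' t) = 0 by rewrite inner_null//; exact: L2B.
rewrite innerBl// in h; rewrite innerBr// in h'.
by rewrite (subr0_eq h) (subr0_eq h').
Qed.

Lemma error_covE K k (y : 'I_q -> T -> R[i]) :
  (forall i, is_residual K (fun t => X k t i 0) (y i)) ->
  error_cov P X K k = \matrix_(i, j) inner P (y i) (y j).
Proof.
move=> yR; apply/matrixP => i j; rewrite !mxE -(residual_inner _ _ (yR i) (yR j))//.
by apply: eq_cintegral => t _; rewrite !mxE big_ord1 !mxE.
Qed.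

Lemma L2_closureI (S : set (T -> R[i])) z : L2 P z ->
  (forall e, 0 < e -> exists2 w, S w & nrm2 P (fun t => z t - w t) <= e) ->
  L2_closure P S z.
Proof.
(* Positivity in [R[i]] forces the tolerance to be real. *)
move=> Lz zS; split=> // e; rewrite ltcE => /= /andP[/eqP e2 e1].
have e0 : 0 < CRe e ^+ 2 / 2 by rewrite divr_gt0// exprn_gt0.
have [w Sw wz] := zS _ e0; exists w => //.
have -> : e = (CRe e)%:C by apply: complex_eqP.
rewrite innerxx -rmorphXn/= ltcR (le_lt_trans wz)//.
by rewrite ltr_pdivrMr// ltr_pMr ?exprn_gt0// ltr1n.
Qed.

Lemma sub_closure (S : set (T -> R[i])) z : L2 P z -> S z -> L2_closure P S z.
Proof.
move=> Lz Sz; apply: L2_closureI => // e e0; exists z => //.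
rewrite (_ : (fun t => _) = fun=> 0) ?/nrm2 ?inner0l ?ltW//.
by apply/funext => t; rewrite subrr.
Qed.

(** Closure-free variant of [is_residual]: the predictor is an explicit finite combination, as is
    available for finitely many times. *)
Definition fin_residual K x y := lin_span X K (fun t => x t - y t) /\
  forall k i, K k -> inner P y (fun t => X k t i 0) = 0.

Lemma fin_residual_lin_span K L x y : K `<=` L -> lin_span X L x ->
  fin_residual K x y -> lin_span X L y.
Proof.
move=> KL xL [/(lin_spanS KL) xyL _].
rewrite (_ : y = fun t => x t - (x t - y t)); first exact: lin_spanB.
by apply/funext => t; rewrite subKr.
Qed.

Lemma fin_residualW K x y : lin_span X setT x -> fin_residual K x y ->
  is_residual K x y.
Proof.
move=> xT yR; have [xyK yX] := yR.
have yT := fin_residual_lin_span (@subsetT _ K) xT yR.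
apply: residualI => //; first exact: lin_span_L2 xT.
  by apply: sub_closure => //; exact: lin_span_L2 yT.
by apply: sub_closure => //; exact: lin_span_L2 xyK.
Qed.

Lemma fin_residual_exists (s : seq int) x : L2 P x ->
  exists y, fin_residual [set` s] x y.
Proof.
move=> Lx; pose v (p : int * 'I_q) t := X p.1 t p.2 0.
pose s' := undup [seq (k, i) | k <- s, i <- enum 'I_q].
have [c cP] := finite_projection (v := v) (fun p => LX p.1 p.2) (undup_uniq _ : uniq s') Lx.
exists (fun t => x t - \sum_(p <- s') c p * v p t); split.
  apply/lin_spanP; exists [seq (c p, p) | p <- s'].
    move=> _ /mapP[p + ->] /=; rewrite mem_undup => /allpairsP[[k i] /= [ks _ ->]].
    exact: ks.
  by apply/funext => t; rewrite subKr big_map.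
move=> k i ks; apply: (cP (k, i)).
by rewrite mem_undup; apply/allpairsP; exists (k, i); rewrite mem_enum.
Qed.

(** Pythagoras: y - z lies in the span over L, to which z is orthogonal. *)
Lemma fin_residual_nrm2B K L x y z : K `<=` L -> L2 P x ->
  fin_residual K x y -> fin_residual L x z ->
  nrm2 P (fun t => y t - z t) = nrm2 P y - nrm2 P z.
Proof.
move=> KL Lx [xyK _] [xzL zL].
have Lxy := lin_span_L2 xyK; have Lxz := lin_span_L2 xzL.
have Ly : L2 P y.
  by rewrite (_ : y = fun t => x t - (x t - y t)); [exact: L2B|apply/funext => t; rewrite subKr].
have Lz : L2 P z.
  by rewrite (_ : z = fun t => x t - (x t - z t)); [exact: L2B|apply/funext => t; rewrite subKr].
have : inner P z (fun t => (x t - z t) - (x t - y t)) = 0.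
  by apply: lin_span_ortho zL _ => //; apply: lin_spanB => //; exact: lin_spanS xyK.
rewrite (_ : (fun t => _) = fun t => y t - z t); last by apply/funext => t; ring.
rewrite innerBr// => /subr0_eq zy.
rewrite nrm2B// (innerC Lz Ly) zy {1}innerxx conjE/= /nrm2; ring.
Qed.

Lemma nonincreasing_cauchy (a : nat -> R) : (forall n, 0 <= a n) ->
  (forall m n, (m <= n)%N -> a n <= a m) ->
  forall e, 0 < e -> exists N, forall m, (N <= m)%N -> a N - a m <= e.
Proof.
move=> a0 an e e0.
have ia : has_inf (range a).
  by split; [exists (a 0%N), 0%N|exists 0 => _ [n _ <-]].
have [_ [N _ <-] aN] := inf_adherent e0 ia.
exists N => m Nm; rewrite lerBlDr (le_trans (ltW aN))// addrC lerD2l.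
by apply: ge_inf; [case: ia|exists m].
Qed.

(** The squared norms of the residuals decrease, so by Pythagoras the residuals form a Cauchy
    sequence. Their limit inherits orthogonality to each [Kn n], and x minus the limit is
    approximated by the finite predictors. *)
Lemma residual_cvg K (Kn : nat -> set int) x (y : nat -> T -> R[i]) :
  (forall m n, (m <= n)%N -> Kn m `<=` Kn n) -> K = \bigcup_n Kn n ->
  lin_span X setT x -> (forall n, fin_residual (Kn n) x (y n)) ->
  exists z, [/\ L2 P z, is_residual K x z & forall e, 0 < e ->
    exists N, forall n, (N <= n)%N -> nrm2 P (fun t => y n t - z t) <= e].
Proof.
move=> mono KE xT yR; have Lx := lin_span_L2 xT.
have yT n := fin_residual_lin_span (@subsetT _ (Kn n)) xT (yR n).
have Ly n := lin_span_L2 (yT n).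
have ynm m n : (m <= n)%N ->
    nrm2 P (fun t => y m t - y n t) = nrm2 P (y m) - nrm2 P (y n).
  by move=> mn; exact: fin_residual_nrm2B (mono _ _ mn) Lx (yR m) (yR n).
have yle m n : (m <= n)%N -> nrm2 P (y n) <= nrm2 P (y m).
  by move=> mn; rewrite -subr_ge0 -ynm// nrm2_ge0.
have [z Lz yz] : exists2 z, L2 P z & forall e, 0 < e -> exists N, forall n,
    (N <= n)%N -> nrm2 P (fun t => y n t - z t) <= e.
  apply: L2_complete => // e e0.
  have [N NP] := nonincreasing_cauchy (fun n => nrm2_ge0 P (y n)) yle e0.
  exists N => m n Nm Nn; wlog mn : m n Nm Nn / (m <= n)%N.
    by move=> h; have [/h|/ltnW/h] := leqP m n; last rewrite nrm2BC; apply.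
  by rewrite ynm// (le_trans _ (NP n Nn))// lerD2r yle.
exists z; split=> //; apply: residualI => //.
- apply: L2_closureI => // e /yz[N yN]; exists (y N) => //.
  by rewrite nrm2BC ?yN.
- move=> k i; rewrite KE => -[n0 _ kn0].
  have LXk := LX k i.
  apply/eqP; rewrite -normc_eq0 eq_le normc_ge0 andbT leNgt; apply/negP => a0.
  set a := normc _ in a0.
  have X0 := nrm2_ge0 P (fun t => X k t i 0).
  pose N1 := nrm2 P (fun t => X k t i 0) + 1.
  have N10 : 0 < N1 by rewrite ltr_wpDl.
  have e0 : 0 < a ^+ 2 / N1 / 2 by rewrite !divr_gt0// exprn_gt0.
  have [N yN] := yz _ e0.
  have LyN : L2 P (fun t => y (maxn N n0) t - z t) by exact: L2B.
  have := inner_CS LyN LXk.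
  rewrite innerBl// (yR _).2; last exact: mono (leq_maxr _ _) _ kn0.
  rewrite sub0r normcN -/a; apply/negP; rewrite -ltNge.
  apply: (@le_lt_trans _ _ (a ^+ 2 / N1 / 2 * N1)).
    by apply: ler_pM; rewrite ?nrm2_ge0 ?yN ?leq_maxl// lerDl.
  rewrite (_ : _ * _ = a ^+ 2 / 2); last by field; rewrite gt_eqF.
  by rewrite ltr_pdivrMr// ltr_pMr ?exprn_gt0// ltr1n.
- have Lxz : L2 P (fun t => x t - z t) by exact: L2B.
  apply: L2_closureI => // e /yz[N yN]; exists (fun t => x t - y N t).
    by apply: lin_spanS (yR N).1; rewrite KE; exact: bigcup_sup.
  rewrite (_ : (fun t => _) = fun t => y N t - z t) ?yN//.
  by apply/funext => t; ring.
Qed.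

Lemma inner_cvg (y y' : nat -> T -> R[i]) z z' :
  (forall n, L2 P (y n)) -> (forall n, L2 P (y' n)) -> L2 P z -> L2 P z' ->
  (forall e, 0 < e -> exists N, forall n, (N <= n)%N ->
    nrm2 P (fun t => y n t - z t) <= e) ->
  (forall e, 0 < e -> exists N, forall n, (N <= n)%N ->
    nrm2 P (fun t => y' n t - z' t) <= e) ->
  forall e, 0 < e -> exists N, forall n, (N <= n)%N ->
    normc (inner P (y n) (y' n) - inner P z z') <= e.
Proof.
move=> Ly Ly' Lz Lz' yz yz' e e0.
pose M := 1 + nrm2 P z + nrm2 P z'.
have z0 := nrm2_ge0 P z; have z'0 := nrm2_ge0 P z'.
have M1 : 1 <= M by rewrite /M -addrA lerDl addr_ge0.
have M0 : 0 < M by exact: lt_le_trans M1.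
(* Each of the three terms of the expansion below is then at most [d * M], a third of e at most. *)
pose d := Num.min 1 (e / (3 * M)).
have d0 : 0 < d by rewrite /d lt_min ltr01 divr_gt0// mulr_gt0.
have d1 : d <= 1 by rewrite /d ge_min lexx.
have dM : 3 * d * M <= e.
  by rewrite mulrAC -ler_pdivlMl ?mulr_gt0// mulrC /d ge_min lexx orbT.
have d20 : 0 < d ^+ 2 by rewrite exprn_gt0.
have [N1 yN] := yz _ d20; have [N2 yN'] := yz' _ d20.
exists (maxn N1 N2) => n; rewrite geq_max => /andP[/yN yn /yN' yn'].
have LB : L2 P (fun t => y n t - z t) by exact: L2B.
have LB' : L2 P (fun t => y' n t - z' t) by exact: L2B.
have bound u v a b : L2 P u -> L2 P v -> 0 <= a -> 0 <= b ->
    nrm2 P u <= a ^+ 2 -> nrm2 P v <= b ^+ 2 -> normc (inner P u v) <= a * b.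
  move=> Lu Lv a0 b0 ua vb.
  rewrite -(@ler_pXn2r _ 2)// ?nnegrE ?normc_ge0 ?mulr_ge0// exprMn.
  by apply: (le_trans (inner_CS Lu Lv)); apply: ler_pM; rewrite ?nrm2_ge0.
have MM : M <= M ^+ 2 by rewrite expr2 ler_peMl// ltW.
have zM : nrm2 P z <= M ^+ 2 by apply: le_trans MM; rewrite /M; lra.
have zM' : nrm2 P z' <= M ^+ 2 by apply: le_trans MM; rewrite /M; lra.
rewrite (_ : _ - _ = inner P (fun t => y n t - z t) (fun t => y' n t - z' t) +
   (inner P (fun t => y n t - z t) z' + inner P z (fun t => y' n t - z' t))); last first.
  by rewrite !innerBl// !innerBr//; ring.
apply: (le_trans _ dM).
rewrite (_ : 3 * d * M = d * M + (d * M + M * d)); last by ring.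
apply: (le_trans (normcD _ _)); apply: lerD; last first.
  by apply: (le_trans (normcD _ _)); apply: lerD; apply: bound => //; exact: ltW.
apply: (@le_trans _ _ (d * d)); first by apply: bound => //; exact: ltW.
by rewrite ler_wpM2l ?(ltW d0)// (le_trans d1).
Qed.

(** The link between infinite and finite prediction: the inner product is continuous along the
    converging residuals, and finitely many entries share a rank. *)
Lemma error_cov_cvg K (Kn : nat -> seq int) k :
  (forall m n, (m <= n)%N -> {subset Kn m <= Kn n}) ->
  K = \bigcup_n [set` Kn n] -> forall e, 0 < e -> exists N, forall n, (N <= n)%N ->
  forall i j, normc (error_cov P X [set` Kn n] k i j - error_cov P X K k i j) <= e.
Proof.
move=> mono KE.
have xT i : lin_span X setT (fun t => X k t i 0) by exact: lin_span_gen.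
have /choice[y yP] (p : nat * 'I_q) :
    exists y, fin_residual [set` Kn p.1] (fun t => X k t p.2 0) y.
  exact: fin_residual_exists.
have mono' m n : (m <= n)%N -> [set` Kn m] `<=` [set` Kn n].
  by move=> /mono mn a /= /mn.
have /choice[z zP] i := residual_cvg mono' KE (xT i) (fun n => yP (n, i)).
have Ly n i : L2 P (y (n, i)).
  exact: lin_span_L2 (fin_residual_lin_span (@subsetT _ _) (xT i) (yP (n, i))).
have zR i : is_residual K (fun t => X k t i 0) (z i) by case: (zP i).
have Lz i : L2 P (z i) by case: (zP i).
have yz i : forall e, 0 < e -> exists N, forall n, (N <= n)%N ->
  nrm2 P (fun t => y (n, i) t - z i t) <= e by case: (zP i).
move=> e e0.
have /choice[N NP] (p : 'I_q * 'I_q) : exists N, forall n, (N <= n)%N ->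
    normc (inner P (y (n, p.1)) (y (n, p.2)) - inner P (z p.1) (z p.2)) <= e.
  exact: inner_cvg (fun n => Ly n p.1) (fun n => Ly n p.2) (Lz _) (Lz _) (yz _) (yz _) _ e0.
exists (\max_p N p) => n Nn i j.
rewrite (error_covE (y := fun i => y (n, i))); last first.
  by move=> a; exact: fin_residualW (xT a) (yP (n, a)).
rewrite (error_covE zR) !mxE; apply: (NP (i, j)).
by apply: leq_trans Nn; exact: leq_bigmax.
Qed.

End Projections.

(** * The weight of fractional integration and its moments *)

Section FTC.
Context {R : realType}.
Local Notation mu := (@lebesgue_measure R).
Implicit Types (f F : R -> R).

Lemma FTC_regular f F (a b : R) : a < b ->
  (forall x, a <= x <= b -> is_derive x 1 F (f x)) ->
  (forall x, a <= x <= b -> {for x, continuous f}) ->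
  \int[mu]_(x in `[a, b]) f x = F b - F a.
Proof.
move=> ab dF cf.
have cF x : a <= x <= b -> {for x, continuous F}.
  move=> /dF [dFx _]; apply: differentiable_continuous.
  exact/derivable1_diffP.
rewrite /Rintegral (@continuous_FTC2 _ f F)//.
- apply: continuous_in_subspaceT => x; rewrite inE/= in_itv/=; exact: cf.
- split.
  + move=> x; rewrite in_itv/= => /andP[ax xb].
    have xab : a <= x <= b by rewrite !ltW.
    by have [] := dF x xab.
  + by apply: cvg_at_right_filter; apply: cF; rewrite lexx ltW.
  + by apply: cvg_at_left_filter; apply: cF; rewrite lexx ltW.
- move=> x; rewrite in_itv/= => /andP[ax xb]; rewrite derive1E.
  have xab : a <= x <= b by rewrite !ltW.
  by have [_ ->] := dF x xab.
Qed.

Lemma small_interval_integral f (c : R) : 0 < c ->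
  mu.-integrable `[- c, c] (EFin \o f) ->
  forall e, 0 < e -> exists2 r, 0 < r & forall t, 0 < t -> t < r -> t < c ->
    `|\int[mu]_(x in `]- t, t]) f x| <= e.
Proof.
move=> c0 fi e e0.
pose g := f \_ `[- c, c].
have gi : mu.-integrable setT (EFin \o g).
  by rewrite -restrict_EFin; apply/integrable_restrict => //=; rewrite setTI.
have [r [r0 rP]] := @integral_normr_continuous _ _ _ mu g gi _ e0.
exists (r / 2); first by rewrite divr_gt0.
move=> t t0 tr tc.
have sub : `]- t, t] `<=` `[- c, c].
  by move=> x /=; rewrite !in_itv/= => /andP[tx xt]; apply/andP; split; lra.
have fit : mu.-integrable `]- t, t] (EFin \o f) by exact: integrableS fi.
apply: (le_trans (le_normr_Rintegral _ _)) => //.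
rewrite (_ : \int[mu]_(x in _) _ = \int[mu]_(x in `]- t, t]) `|g x|).
  apply/ltW/rP => //.
  have h : mu `]- t, t] = (t + t)%:E.
    by rewrite lebesgue_measure_itv/= lte_fin ifT ?opprK//; lra.
  apply: (@le_lt_trans _ _ (t + t)%:E); last by rewrite lte_fin; lra.
  by rewrite le_eqVlt; apply/orP; left; apply/eqP; exact: h.
apply: eq_Rintegral => x; rewrite inE => /sub xc.
by rewrite /g patchE mem_set.
Qed.

(* The primitive may be singular at 0, as long as it tends to 0 there. *)
Lemma FTC_singular f F (c : R) : 0 < c ->
  (forall x, - c <= x <= c -> x != 0 -> is_derive x 1 F (f x)) ->
  (forall x, - c <= x <= c -> x != 0 -> {for x, continuous f}) ->
  mu.-integrable `[- c, c] (EFin \o f) ->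
  (forall e, 0 < e -> exists2 r, 0 < r & forall t, 0 < `|t| -> `|t| < r -> `|F t| <= e) ->
  \int[mu]_(x in `[- c, c]) f x = F c - F (- c).
Proof.
move=> c0 dF cf fi F0; apply/eqP; rewrite -subr_eq0 -normr_le0.
apply/ler_addgt0Pl => e e0; rewrite addr0.
have e30 : 0 < e / 3 by rewrite divr_gt0.
have [r1 r10 small] := small_interval_integral c0 fi e30.
have [r2 r20 Fsmall] := F0 _ e30.
pose t := Num.min c (Num.min r1 r2) / 2.
have m0 : 0 < Num.min c (Num.min r1 r2) by rewrite !lt_min c0 r10 r20.
have tm : t < Num.min c (Num.min r1 r2) by rewrite /t; lra.
have t0 : 0 < t by rewrite divr_gt0.
move: tm; rewrite !lt_min => /and3P[tc tr1 tr2].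
have Ft : `|F t| <= e / 3 by apply: Fsmall; rewrite gtr0_norm.
have FNt : `|F (- t)| <= e / 3 by apply: Fsmall; rewrite normrN gtr0_norm.
have tN0 : - t < 0 by rewrite oppr_lt0.
have tNc : - t <= c := le_trans (ltW tN0) (ltW c0).
have Nct : - c < - t by rewrite ltrN2.
have Ntt : - t <= t := ltW (lt_trans tN0 t0).
have E1 : \int[mu]_(x in `[- c, (- t)]) f x = F (- t) - F (- c).
  apply: FTC_regular => // x /andP[cx xt]; [apply: dF|apply: cf];
    by [rewrite cx (le_trans xt)|rewrite lt_eqF// (le_lt_trans xt)].
have E2 : \int[mu]_(x in `[t, c]) f x = F c - F t.
  apply: FTC_regular => // x /andP[tx xc]; [apply: dF|apply: cf];
    by [rewrite xc (le_trans _ tx)// (le_trans (ltW Nct))|rewrite gt_eqF// (lt_le_trans t0)].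
have fi2 : mu.-integrable `]- t, c] (EFin \o f).
  apply: integrableS fi => //= x /=; rewrite !in_itv/= => /andP[tx ->].
  by rewrite andbT; lra.
have fi3 : mu.-integrable `]t, c] (EFin \o f).
  apply: integrableS fi => //= x /=; rewrite !in_itv/= => /andP[tx ->].
  by rewrite andbT; lra.
have := Rintegral_itvB (x := - t) fi; rewrite !bnd_simp E1.
move=> /(_ (ltW Nct) tNc) => H1.
have := Rintegral_itvB (x := t) fi2; rewrite !bnd_simp.
move=> /(_ Ntt (ltW tc)); rewrite -H1 (Rintegral_itv_obnd_cbnd fi3) E2 => H2.
have := small t t0 tr1 tc; move: H2 Ft FNt.
set I := \int[mu]_(x in `[- c, c]) f x; set J := \int[mu]_(x in _) f x.
move=> H2; rewrite !ler_norml => /andP[k1 k2] /andP[k3 k4] /andP[k5 k6].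
by clear -H2 k1 k2 k3 k4 k5 k6; apply/andP; split; lra.
Qed.

End FTC.

(** * The weight |1 - e^(it)|^(-2d) and its integrability *)

Section Weight.
Context {R : realType}.
Local Notation mu := (@lebesgue_measure R).
Implicit Types (d t : R).

(** The squared chord |1 - e^(it)|^2, whose power -d is the weight. *)
Definition chord2 t : R := 2 - 2 * cos t.

Definition wgt d t : R := chord2 t `^ (- d).

Lemma cos_half t : cos t = 1 - 2 * sin (t / 2) ^+ 2.
Proof.
have -> : cos t = cos ((t / 2) *+ 2) by congr cos; rewrite -mulr_natr; field.
by rewrite cos_mulr2n cos2sin2; ring.
Qed.

Lemma sin_half t : sin t = 2 * sin (t / 2) * cos (t / 2).
Proof.
have -> : sin t = sin ((t / 2) *+ 2) by congr sin; rewrite -mulr_natr; field.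
by rewrite sin_mulr2n; ring.
Qed.

Lemma chord2E t : chord2 t = 4 * sin (t / 2) ^+ 2.
Proof. by rewrite /chord2 cos_half; ring. Qed.

Lemma chord2_ge0 t : 0 <= chord2 t.
Proof. by rewrite chord2E mulr_ge0// sqr_ge0. Qed.

Lemma chord2_le4 t : chord2 t <= 4.
Proof. by have := cos_geN1 t; rewrite /chord2; lra. Qed.

Lemma chord2_gt0 t : - pi <= t <= pi -> t != 0 -> 0 < chord2 t.
Proof.
move=> /andP[t1 t2] t0; rewrite chord2E mulr_gt0// lt_neqAle sqr_ge0 andbT eq_sym sqrf_eq0.
have pi0 := pi_gt0 R.
have [tp|tn|/eqP] := ltgtP t 0; last by rewrite (negbTE t0).
  rewrite -oppr_eq0 -sinN gt_eqF// sin_gt0_pi//; apply/andP; split; lra.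
by rewrite gt_eqF// sin_gt0_pi//; apply/andP; split; lra.
Qed.

Lemma normc_cis t : normc (cis t) = 1.
Proof. by rewrite /= cos2Dsin2 sqrtr1. Qed.

Lemma wgtE d t : complex.Re `|1 - cis t| `^ (- (2 * d)) = wgt d t.
Proof.
rewrite CRe_norm; have -> : normc (1 - cis t) = chord2 t `^ 2^-1.
  rewrite powR12_sqrt ?chord2_ge0//=; congr Num.sqrt.
  by rewrite /chord2 sub0r sqrrN sin2cos2; ring.
by rewrite -powRrM; congr powR; field.
Qed.

Lemma wgt_ge0 d t : 0 <= wgt d t. Proof. exact: powR_ge0. Qed.

Lemma measurable_chord2 : measurable_fun setT chord2.
Proof.
apply: measurable_funB => //; apply: measurable_funM => //.
by apply: continuous_measurable_fun; exact: continuous_cos.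
Qed.

Lemma measurable_wgt d : measurable_fun setT (wgt d).
Proof. exact: measurableT_comp (measurable_powR _) measurable_chord2. Qed.

Lemma wgtM d t : - pi <= t <= pi -> t != 0 -> wgt d t * wgt (- d) t = 1.
Proof.
move=> tpi t0; rewrite /wgt [X in _ * X]powRN mulfV// powR_eq0.
by rewrite gt_eqF// chord2_gt0.
Qed.

Lemma is_derive_chord2 t : is_derive t 1 chord2 (2 * sin t).
Proof.
rewrite (_ : chord2 = cst 2 - (2 \*: (cos : R -> R)))//.
have h := is_deriveB (is_derive_cst (2 : R) t 1) (is_deriveZ 2 (is_derive_cos t)).
apply: is_derive_eq h _; rewrite /GRing.scale/=; ring.
Qed.

Lemma is_derive_wgt d t : 0 < chord2 t ->
  is_derive t 1 (wgt d) (- d * chord2 t `^ (- d - 1) * (2 * sin t)).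
Proof.
move=> c0; apply: (@is_derive1_comp _ (fun x => x `^ (- d)) chord2).
  exact: is_derive1_powR.
exact: is_derive_chord2.
Qed.

Lemma continuous_wgt d t : 0 < chord2 t -> {for t, continuous (wgt d)}.
Proof.
move=> /(is_derive_wgt d)[dw _]; apply: differentiable_continuous.
exact/derivable1_diffP.
Qed.

(** The factor sin(t/2) keeps the singularity from getting worse under differentiation: the
    derivative is a multiple of [wgt d t * cos (t / 2)]. This is the primitive behind both
    integrability and the moment recursion. *)
Definition wsin d t := wgt d t * sin (t / 2).

Lemma is_derive_lin (a t : R) (F : R -> R) (f : R) : is_derive (a * t) 1 F f ->
  is_derive t 1 (fun x => F (a * x)) (a * f).
Proof.
move=> dF; rewrite mulrC; apply: (@is_derive1_comp _ F (fun x => a * x)) => //.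
rewrite (_ : (fun x => _) = a \*: (id : R -> R))//.
have h := is_deriveZ a (is_derive_id t 1).
by apply: is_derive_eq h _; rewrite /GRing.scale/= mulr1.
Qed.

Lemma is_derive_wsin d t : 0 < chord2 t ->
  is_derive t 1 (wsin d) ((2^-1 - d) * (wgt d t * cos (t / 2))).
Proof.
move=> c0; have dw := is_derive_wgt d c0.
have ds : is_derive t 1 (fun x => sin (x / 2)) (2^-1 * cos (2^-1 * t)).
  rewrite (_ : (fun x => _) = fun x => sin (2^-1 * x)); last by apply/funext => x; rewrite mulrC.
  exact: is_derive_lin.
have h := is_deriveM dw ds; apply: is_derive_eq h _.
rewrite /GRing.scale/= [2^-1 * t]mulrC (sin_half t).
have -> : wgt d t = chord2 t `^ (- d - 1) * (4 * sin (t / 2) ^+ 2).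
  rewrite -chord2E /wgt -[X in _ = _ * X]powRr1 ?ltW//.
  by rewrite -powRD ?subrK// (gt_eqF c0) implybT.
by field.
Qed.

(** As |sin(t/2)| is half the square root of [chord2 t], the modulus is half of [chord2 t] to the
    positive power 1/2 - d. *)
Lemma wsin_small d : d < 2^-1 -> forall e, 0 < e -> exists2 r, 0 < r &
  forall t, 0 < `|t| -> `|t| < r -> `|wsin d t| <= e.
Proof.
move=> d2 e e0; pose p := 2^-1 - d; have p0 : 0 < p by rewrite subr_gt0.
have b0 : 0 < e `^ p^-1 by exact: powR_gt0.
have /(_ 0) : continuous chord2.
  move=> x; apply: differentiable_continuous; apply/derivable1_diffP.
  by have [] := is_derive_chord2 x.
move=> /cvgrPdist_lt /(_ _ b0) [r /= r0 rP]; exists r => // t t0 tr.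
have := rP t; rewrite /= sub0r normrN => /(_ tr).
rewrite [chord2 0]/chord2 cos0 mulr1 subrr sub0r normrN ger0_norm ?chord2_ge0// => ct.
have [c0|cpos] := eqVneq (chord2 t) 0.
  move: c0; rewrite chord2E => /eqP; rewrite mulf_eq0 pnatr_eq0/= sqrf_eq0 => /eqP s0.
  by rewrite /wsin s0 mulr0 normr0 ltW.
rewrite /wsin normrM ger0_norm ?wgt_ge0//.
have -> : `|sin (t / 2)| = chord2 t `^ 2^-1 / 2.
  rewrite powR12_sqrt ?chord2_ge0// chord2E.
  have -> : 4 * sin (t / 2) ^+ 2 = (2 * sin (t / 2)) ^+ 2 by ring.
  by rewrite sqrtr_sqr normrM ger0_norm//; field.
rewrite mulrA /wgt -powRD ?cpos ?implybT// addrC -/p ler_pdivrMr//.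
apply: (@le_trans _ _ e); last by rewrite ler_peMr ?ltW// ltr1n.
have -> : e = (e `^ p^-1) `^ p by rewrite -powRrM mulVf ?gt_eqF// powRr1 ?ltW.
by apply: ge0_ler_powR; rewrite ?nnegrE ?chord2_ge0 ?ltW.
Qed.

Lemma cos_half_ge0 t : - pi <= t <= pi -> 0 <= cos (t / 2).
Proof. by move=> /andP[t1 t2]; apply: cos_ge0_pihalf; apply/andP; split; lra. Qed.

Lemma chord2_wgt_le d t : - 2^-1 < d < 2^-1 -> chord2 t * wgt d t <= 16.
Proof.
move=> /andP[d1 d2]; have := chord2_ge0 t; rewrite le_eqVlt => /orP[/eqP<-|c0].
  by rewrite mul0r.
rewrite -{1}[chord2 t](powRr1 (ltW c0)) -powRD ?(gt_eqF c0) ?implybT//.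
apply: (@le_trans _ _ (4 `^ (1 - d))).
  by apply: ge0_ler_powR; rewrite ?nnegrE ?chord2_ge0 ?chord2_le4//; lra.
have -> : 16 = 4 `^ 2%:R :> R by rewrite powR_mulrn//; ring.
by apply: ler_powR; lra.
Qed.

(** The derivative of [wsin d] dominates the weight only where cos(t/2) is not small; since
    [1 <= cos (t / 2) + chord2 t], the remainder is at most [chord2 t * wgt d t <= 16]. *)
Lemma integral_wgt_le d (a b : R) : - 2^-1 < d < 2^-1 -> a < b ->
  (forall t, a <= t <= b -> - pi <= t <= pi /\ t != 0) ->
  (\int[mu]_(t in `[a, b]) (wgt d t)%:E <=
    ((2^-1 - d)^-1 * (wsin d b - wsin d a) + 16 * (b - a))%:E)%E.
Proof.
move=> dd ab tab; have p0 : 0 < 2^-1 - d by rewrite subr_gt0; case/andP: dd.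
have c0 t : a <= t <= b -> 0 < chord2 t by move=> /tab[]; exact: chord2_gt0.
pose f t := (2^-1 - d) * (wgt d t * cos (t / 2)).
have cf t : a <= t <= b -> {for t, continuous f}.
  move=> /c0 ct; apply: cvgM; first exact: cvg_cst.
  apply: cvgM; first exact: continuous_wgt.
  apply: continuous_comp; last exact: continuous_cos.
  by apply: cvgM; [exact: cvg_id|exact: cvg_cst].
have fE : \int[mu]_(t in `[a, b]) f t = wsin d b - wsin d a.
  by apply: FTC_regular => // t /c0; exact: is_derive_wsin.
have fi : mu.-integrable `[a, b] (EFin \o f).
  apply: continuous_compact_integrable; first exact: segment_compact.
  by apply: continuous_in_subspaceT => x; rewrite inE/= in_itv/=; exact: cf.
pose g t := (2^-1 - d)^-1 * f t + 16.
have gi1 : mu.-integrable `[a, b] (EFin \o (fun t => (2^-1 - d)^-1 * f t)).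
  by apply: eq_integrable (integrableZl _ (2^-1 - d)^-1 fi).
have gi2 : mu.-integrable `[a, b] (EFin \o (fun=> 16 : R)).
  apply: continuous_compact_integrable; first exact: segment_compact.
  by apply: continuous_subspaceT => x; exact: cvg_cst.
have gi : mu.-integrable `[a, b] (EFin \o g) by apply: eq_integrable (integrableD _ gi1 gi2).
have gE : \int[mu]_(t in `[a, b]) g t =
    (2^-1 - d)^-1 * (wsin d b - wsin d a) + 16 * (b - a).
  have mE : mu `[a, b] = (b - a)%:E by rewrite lebesgue_measure_itv/= lte_fin ab -EFinD.
  rewrite RintegralD// RintegralZl// fE Rintegral_cst//; congr (_ + _ * _).
  exact: (congr1 fine mE).
rewrite -gE /Rintegral fineK; last exact: integrable_fin_num gi.
apply: ge0_le_integral => //=.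
- by move=> t _; rewrite lee_fin wgt_ge0.
- by apply/measurable_EFinP; apply: measurable_funS (measurable_wgt d).
- exact: measurable_int gi.
- move=> t; rewrite in_itv/= => tt; have [tpi _] := tab _ tt.
  rewrite lee_fin /g /f mulKf ?gt_eqF//.
  have ch := chord2_wgt_le t dd; have cg := cos_half_ge0 tpi.
  have cl := cos_le1 (t / 2); have wg := wgt_ge0 d t.
  have h : 1 <= cos (t / 2) + chord2 t.
    rewrite chord2E sin2cos2; nra.
  nra.
Qed.

(** Monotone exhaustion of the interval deprived of 0. The values of [wsin d] at the inner endpoints
    enter with a favourable sign, so that one bound [C] holds for every n. *)
Lemma integrable_wgt d : - 2^-1 < d < 2^-1 ->
  mu.-integrable `[- pi, pi] (EFin \o wgt d).
Proof.
move=> dd; have p0 : 0 < 2^-1 - d by rewrite subr_gt0; case/andP: dd.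
have pi0 := pi_gt0 R.
have [r [e0 epi rmono rsmall]] : exists r : nat -> R, [/\ forall n, 0 < r n,
    forall n, r n < pi, forall n m, (n <= m)%N -> r m <= r n &
    forall x, 0 < x -> exists n, r n <= x].
  exists (fun n => pi / n.+2%:R); split.
  - by move=> n; rewrite divr_gt0.
  - by move=> n; rewrite ltr_pdivrMr// ltr_pMr// ltr1n.
  - by move=> n m nm; rewrite ler_pM2l// lef_pV2 ?posrE// ler_nat.
  - move=> x x0; exists (Num.truncn (pi / x)).
    rewrite ler_pdivrMr// mulrC -ler_pdivrMr//.
    by rewrite ltW// (lt_trans (truncnS_gt _))// ltr_nat.
pose F n : set R := `[- pi, (- r n)] `|` `[r n, pi].
have mw D : measurable D -> measurable_fun D (EFin \o wgt d).
  by move=> mD; apply/measurable_EFinP; apply: measurable_funS (measurable_wgt d).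
pose C := (2^-1 - d)^-1 * (wsin d pi - wsin d (- pi)) + 32 * pi.
have wsinN t : wsin d (- t) = - wsin d t.
  by rewrite /wsin /wgt /chord2 cosN mulNr sinN mulrN.
have FC n : (\int[mu]_(t in F n) (wgt d t)%:E <= C%:E)%E.
  rewrite ge0_integral_setU//=; first last.
  - apply/disj_setPS => x /= []; rewrite !in_itv/= => /andP[_ x1] /andP[x2 _].
    have x12 : r n <= - r n := le_trans x2 x1.
    by have := e0 n; lra.
  - by move=> x _; rewrite lee_fin wgt_ge0.
  - exact: mw (measurableU _ _ (measurable_itv _) (measurable_itv _)).
  have h1 := integral_wgt_le (a := - pi) (b := - r n) dd.
  have h2 := integral_wgt_le (a := r n) (b := pi) dd.
  have ep := epi n; have en := e0 n.
  have a1 : - pi < - r n by lra.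
  have a2 t : - pi <= t <= - r n -> - pi <= t <= pi /\ t != 0.
    by move=> /andP[t1 t2]; split; [apply/andP; split; lra|apply/eqP; lra].
  have a3 t : r n <= t <= pi -> - pi <= t <= pi /\ t != 0.
    by move=> /andP[t1 t2]; split; [apply/andP; split; lra|apply/eqP; lra].
  apply: le_trans (leeD (h1 a1 a2) (h2 ep a3)) _.
  rewrite -EFinD lee_fin /C !wsinN.
  have ws : 0 <= wsin d (r n).
    rewrite /wsin mulr_ge0 ?wgt_ge0// sin_ge0_pi//; apply/andP; split; lra.
  have pV : 0 < (2^-1 - d)^-1 by rewrite invr_gt0.
  nra.
have Fmono : {homo F : n m / (n <= m)%N >-> (n <= m)%O}.
  move=> n m nm; apply/subsetPset => x.
  have h := rmono _ _ nm.
  rewrite /F /= !in_itv/= => -[/andP[x1 x2]|/andP[x1 x2]]; [left|right];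
    by apply/andP; split; lra.
have mF n : measurable (F n) by apply: measurableU.
have FE : \bigcup_n F n = `[- pi, pi] `\ 0.
  apply/seteqP; split=> x.
    move=> [n _]; have := e0 n; have := epi n.
    rewrite /F /= !in_itv/= => a1 a2 [/andP[x1 x2]|/andP[x1 x2]];
      by (split; [apply/andP; split; lra|lra]).
  rewrite /= in_itv/= => -[/andP[x1 x2] /eqP x0].
  have ax : 0 < `|x| by rewrite normr_gt0.
  have [n np] := rsmall _ ax.
  exists n => //; rewrite /F /= !in_itv/=.
  have [xp|xn] := leP 0 x; [right|left]; apply/andP; split => //.
    by rewrite -(ger0_norm xp).
  by rewrite lerNr -(ltr0_norm xn).
have key : (\int[mu]_(t in `[(- pi)%R, pi]) (wgt d t)%:E <= C%:E)%E.
  have m0 : measurable (`[- pi, pi] `\ (0 : R)) by exact: measurableD.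
  rewrite -(integral_setD1 m0 (mw _ m0)) -FE.
  have cv : (\int[mu]_(t in F n) (wgt d t)%:E @[n --> \oo] -->
      \int[mu]_(t in \bigcup_n F n) (wgt d t)%:E)%E.
    apply: ge0_nondecreasing_set_cvg_integral => //; first by move=> n; exact: mw.
    by move=> n t _; rewrite lee_fin wgt_ge0.
  rewrite -(cvg_lim _ cv)//; apply: lime_le; first by apply/cvg_ex; eexists; exact: cv.
  by apply: nearW => n; exact: FC.
apply/integrableP; split; first exact: mw.
under eq_integral => t _ do rewrite gee0_abs ?lee_fin ?wgt_ge0//.
by rewrite (le_lt_trans key)// ltry.
Qed.

End Weight.

(** * The two-term recursion for the trigonometric moments of the weight *)

Section Moments.
Context {R : realType}.
Local Notation mu := (@lebesgue_measure R).
Implicit Types (d t : R).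

Lemma real_complex_eq0 (a : R) : (a%:C == 0) = (a == 0).
Proof. by rewrite eq_complex/= eqxx andbT. Qed.

Lemma cisD (s t : R) : cis (s + t) = cis s * cis t.
Proof. by apply: complex_eqP; rewrite ?CReM ?CImM/= ?cosD ?sinD//; ring. Qed.

Lemma cis0 : cis (0 : R) = 1.
Proof. by apply: complex_eqP; rewrite /= ?cos0 ?sin0. Qed.

Lemma cisN t : cis (- t) = (cis t)^*.
Proof. by rewrite conjE; apply: complex_eqP; rewrite /= ?cosN ?sinN. Qed.

Lemma cisX t n : cis t ^+ n = cis (n%:R * t).
Proof.
elim: n => [|n ih]; first by rewrite expr0 mul0r cis0.
by rewrite exprS ih -cisD; congr cis; rewrite -natr1; ring.
Qed.

Lemma integrable_wgtM d (h : R -> R) (M : R) : - 2^-1 < d < 2^-1 ->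
  measurable_fun setT h -> (forall t, `|h t| <= M) ->
  mu.-integrable `[- pi, pi] (EFin \o (fun t => wgt d t * h t)).
Proof.
move=> dd mh hM; have M0 : 0 <= M by exact: le_trans (hM 0).
apply: le_integrable (integrableZl _ M (integrable_wgt dd)) => //.
  apply/measurable_EFinP; apply: (@measurable_funS _ _ _ _ setT) => //.
  by apply: measurable_funM => //; exact: measurable_wgt.
move=> t _; rewrite -EFinM !abse_EFin lee_fin !normrM mulrC.
by rewrite ler_wpM2r// (ger0_norm M0).
Qed.

Lemma sin_natpi k : sin (k%:R * pi) = 0 :> R.
Proof.
have := alternatingn (@sinDpi R) k 0; rewrite add0r sin0 mulr0.
by rewrite mulr_natl.
Qed.

Lemma cos_halfpi k : cos ((k%:R + 2^-1) * pi) = 0 :> R.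
Proof.
by rewrite mulrDl mulrC [2^-1 * pi]mulrC cosDpihalf mulrC sin_natpi oppr0.
Qed.

Lemma is_derive_wsinM d (a : R) (g g' : R -> R) t : 0 < chord2 t ->
  (forall x : R, is_derive x 1 g (g' x)) ->
  is_derive t 1 (fun t => wsin d t * g (a * t))
    ((2^-1 - d) * (wgt d t * cos (t / 2)) * g (a * t) + wsin d t * (a * g' (a * t))).
Proof.
move=> c0 dg; have h := is_deriveM (is_derive_wsin d c0) (is_derive_lin (dg (a * t))).
by apply: is_derive_eq h _; rewrite /GRing.scale/=; ring.
Qed.

Lemma wsinN d t : wsin d (- t) = - wsin d t.
Proof. by rewrite /wsin /wgt /chord2 cosN mulNr sinN mulrN. Qed.

Let cont_lin (g : R -> R) (a : R) t : continuous g ->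
  {for t, continuous (fun t => g (a * t))}.
Proof.
move=> cg; apply: continuous_comp; last exact: cg.
by apply: cvgM; [exact: cvg_cst|exact: cvg_id].
Qed.

(** The primitive is 2 w(t) sin(t/2) g((k+1/2)t): the two terms of its derivative recombine, by the
    addition formulas, into the frequencies k and k+1. Cosine and sine are both instances of g, and
    the last hypothesis cancels the boundary terms. *)
Lemma moment_rec_trig d (k : nat) (g g' : R -> R) : - 2^-1 < d < 2^-1 ->
  (forall t : R, is_derive t 1 g (g' t)) -> continuous g -> (forall t, `|g t| <= 1) ->
  (forall t, g ((k.+1)%:R * t) =
     g ((k%:R + 2^-1) * t) * cos (t / 2) + g' ((k%:R + 2^-1) * t) * sin (t / 2)) ->
  (forall t, g (k%:R * t) =
     g ((k%:R + 2^-1) * t) * cos (t / 2) - g' ((k%:R + 2^-1) * t) * sin (t / 2)) ->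
  g ((k%:R + 2^-1) * pi) + g (- ((k%:R + 2^-1) * pi)) = 0 ->
  (k.+1%:R - d) * \int[mu]_(t in `[- pi, pi]) (wgt d t * g (k.+1%:R * t)) =
  (k%:R + d) * \int[mu]_(t in `[- pi, pi]) (wgt d t * g (k%:R * t)).
Proof.
move=> dd dg cg g1 gS gk gpi; set a := k%:R + 2^-1 in gS gk gpi *.
have pi0 := pi_gt0 R.
have mg b : measurable_fun setT (fun t => g (b * t)).
  by apply: continuous_measurable_fun => t; exact: cont_lin.
have ig b : mu.-integrable `[- pi, pi] (EFin \o (fun t => wgt d t * g (b * t))).
  by apply: (@integrable_wgtM _ _ 1) => //.
pose F t := 2 * (wsin d t * g (a * t)).
pose f t := (k.+1%:R - d) * (wgt d t * g (k.+1%:R * t)) -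
            (k%:R + d) * (wgt d t * g (k%:R * t)).
have i1 : mu.-integrable `[- pi, pi]
    (EFin \o (fun t => (k.+1%:R - d) * (wgt d t * g (k.+1%:R * t)))).
  by apply: eq_integrable (integrableZl _ (k.+1%:R - d) (ig _)).
have i2 : mu.-integrable `[- pi, pi]
    (EFin \o (fun t => (k%:R + d) * (wgt d t * g (k%:R * t)))).
  by apply: eq_integrable (integrableZl _ (k%:R + d) (ig _)).
have fi : mu.-integrable `[- pi, pi] (EFin \o f).
  by apply: eq_integrable (integrableB _ i1 i2).
have intZ b c : \int[mu]_(t in `[- pi, pi]) (c * (wgt d t * g (b * t))) =
    c * \int[mu]_(t in `[- pi, pi]) (wgt d t * g (b * t)) by rewrite RintegralZl.
apply/eqP; rewrite -subr_eq0 -!intZ -RintegralB//.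
have -> : \int[mu]_(t in `[- pi, pi]) f t = F pi - F (- pi).
  apply: FTC_singular => //.
  - move=> t tpi t0; have c0 := chord2_gt0 tpi t0.
    have h := is_deriveZ 2 (is_derive_wsinM d a c0 dg).
    apply: is_derive_eq h _.
    by rewrite /f gS gk /wsin /GRing.scale/= /a -natr1; field.
  - move=> t tpi t0; have c0 := chord2_gt0 tpi t0.
    have cw b : {for t, continuous (fun t => wgt d t * g (b * t))}.
      by apply: cvgM; [exact: continuous_wgt|exact: cont_lin].
    by apply: cvgB; (apply: cvgM; [exact: cvg_cst|exact: cw]).
  - move=> e e0; have e20 : 0 < e / 2 by rewrite divr_gt0.
    have d2 : d < 2^-1 by case/andP: dd.
    have [r r0 rP] := wsin_small d2 e20.
    exists r => // t t0 tr; rewrite /F normrM (normrM (wsin d t)) ger0_norm//.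
    have := rP t t0 tr; have := g1 (a * t); have := normr_ge0 (wsin d t).
    have := normr_ge0 (g (a * t)); nra.
apply/eqP; rewrite /F wsinN mulrN mulNr mulrN opprK -mulrDr -mulrDr.
by rewrite gpi !mulr0.
Qed.

Lemma moment_rec d (k : nat) : - 2^-1 < d < 2^-1 ->
  (k.+1%:R - d)%:C *
    cintegral mu `[- pi, pi] (fun t => (wgt d t)%:C * cis t ^+ k.+1) =
  (k%:R + d)%:C * cintegral mu `[- pi, pi] (fun t => (wgt d t)%:C * cis t ^+ k).
Proof.
move=> dd.
have E1 t : (k.+1%:R * t) = (k%:R + 2^-1) * t + t / 2 by rewrite -natr1; field.
have E0 t : (k%:R * t) = (k%:R + 2^-1) * t - t / 2 by field.
have hc := @moment_rec_trig d k cos (fun x => - sin x) dd (@is_derive_cos R) (@continuous_cos R) (@cos_max R).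
have hs := @moment_rec_trig d k sin cos dd (@is_derive_sin R) (@continuous_sin R) (@sin_max R).
have cE n : cintegral mu `[- pi, pi] (fun t => (wgt d t)%:C * cis t ^+ n) =
   (\int[mu]_(t in `[- pi, pi]) (wgt d t * cos (n%:R * t))) +i*
   (\int[mu]_(t in `[- pi, pi]) (wgt d t * sin (n%:R * t))).
  by congr Complex; apply: eq_Rintegral => t _; rewrite cisX ?CReM ?CImM/= !mul0r ?subr0 ?addr0.
rewrite !cE; apply: complex_eqP; rewrite ?CReM ?CImM/= !mul0r ?subr0 ?addr0.
  apply: hc.
  - by move=> t; rewrite E1 cosD; ring.
  - by move=> t; rewrite E0 cosB; ring.
  - by rewrite cosN cos_halfpi addr0.
apply: hs.
- by move=> t; rewrite E1 sinD.
- by move=> t; rewrite E0 sinB.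
- by rewrite sinN subrr.
Qed.

Lemma cintegrable_wgtM d (h : R -> R[i]) (M : R) : - 2^-1 < d < 2^-1 ->
  measurable_fun setT (CRe \o h) -> measurable_fun setT (CIm \o h) ->
  (forall t, normc (h t) <= M) ->
  cintegrable mu `[- pi, pi] (fun t => (wgt d t)%:C * h t).
Proof.
move=> dd mr mi hM; split.
  apply: eq_integrable (@integrable_wgtM _ (CRe \o h) M dd mr _) => //.
    by move=> t _ /=; rewrite CReM/= mul0r subr0.
  by move=> t; apply: le_trans (hM t); exact: Re_le_normc.
apply: eq_integrable (@integrable_wgtM _ (CIm \o h) M dd mi _) => //.
  by move=> t _ /=; rewrite CImM/= mul0r addr0.
by move=> t; apply: le_trans (hM t); exact: Im_le_normc.
Qed.

(** The zeroth moment is real, and the recursion has real coefficients with [k.+1%:R - d] nonzero,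
    so reality propagates. *)
Lemma moment_real d : - 2^-1 < d < 2^-1 -> exists gam : nat -> R,
  (forall k, cintegral mu `[- pi, pi] (fun t => (wgt d t)%:C * cis t ^+ k) = (gam k)%:C) /\
  (forall k, (k.+1%:R - d) * gam k.+1 = (k%:R + d) * gam k).
Proof.
move=> dd; pose M k := cintegral mu `[- pi, pi] (fun t => (wgt d t)%:C * cis t ^+ k).
have dk (k : nat) : k.+1%:R - d != 0.
  have : 1 <= k.+1%:R :> R by rewrite ler1n.
  by move: dd => /andP[? ?] ?; apply/eqP; lra.
have Mr k : M k = (CRe (M k))%:C.
  elim: k => [|k ih].
    have -> : M 0%N = cintegral mu `[- pi, pi] (fun t => (wgt d t)%:C).
      by apply: eq_cintegral => t _; rewrite expr0 mulr1.
    by rewrite cintegral_real.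
  have := moment_rec k dd; rewrite -/(M k) -/(M k.+1) ih => h.
  have -> : M k.+1 = (((k%:R + d) * CRe (M k)) / (k.+1%:R - d))%:C.
    apply: (@mulfI _ (k.+1%:R - d)%:C); first by rewrite real_complex_eq0.
    by rewrite h -!rmorphM/= [X in _ = X%:C]mulrC divfK.
  by [].
exists (fun k => CRe (M k)); split=> // k.
have := moment_rec k dd; rewrite -/(M k) -/(M k.+1) Mr (Mr k) -!rmorphM.
by move=> /complexI.
Qed.

End Moments.

(** * Orthogonal polynomials for the fractional weight *)

Section SzegoPolynomials.
Context {R : realType}.
Variable d : R.
Hypothesis d_itv : - 2^-1 < d < 2^-1.
Hypothesis d_neq0 : d != 0.

Let natB_gt0 (n : nat) : 0 < n.+1%:R - d.
Proof.
have : 1 <= n.+1%:R :> R by rewrite ler1n.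
by case/andP: d_itv => ? ? ?; lra.
Qed.

Let natB_neq0 (n : nat) : n.+1%:R - d != 0.
Proof. by rewrite gt_eqF. Qed.

Let intD_neq0 (m : int) : m%:~R + d != 0.
Proof.
case/andP: d_itv => d1 d2; apply/eqP => /eqP; rewrite addr_eq0 => /eqP md.
have [m0|m0|m0] := ltgtP m 0; last by move: md d_neq0; rewrite m0 => /esym/eqP; rewrite oppr_eq0 => ->.
  have : m%:~R <= -1 :> R by rewrite -[-1]/((-1)%:~R) ler_int; lia.
  by rewrite md; lra.
have : 1 <= m%:~R :> R by rewrite -[1]/(1%:~R) ler_int; lia.
by rewrite md; lra.
Qed.

(* The coefficient of [z ^ k] in the monic-at-0 orthogonal polynomial of degree
   [j + k] for the weight |1 - z|^(-2d). *)
Definition szA (j k : nat) : R :=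
  \prod_(i < k) ((j + i).+1%:R * (i%:R - d) / (i.+1%:R * ((j + i).+1%:R - d))).

Definition sz (n k : nat) : R := if (k <= n)%N then szA (n - k) k else 0.

Definition verblunsky (n : nat) : R := d / (n%:R - d).

Lemma szA0 j : szA j 0 = 1.
Proof. by rewrite /szA big_ord0. Qed.

Lemma szAS j k : szA j k.+1 =
  szA j k * ((j + k).+1%:R * (k%:R - d) / (k.+1%:R * ((j + k).+1%:R - d))).
Proof. by rewrite /szA big_ord_recr. Qed.

Local Ltac nonzero := repeat (apply/andP; split); apply/eqP; lra.

Lemma szASl j k : szA j.+1 k * (((j + k).+1%:R - d) * j.+1%:R) =
  szA j k * ((j.+1%:R - d) * (j + k).+1%:R).
Proof.
case/andP: d_itv => d1 d2.
elim: k => [|k ih]; first by rewrite !szA0 addn0; ring.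
rewrite !szAS; move: ih; rewrite !addSn !addnS -!natr1 !natrD.
have : 0 <= j%:R :> R by []. have : 0 <= k%:R :> R by [].
move: (szA j.+1 k) (szA j k) (j%:R) (k%:R) => A B x y y0 x0 ih.
transitivity ((A * ((x + y + 1 - d) * (x + 1))) *
   ((x + y + 1 + 1) * (y - d) / ((y + 1) * (x + y + 1 - d)))).
  by field; nonzero.
by rewrite ih; field; nonzero.
Qed.

(** In rising factorials [szA j k] is (-d)_k (j+1)_k / (k! (j+1-d)_k); multiplied by k - d it
    becomes symmetric in j and k. *)
Lemma szA_sym j k : szA j k * (k%:R - d) = szA k j * (j%:R - d).
Proof.
case/andP: d_itv => d1 d2.
elim: j k => [|j ih] k.
  elim: k => [|k ihk]; first by rewrite !szA0.
  rewrite szAS !szA0 mul1r in ihk *; rewrite add0n -!natr1.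
  have : 0 <= k%:R :> R by [].
  move: (szA 0 k) (k%:R) ihk => A y ihk y0.
  transitivity (A * (y - d)); last by rewrite ihk.
  by field; nonzero.
have h := szASl j k; have := ih k.
rewrite szAS addnC; move: h; rewrite -!natr1 !natrD.
have : 0 <= j%:R :> R by []. have : 0 <= k%:R :> R by [].
move: (szA j.+1 k) (szA j k) (szA k j) (j%:R) (k%:R) => A B D x y y0 x0 h1 h2.
have -> : A = B * ((x + 1 - d) * (x + y + 1)) / ((x + y + 1 - d) * (x + 1)).
  by rewrite -h1; field; nonzero.
transitivity (B * (y - d) * ((x + 1 - d) * (x + y + 1)) / ((x + y + 1 - d) * (x + 1))).
  by field; nonzero.
by rewrite h2; field; nonzero.
Qed.

Lemma szA_rec j k : szA j.+1 k.+1 =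
  szA j k.+1 - verblunsky (j + k.+2) * szA k j.+1.
Proof.
case/andP: d_itv => d1 d2.
have h1 := szASl j k.+1; have h2 := szASl k j.+1; have h3 := szA_sym j.+1 k.+1.
move: h1 h2 h3; rewrite /verblunsky !addnS -!natr1 !natrD.
have : 0 <= j%:R :> R by []. have : 0 <= k%:R :> R by [].
move: (szA j.+1 k.+1) (szA j k.+1) (szA k.+1 j.+1) (szA k j.+1) => A B C D.
move: (j%:R) (k%:R) => x y y0 x0 h1 h2 h3.
have -> : B = A * ((x + y + 1 + 1 - d) * (x + 1)) / ((x + 1 - d) * (x + y + 1 + 1)).
  by rewrite h1; field; nonzero.
have -> : D = C * ((y + x + 1 + 1 - d) * (y + 1)) / ((y + 1 - d) * (y + x + 1 + 1)).
  by rewrite h2; field; nonzero.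
have -> : C = A * (y + 1 - d) / (x + 1 - d) by rewrite h3; field; nonzero.
by field; nonzero.
Qed.

Lemma sz_out n k : (n < k)%N -> sz n k = 0.
Proof. by move=> nk; rewrite /sz leqNgt nk. Qed.

Lemma sz0 n : sz n 0 = 1. Proof. by rewrite /sz subn0 szA0. Qed.

(** The Szego recursion on coefficients, the index [n.+1 - k] standing for z times the reversed
    polynomial. At the top degree it reduces to the symmetry of [szA]. *)
Lemma sz_rec n k : (k <= n.+1)%N ->
  sz n.+1 k = sz n k - verblunsky n.+1 * sz n (n.+1 - k).
Proof.
case: k => [|k] kn; first by rewrite subn0 !sz0 sz_out// mulr0 subr0.
rewrite /sz kn subSS leq_subr subKn//.
have [kn'|kn'] := ltnP k n.
  have -> : (n - k = (n - k.+1).+1)%N by lia.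
  rewrite szA_rec; congr (_ - verblunsky _ * _); lia.
have -> : k = n by lia.
rewrite subnn szA0 sub0r mulr1; have := szA_sym 0 n.+1; rewrite szA0 mul1r.
have := natB_neq0 n; rewrite /verblunsky => h E.
by apply: (@mulIf _ (n.+1%:R - d)) => //; rewrite E mulNr divfK// sub0r.
Qed.

(** Coefficients near the top degree are O(1/n), which is what makes the overshoot of a truncated
    quotient small. The induction starts at degree 1, because the factor with i = 0 contains -d, of
    either sign, while the later ones are positive. *)
Lemma sz_le n k : (k <= n)%N -> `|sz n k| <= (n - k + 2)%:R / n.+1%:R.
Proof.
move=> kn; rewrite /sz kn -{3}(subnK kn); move: (n - k)%N => j {kn}.
case/andP: d_itv => d1 d2.
case: k => [|k].
  by rewrite szA0 normr1 addn0 ler_pdivlMr// mul1r ler_nat; lia.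
have j0 : 0 <= j%:R :> R by [].
elim: k => [|k ih].
  rewrite szAS szA0 mul1r addn0 addn1 addn2 divff ?pnatr_eq0//.
  rewrite normrM normfV ler_pdivrMr ?normr_gt0 ?mulf_neq0// ?pnatr_eq0// mul1r.
  rewrite mul1r sub0r normrM normrN ger0_norm// (gtr0_norm (natB_gt0 j)) -natr1.
  have : `|d| <= 2^-1 by rewrite ler_norml; apply/andP; split; lra.
  nra.
have k0 : 0 <= k%:R :> R by [].
rewrite szAS normrM; apply: le_trans (ler_wpM2r (normr_ge0 _) ih) _.
rewrite ger0_norm; last first.
  by rewrite divr_ge0// mulr_ge0// ?(ltW (natB_gt0 _))// -natr1; lra.
have c0 : 0 <= (j + 2)%:R :> R by [].
move: ((j + 2)%:R) c0 => c c0; rewrite !addnS -!natr1 !natrD.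
move: (j%:R) (k%:R) j0 k0 => x y x0 y0.
rewrite (_ : _ * _ = c * ((y + 1 - d) / ((y + 1 + 1) * (x + y + 1 + 1 - d)))); last first.
  by field; nonzero.
rewrite ler_wpM2l//.
have x1 : 0 < x + y + 1 + 1 + 1 by lra.
have x2 : 0 < y + 1 + 1 by lra.
have x3 : 0 < x + y + 1 + 1 - d by lra.
rewrite ler_pdivrMr ?mulr_gt0// mulrC ler_pdivlMr//; nra.
Qed.

(** * Pairings of the orthogonal polynomials with monomials *)

Section Moments.
Variable gam : nat -> R.
Hypothesis gam_rec : forall k, (k.+1%:R - d) * gam k.+1 = (k%:R + d) * gam k.

Definition gamZ (m : int) : R := gam `|m|%N.

Lemma gamZN m : gamZ (- m) = gamZ m.
Proof. by rewrite /gamZ abszN. Qed.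

Lemma gamZ_rec (m : int) : (m%:~R + 1 - d) * gamZ (m + 1) = (m%:~R + d) * gamZ m.
Proof.
case: m => [k|k].
  by rewrite /gamZ -PoszD addn1 natr1; exact: gam_rec.
have -> : gamZ (Negz k + 1) = gam k by rewrite /gamZ; congr gam; lia.
have -> : gamZ (Negz k) = gam k.+1 by rewrite /gamZ; congr gam; lia.
have := gam_rec k; rewrite NegzE mulrNz -pmulrn -natr1 => h.
apply: oppr_inj; rewrite -!mulNr (_ : - (_ + d) = k%:R + 1 - d); last by ring.
by rewrite h; ring.
Qed.

Definition szK (n : nat) : R :=
  \prod_(i < n) ((i.+1%:R - 2 * d) / (i.+1%:R - d)).

(** The weighted pairing of the n-th polynomial with z^m, when [gam] is the sequence of moments. *)
Definition szmom (n : nat) (m : int) : R := \sum_(k < n.+1) sz n k * gamZ (m - k%:Z).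

Lemma szmom_rec n m :
  szmom n.+1 m = szmom n m - verblunsky n.+1 * szmom n (n.+1%:Z - m).
Proof.
rewrite {1}/szmom.
under eq_bigr => k _ do rewrite (@sz_rec n k (ltn_ord k)) mulrBl -mulrA.
rewrite sumrB -mulr_sumr; congr (_ - _ * _).
  by rewrite big_ord_recr/= sz_out// mul0r addr0.
rewrite (reindex_inj rev_ord_inj)/= big_ord_recr/= subSS subnn subn0 sz_out// mul0r addr0.
apply: eq_bigr => k _; have kn : (k <= n.+1)%N by have := ltn_ord k; lia.
rewrite subSS subKn// -gamZN; congr (sz _ _ * gamZ _).
by rewrite -subzn//; ring.
Qed.

Let prodfrac (n : nat) (x : R) := \prod_(i < n) ((x - i.+1%:R) / (x - i.+1%:R + d)).

Let intR (m : int) (i : nat) : m%:~R - i%:R + d != 0.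
Proof. by have := intD_neq0 (m - i%:Z); rewrite rmorphB. Qed.

(** The recursion for [szmom] evaluates the closed form at n + 1 - m; this reflection brings it back
    to m, with one use of the moment recursion per step of n. *)
Let prodfrac_refl n (m : int) :
  gamZ (n.+1%:Z - m) * prodfrac n (n.+1%:R - m%:~R) =
  gamZ m * ((m%:~R - d) / (m%:~R - n.+1%:R + d)) * prodfrac n m%:~R.
Proof.
have -> : prodfrac n (n.+1%:R - m%:~R) =
    \prod_(i < n) ((m%:~R - i.+1%:R) / (m%:~R - i.+1%:R - d)).
  rewrite /prodfrac (reindex_inj rev_ord_inj)/=; apply: eq_bigr => i _.
  have -> : (n - i.+1).+1%:R = n%:R - i%:R :> R.
    by rewrite -natrB; [congr _%:R|]; have := ltn_ord i; lia.
  rewrite -[RHS]mulrNN -invrN -!natr1; congr (_ / _); ring.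
rewrite -gamZN opprB.
elim: n => [|n ih].
  rewrite /prodfrac !big_ord0 !mulr1; have := gamZ_rec (m - 1).
  rewrite subrK rmorphB/= subrK => h.
  have h0 := intR m 1; apply: (@mulfI _ (m%:~R - 1 + d)) => //.
  by rewrite -h [RHS]mulrCA [X in _ = _ * X]mulrC divfK// mulrC.
rewrite big_ord_recr/= /prodfrac big_ord_recr/= -/(prodfrac n _).
have := gamZ_rec (m - n.+2%:Z); rewrite (_ : m - n.+2%:Z + 1 = m - n.+1%:Z); last by lia.
move: ih; rewrite mulrA.
have h1 := intR m n.+1; have h2 := intR m n.+2.
have h3 : m%:~R - n.+1%:R - d != 0.
  have := intD_neq0 (n.+1%:Z - m); rewrite rmorphB/= -pmulrn => h; apply: contra h.
  by rewrite -oppr_eq0 => /eqP h; apply/eqP; rewrite -h; ring.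
move: h1 h2 h3; rewrite rmorphB/= -?pmulrn -![n.+2%:R]natr1.
move: (gamZ (m - n.+1%:Z)) (gamZ (m - n.+2%:Z)) (\prod_(i < n) _) (gamZ m) (prodfrac n _).
move: (n.+1%:R) (m%:~R) => y x g1 g2 p g q h1 h2 h3 ih gr.
have h4 : x - (y + 1) + 1 - d = x - y - d by ring.
have -> : g2 = (x - y - d) * g1 / (x - (y + 1) + d).
  by rewrite -h4 gr mulrAC divff ?mul1r.
transitivity (g1 * p * (x - y) / (x - (y + 1) + d)).
  by field; rewrite h3; move: h2; rewrite (_ : x - (y + 1) + d = x - y - 1 + d) ?opprD ?addrA// => ->.
rewrite ih.
by field; rewrite h1; move: h2; rewrite (_ : x - (y + 1) + d = x - y - 1 + d) ?opprD ?addrA// => ->.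
Qed.

(** The product satisfies the same Szego recursion. Its numerators m - 1, ..., m - n exhibit the
    orthogonality to z, ..., z^n. *)
Lemma szmomE n m : szmom n m = szK n * gamZ m * prodfrac n m%:~R.
Proof.
elim: n m => [|n ih] m.
  by rewrite /szmom big_ord1 sz0 /szK /prodfrac !big_ord0 !mul1r mulr1 subr0.
rewrite szmom_rec !ih rmorphB/= -mulrA -[szK n * _ * _ in X in _ - _ * X]mulrA prodfrac_refl.
rewrite /szK big_ord_recr/= -/(szK n) /prodfrac big_ord_recr/= -/(prodfrac n _).
have h1 := natB_neq0 n; have h2 := intR m n.+1; rewrite /verblunsky.
move: (gamZ m) (prodfrac n _) (szK n) h1 h2 => g q K.
move: (n.+1%:R) (m%:~R) => y x h1 h2.
by field; rewrite h1 h2.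
Qed.

Lemma szmom_ortho n k : (0 < k <= n)%N -> szmom n k%:Z = 0.
Proof.
move=> /andP[k0 kn]; rewrite szmomE /prodfrac.
have kn' : (k.-1 < n)%N by lia.
by rewrite (bigD1 (Ordinal kn'))//= prednK// subrr !mul0r mulr0.
Qed.

Lemma gam_le k : `|gam k| <= `|gam 0%N|.
Proof.
case/andP: d_itv => d1 d2.
elim: k => [//|k ih]; apply: le_trans ih.
have := natB_gt0 k => h0; rewrite -(ler_pM2l h0).
have -> : (k.+1%:R - d) * `|gam k.+1| = `|(k.+1%:R - d) * gam k.+1|.
  by rewrite normrM (gtr0_norm h0).
rewrite gam_rec normrM ler_wpM2r// ler_norml -natr1.
have : 0 <= k%:R :> R by []. by move=> ?; apply/andP; split; lra.
Qed.

(** Beyond degree n orthogonality fails only by O(1/n), with quadratic growth in the distance l,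
    which geometrically decaying coefficients will absorb. *)
Lemma szmom_tail_le n l :
  `|szmom n (n + l).+1%:Z| <= `|gam 0%N| * (l.+1 * l.+2)%:R / n.+1%:R.
Proof.
case/andP: d_itv => d1 d2.
(* A sharper bound, of a shape preserved by the exact ratio [rec] between consecutive n at fixed
   l. *)
have key : `|szmom n (n + l).+1%:Z| <=
    `|gam 0%N| * (n.+1 * (l.+1 * l.+2))%:R / ((n + l).+1 * (n + l).+2)%:R.
  elim: n => [|n ih].
    rewrite /szmom big_ord1 sz0 mul1r subr0 !add0n mul1n.
    by rewrite mulfK ?pnatr_eq0//; exact: gam_le.
  have rec : szmom n.+1 (n.+1 + l).+1%:Z * ((n.+1%:R - d) * ((n + l).+2%:R - d)) =
      szmom n (n + l).+1%:Z * ((n.+1%:R - 2 * d) * (n + l).+1%:R).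
    rewrite !szmomE /szK big_ord_recr/= -/(szK n) {1}/prodfrac big_ord_recl/=.
    have -> : \prod_(i < n) (((n.+1 + l).+1%:R - (bump 0 i).+1%:R) /
       ((n.+1 + l).+1%:R - (bump 0 i).+1%:R + d)) = prodfrac n (n + l).+1%:R :> R.
      apply: eq_bigr => i _; rewrite /bump leq0n add1n addSn.
      by rewrite -![(_).+2%:R]natr1; congr (_ / _); ring.
    have := gam_rec (n + l).+1; rewrite /gamZ !absz_nat addSn => gr.
    have h1 := natB_neq0 n; have h2 := natB_neq0 (n + l).+1.
    have h3 := intD_neq0 (n + l).+1%:Z; move: h1 h2 h3 gr; rewrite -!pmulrn.
    rewrite -![(n + l).+2%:R]natr1; move: (n.+1%:R) ((n + l).+1%:R) => x y.
    move: (prodfrac _ _) (szK n) (gam (n + l).+2) (gam (n + l).+1) => p K g2 g1 h1 h2 h3 gr.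
    have -> : g2 = (y + d) * g1 / (y + 1 - d) by rewrite -gr mulrAC divff ?mul1r.
    rewrite addrK; field.
    by rewrite h1 h2 h3.
  have x1 := natB_gt0 n; have x2 := natB_gt0 (n + l).+1.
  rewrite -(ler_pM2r (mulr_gt0 x1 x2)) -[X in _ * X <= _](gtr0_norm (mulr_gt0 x1 x2)).
  rewrite -normrM rec normrM.
  have x3 : 0 <= (n.+1%:R - 2 * d) * (n + l).+1%:R.
    by rewrite mulr_ge0// -natr1; have : 0 <= n%:R :> R by []; lra.
  rewrite (ger0_norm x3); apply: le_trans (ler_wpM2r x3 ih) _.
  rewrite addSn !natrM -!mulrA ler_wpM2l// -!natr1 !natrD.
  have : 0 <= n%:R :> R by []. have : 0 <= l%:R :> R by [].
  move: (n%:R) (l%:R) => x y y0 x0.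
  have z1 : 0 < x + y + 1 by lra.
  have z2 : 0 < x + y + 1 + 1 by lra.
  have z3 : 0 < x + y + 1 + 1 + 1 by lra.
  set D := (x + y + 1) * (x + y + 1 + 1) * (x + y + 1 + 1 + 1).
  have D0 : 0 < D by rewrite /D !mulr_gt0.
  rewrite -(ler_pM2r D0) -subr_ge0.
  rewrite [X in 0 <= X](_ : _ = (y + 1) * (y + 1 + 1) * (x + y + 1) *
     ((y + 1) * (d * (x + 1) + (x + 1) - d) + d ^+ 2 * (x + 1 + 1))).
    rewrite !mulr_ge0//; try lra.
    apply: addr_ge0; apply: mulr_ge0; try lra; last exact: sqr_ge0.
    nra.
  by rewrite /D; field; nonzero.
apply: (le_trans key); rewrite -!mulrA ler_wpM2l// ler_pdivrMr ?ltr0n ?muln_gt0//.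
rewrite mulrAC ler_pdivlMr ?ltr0n// -!natrM ler_nat.
rewrite [X in (X <= _)%N]mulnAC mulnC leq_mul2l; apply/orP; right; apply: leq_mul; lia.
Qed.

(** As the polynomial has value 1 at 0, [szmom n 0] is its squared norm, and this is one factor of
    the classical product for the scalar prediction error. *)
Lemma szmom0_rec n :
  szmom n.+1 0 = szmom n 0 * (1 - (d / (n.+1%:R - d)) ^+ 2).
Proof.
rewrite !szmomE /szK /prodfrac !big_ord_recr/= mulr0z sub0r.
have h1 := natB_neq0 n; have h2 : - n.+1%:R + d != 0.
  by rewrite -oppr_eq0 opprD opprK.
move: (gamZ 0) (\prod_(i < n) _) (\prod_(i < n) _) (n.+1%:R) h1 h2 => g p q x h1 h2.
by field; rewrite h1 h2.
Qed.

End Moments.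
End SzegoPolynomials.

(** * Second-order asymptotics of the scalar prediction error *)

Section ProductAsymptotics.
Context {R : realType}.

(** The intervals [t n - b n, t n + b n] are nested, and c is the supremum of their left ends. *)
Lemma cvg_telescope_bound (t b : nat -> R) :
  (forall n, 0 <= b n) -> (forall n, `|t n.+1 - t n| <= b n - b n.+1) ->
  exists c, forall n, `|t n - c| <= b n.
Proof.
move=> b0 tb.
have step m n : `|t (m + n)%N - t m| <= b m - b (m + n)%N.
  elim: n => [|n ih]; first by rewrite addn0 !subrr normr0.
  have := tb (m + n)%N; rewrite addnS; move: ih.
  rewrite !ler_norml => /andP[? ?] /andP[? ?]; apply/andP; split; lra.
have cross m n : t m - b m <= t n + b n.
  have bm := b0 m; have bn := b0 n.
  have [/subnKC|/ltnW/subnKC] := leqP m n => [E|E].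
    have := step m (n - m)%N; rewrite E ler_norml => /andP[? ?]; lra.
  have := step n (m - n)%N; rewrite E ler_norml => /andP[? ?]; lra.
pose S := range (fun n => t n - b n).
have hS : has_sup S.
  by split; [exists (t 0%N - b 0%N), 0%N|exists (t 0%N + b 0%N) => _ [n _ <-]].
exists (sup S) => n.
have l1 : t n - b n <= sup S by apply: ub_le_sup; [case: hS|exists n].
have l2 : sup S <= t n + b n by apply: ge_sup; [case: hS|move=> _ [m _ <-]].
by rewrite ler_norml; apply/andP; split; lra.
Qed.

(** Multiplying v n by 1 - d^2 / n removes its 1/n term: consecutive values then differ by O(n^-3),
    which the decrements of [b] dominate, so the limit is reached at rate n^-2. *)
Lemma product_asymptotics (d : R) (v : nat -> R) : - 2^-1 < d < 2^-1 ->
  (forall n, v n.+1 = v n * (1 - (d / (n.+1%:R - d)) ^+ 2)) ->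
  exists c M, forall n, (0 < n)%N -> `|v n - c * (1 + d ^+ 2 / n%:R)| <= M / n%:R ^+ 2.
Proof.
move=> /andP[d1 d2] vr.
have d20 : 0 <= d ^+ 2 by exact: sqr_ge0.
have d24 : d ^+ 2 <= 4^-1 by nra.
have nd n : 2^-1 < n.+1%:R - d.
  by have : 1 <= n.+1%:R :> R; [rewrite ler1n|lra].
have vle n : `|v n| <= `|v 0%N|.
  elim: n => [//|n ih]; rewrite vr normrM (le_trans _ ih)// ler_piMr//.
  have h := nd n; rewrite expr_div_n.
  have h0 : 0 < (n.+1%:R - d) ^+ 2 by rewrite exprn_gt0//; lra.
  have q0 : 0 <= d ^+ 2 / (n.+1%:R - d) ^+ 2 by rewrite divr_ge0// ltW.
  have q1 : d ^+ 2 / (n.+1%:R - d) ^+ 2 <= 1 by rewrite ler_pdivrMr// mul1r; nra.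
  by rewrite ger0_norm; lra.
pose V := `|v 0%N|; have V0 : 0 <= V by exact: normr_ge0.
pose t n := v n.+1 * (1 - d ^+ 2 / n.+1%:R).
pose b n : R := 4 * V / n.+1%:R ^+ 2.
have [n|n|c cP] := @cvg_telescope_bound t b.
- by rewrite /b divr_ge0// ?mulr_ge0// sqr_ge0.
- rewrite /t /b vr; have := vle n.+1; rewrite -/V.
  have h := nd n.+1; have : 1 <= n.+1%:R :> R by rewrite ler1n.
  move: h; rewrite -![n.+2%:R]natr1; move: (v n.+1) (n.+1%:R) => w x h x1 wV.
  have E : w * (1 - (d / (x + 1 - d)) ^+ 2) * (1 - d ^+ 2 / (x + 1)) -
      w * (1 - d ^+ 2 / x) =
    w * (d ^+ 2 * ((x + 1) * (1 - 2 * d) + d ^+ 2 + d ^+ 2 * x)) /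
      (x * (x + 1) * (x + 1 - d) ^+ 2).
    by field; repeat (apply/andP; split); apply/eqP; lra.
  rewrite E; have x0 : 0 < x by lra.
  have D0 : 0 < x * (x + 1) * (x + 1 - d) ^+ 2.
    by rewrite !mulr_gt0// ?exprn_gt0//; lra.
  rewrite normrM normfV (gtr0_norm D0) ler_pdivrMr// normrM.
  have N0 : 0 <= d ^+ 2 * ((x + 1) * (1 - 2 * d) + d ^+ 2 + d ^+ 2 * x).
    rewrite mulr_ge0// !addr_ge0// mulr_ge0//; lra.
  rewrite (ger0_norm N0).
  apply: (@le_trans _ _ (V * (x + 1))).
    apply: ler_pM => //.
    have : (x + 1) * (1 - 2 * d) <= (x + 1) * 2 by rewrite ler_wpM2l//; lra.
    move: (d ^+ 2) d20 d24 N0 => e e0 e4 N0 h2.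
    have : e * ((x + 1) * (1 - 2 * d) + e + e * x) <= e * ((x + 1) * 3).
      by rewrite ler_wpM2l//; nra.
    nra.
  rewrite (_ : 4 * V / x ^+ 2 - 4 * V / (x + 1) ^+ 2 =
     V * (4 * (2 * x + 1) / (x ^+ 2 * (x + 1) ^+ 2))); last first.
    by field; repeat (apply/andP; split); apply/eqP; lra.
  rewrite -[X in _ <= X]mulrA ler_wpM2l// mulrAC ler_pdivlMr; last first.
    by rewrite mulr_gt0// exprn_gt0//; lra.
  have s1 : (x + 2^-1) ^+ 2 <= (x + 1 - d) ^+ 2.
    by rewrite ler_pXn2r// ?nnegrE; lra.
  have s2 : x * (x + 1) <= (x + 1 - d) ^+ 2 by nra.
  have -> : (x + 1) * (x ^+ 2 * (x + 1) ^+ 2) = (x * (x + 1)) * (x * (x + 1)) * (x + 1) by ring.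
  have -> : 4 * (2 * x + 1) * (x * (x + 1) * (x + 1 - d) ^+ 2) =
     (x * (x + 1)) * (x + 1 - d) ^+ 2 * (4 * (2 * x + 1)) by ring.
  have xx : 0 <= x * (x + 1) by nra.
  apply: ler_pM; rewrite ?mulr_ge0//; try lra.
  by rewrite ler_wpM2l.
(* Dividing back by 1 - d^2 / x, which is at least 1/2, costs the factor 2; the product of 1 - d^2 /
   x and 1 + d^2 / x differs from 1 by d^4 / x^2. *)
exists c, ((4 * V + `|c|) * 2) => -[//|n] _.
have := cP n; rewrite /t /b; have : 1 <= n.+1%:R :> R by rewrite ler1n.
move: (v n.+1) (n.+1%:R) => w x x1 wc.
have x0 : 0 < x by lra.
have D0 : 0 < 1 - d ^+ 2 / x.
  rewrite subr_gt0 ltr_pdivrMr//; lra.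
have D2 : 2^-1 <= 1 - d ^+ 2 / x.
  have : d ^+ 2 / x <= 2^-1 by rewrite ler_pdivrMr//; lra.
  lra.
rewrite -(ler_pM2r D0) -[X in _ * X <= _](gtr0_norm D0) -normrM.
have -> : (w - c * (1 + d ^+ 2 / x)) * (1 - d ^+ 2 / x) =
    (w * (1 - d ^+ 2 / x) - c) + c * (d ^+ 2 * d ^+ 2 / x ^+ 2).
  by field; apply/eqP; lra.
have x20 : 0 < x ^+ 2 by rewrite exprn_gt0.
apply: (le_trans (ler_normD _ _)).
apply: (@le_trans _ _ ((4 * V + `|c|) / x ^+ 2)).
  rewrite mulrDl lerD// normrM ler_wpM2l// ger0_norm; last first.
    by apply: divr_ge0; [apply: mulr_ge0|]; rewrite ?sqr_ge0.
  rewrite ler_pdivrMr// mulVf ?gt_eqF//; nra.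
rewrite [X in _ <= X](_ : _ = (4 * V + `|c|) / x ^+ 2 * (2 * (1 - d ^+ 2 / x))); last first.
  by field; apply/eqP; lra.
rewrite ler_peMr//; last by lra.
by apply: divr_ge0; [rewrite addr_ge0// mulr_ge0|exact: ltW].
Qed.

End ProductAsymptotics.

(** * Inverses of polynomials as power series *)

Section PowerSeriesInverse.
Context {R : realType}.
Local Notation C := R[i].

Lemma sum_geom_le (y : R) N : 0 <= y -> y < 1 -> \sum_(i < N) y ^+ i <= (1 - y)^-1.
Proof.
move=> y0 y1; have h : 0 < 1 - y by rewrite subr_gt0.
rewrite -(ler_pM2l h) mulfV ?gt_eqF// -opprB mulNr -subrX1 opprB gerBl.
exact: exprn_ge0.
Qed.

Lemma natmul_geom_le (y : R) l : 0 <= y -> y < 1 -> l.+1%:R * y ^+ l <= (1 - y)^-1.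
Proof.
move=> y0 y1; apply: le_trans (sum_geom_le l.+1 y0 y1).
rewrite mulr_natl -[X in _ *+ X]card_ord -sumr_const.
apply: ler_sum => i _; have il : (i <= l)%N by rewrite -ltnS.
by rewrite ler_wiXn2l// ltW.
Qed.

(** The number y with r = 4 y - 3 satisfies r <= y^3; of the three factors y^l, two absorb the
    quadratic weight and the third is summed. *)
Lemma sum_quad_geom (r : R) : 0 <= r -> r < 1 ->
  exists K, forall N, \sum_(l < N) (l.+1 * l.+2)%:R * r ^+ l <= K.
Proof.
move=> r0 r1; pose y := 1 - (1 - r) / 4.
have y0 : 0 <= y by rewrite /y; lra.
have y1 : y < 1 by rewrite /y; lra.
have ry : r <= y ^+ 3.
  have yr : r = 4 * y - 3 by rewrite /y; field.
  rewrite [leLHS]yr -subr_ge0 (_ : _ - _ = (1 - y) * (3 - y - y ^+ 2)); last by ring.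
  by rewrite mulr_ge0//; [lra|nra].
pose B := (1 - y)^-1; have B0 : 0 <= B by rewrite invr_ge0 subr_ge0 ltW.
exists (2 * B ^+ 2 * B) => N.
apply: (@le_trans _ _ (\sum_(l < N) 2 * B ^+ 2 * y ^+ l)); last first.
  by rewrite -mulr_sumr ler_wpM2l ?sum_geom_le// mulr_ge0// sqr_ge0.
apply: ler_sum => l _.
apply: (@le_trans _ _ ((l.+1 * l.+2)%:R * (y ^+ 3) ^+ l)).
  by rewrite ler_wpM2l// lerXn2r// nnegrE exprn_ge0.
rewrite -exprM (_ : (3 * l = l + l + l)%N); last by lia.
rewrite !exprD mulrA ler_wpM2r ?exprn_ge0//.
have h := natmul_geom_le l y0 y1; rewrite -/B in h.
apply: (@le_trans _ _ (2 * (l.+1%:R * y ^+ l) ^+ 2)).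
  rewrite exprMn [X in _ <= X]mulrA -expr2 ler_wpM2r ?sqr_ge0//.
  by rewrite -natrX -natrM ler_nat; nia.
by rewrite ler_wpM2l// lerXn2r// nnegrE// mulr_ge0// exprn_ge0.
Qed.

Definition series_inverse (D : {poly C}) (del : nat -> C) :=
  forall m, \sum_(i < m.+1) D`_i * del (m - i)%N = (m == 0%N)%:R.

(** Dividing a power series by X - a is a first-order recursion with multiplier 1 / a. The new rate
    [t] exceeds 1 / |a| strictly, so that the estimate on the recursion has the fixed point [M']. *)
Lemma series_inverse_linear (a : C) (Q : {poly C}) (del : nat -> C) (M r : R) :
  1 < normc a -> 0 <= M -> 0 <= r -> r < 1 -> series_inverse Q del ->
  (forall l, normc (del l) <= M * r ^+ l) ->
  exists del' M' r', [/\ 0 <= M', 0 <= r', r' < 1,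
    series_inverse (('X - a%:P) * Q) del' &
    forall l, normc (del' l) <= M' * r' ^+ l].
Proof.
move=> a1 M0 r0 r1 Qd dM.
have a0 : a != 0 by rewrite -normc_eq0 gt_eqF// (lt_trans ltr01).
have na0 : 0 < normc a by rewrite (lt_trans ltr01).
pose del' := fix f m := if m is k.+1 then (f k - del k.+1) / a else - del 0%N / a.
pose b := (normc a)^-1; have b0 : 0 < b by rewrite invr_gt0.
have b1 : b < 1 by rewrite invf_lt1.
pose t := Num.max r ((1 + b) / 2).
have t1 : t < 1 by rewrite /t gt_max r1 /=; lra.
have bt : b < t by rewrite /t lt_max; apply/orP; right; lra.
have rt : r <= t by rewrite /t le_max lexx.
have t0 : 0 < t by exact: lt_trans bt.
pose M' := M * b / (1 - b / t).
have q0 : 0 < 1 - b / t by rewrite subr_gt0 ltr_pdivrMr// mul1r.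
have M'0 : 0 <= M' by rewrite /M' divr_ge0 ?(ltW q0)// mulr_ge0// ltW.
have M'E : M' * b / t + M * b = M'.
  have -> : M * b = M' * (1 - b / t) by rewrite /M' divfK// gt_eqF.
  ring.
exists del', M', t; split=> //; first exact: ltW.
  move=> m.
  have E i : (i < m.+1)%N -> (('X - a%:P) * Q)`_i * del' (m - i)%N =
    (if i is i'.+1 then Q`_i' * del' (m - i)%N else 0) - a * Q`_i * del' (m - i)%N.
    move=> im; rewrite mulrBl coefB coefXM coefCM mulrBl.
    by case: i im => [|i] im; rewrite ?mul0r.
  under eq_bigr => i _ do rewrite E//.
  rewrite sumrB big_ord_recl/= add0r [X in _ - X]big_ord_recr/= subnn.
  rewrite opprD addrA -sumrB -(Qd m) big_ord_recr/= subnn; congr (_ + _).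
    apply: eq_bigr => i _; rewrite /bump leq0n add1n.
    have -> : (m - i = (m - i.+1).+1)%N by rewrite subnSK.
    by rewrite /= -/del'; field.
  by rewrite /= ; field.
elim=> [|l ih].
  rewrite /= Normc.normcM normcN Normc.normcV expr0 mulr1 -/b.
  have := dM 0%N; rewrite expr0 mulr1 => h.
  apply: (@le_trans _ _ (M * b)); first by rewrite ler_wpM2r// ltW.
  by rewrite -[leRHS]M'E lerDr divr_ge0 ?(ltW t0)// mulr_ge0 ?(ltW b0).
have -> : del' l.+1 = (del' l - del l.+1) / a by [].
rewrite Normc.normcM Normc.normcV -/b.
apply: (@le_trans _ _ ((M' * t ^+ l + M * t ^+ l.+1) * b)).
  rewrite ler_wpM2r ?(ltW b0)// (le_trans (normcB _ _))// lerD//.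
  by rewrite (le_trans (dM _))// ler_wpM2l// lerXn2r// nnegrE ltW.
rewrite exprS -[X in _ <= X * _]M'E le_eqVlt; apply/orP; left; apply/eqP.
by field; rewrite gt_eqF.
Qed.

(** Geometric decay is obtained root by root from the factorization of D, all of whose roots lie
    outside the closed disk. *)
Lemma inv_series (D : {poly C}) : (forall z : C, normc z <= 1 -> ~~ root D z) ->
  exists del M r, [/\ 0 <= M, 0 <= r, r < 1, series_inverse D del &
    forall l, normc (del l) <= M * r ^+ l].
Proof.
move=> Dr; have D0 : D != 0.
  by apply: contraTneq (Dr 0 _) => [->|]; rewrite ?root0// Normc.normc0.
have [s Ds] := closed_field_poly_normal D.
have lD : lead_coef D != 0 by rewrite lead_coef_eq0.
have sP z : z \in s -> 1 < normc z.
  move=> zs; rewrite ltNge; apply/negP => /Dr; rewrite Ds rootZ// root_prod_XsubC.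
  by rewrite zs.
have [del [M [r [M0 r0 r1 sD dM]]]] : exists del M r, [/\ 0 <= M, 0 <= r, r < 1,
    series_inverse (\prod_(z <- s) ('X - z%:P)) del &
    forall l, normc (del l) <= M * r ^+ l].
  elim: s sP {Ds} => [|a s ih] sP.
    exists (fun m => (m == 0%N)%:R), 1, 0; split=> //.
      move=> m; rewrite big_nil big_ord_recl/= coef1 mul1r subn0 big1 ?addr0//.
      by move=> i _; rewrite coef1/= mul0r.
    case=> [|l]; first by rewrite mulr1n Normc.normc1 expr0 mulr1.
    by rewrite mulr0n Normc.normc0 mul1r exprn_ge0.
  have [|del [M [r [M0 r0 r1 sD dM]]]] := ih.
    by move=> z zs; apply: sP; rewrite inE zs orbT.
  rewrite big_cons; apply: series_inverse_linear M0 r0 r1 sD dM.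
  by apply: sP; rewrite inE eqxx.
exists (fun l => (lead_coef D)^-1 * del l), (normc (lead_coef D)^-1 * M), r.
split=> //; first by rewrite mulr_ge0// normc_ge0.
  have Dc i : D`_i = lead_coef D * (\prod_(z <- s) ('X - z%:P))`_i by rewrite {1}Ds coefZ.
  by move=> m; rewrite -(sD m); apply: eq_bigr => i _; rewrite Dc; field.
by move=> l; rewrite Normc.normcM -mulrA ler_wpM2l// normc_ge0.
Qed.

Lemma series_inverse_poly (D : {poly C}) del n : series_inverse D del ->
  exists F, D * \poly_(i < n.+1) del i = 1 + 'X^(n.+1) * F.
Proof.
move=> Dd; pose E := \poly_(i < n.+1) del i.
exists (drop_poly n.+1 (D * E)).
rewrite -{1}(poly_take_drop n.+1 (D * E)); congr (_ + _); last by rewrite mulrC.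
apply/polyP => m; rewrite coef_take_poly coef1; case: ltnP => [mn|mn]; last first.
  by case: m mn.
rewrite -(Dd m) coefM; apply: eq_bigr => i _.
have h : (m - i < n.+1)%N by exact: leq_ltn_trans (leq_subr _ _) mn.
by rewrite coef_poly h.
Qed.

(* [t] truncates the power series of [phi / D] at degree [n]; the overshoot
   [s] of [t * D] only involves the top coefficients of [t], which are [O(1/n)]. *)
Lemma truncated_quotient (D : {poly C}) :
  (forall z : C, normc z <= 1 -> ~~ root D z) ->
  exists K, forall n (phi : {poly C}), (size phi <= n.+1)%N ->
    (forall k, (k <= n)%N -> normc phi`_k <= (n - k + 2)%:R / n.+1%:R) ->
    exists t s : {poly C}, [/\ (size t <= n.+1)%N, (size s <= size D)%N,
      t * D = phi + 'X^(n.+1) * s & forall l, normc s`_l <= K / n.+1%:R].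
Proof.
move=> /inv_series[del [M [r [M0 r0 r1 Dd dM]]]].
have [K1 K1P] := sum_quad_geom r0 r1.
pose S := \sum_(i < size D) normc D`_i.
have S0 : 0 <= S by apply: sumr_ge0 => i _; exact: normc_ge0.
have K10 : 0 <= K1 by apply: le_trans (K1P 0%N); rewrite big_ord0.
exists (S * ((size D + 2)%:R * (M * K1))) => n phi sphi phin.
have n0 : 0 < n.+1%:R :> R by rewrite ltr0n.
have [F DF] := series_inverse_poly n Dd.
set E := \poly_(i < n.+1) del i in DF.
pose t := take_poly n.+1 (phi * E).
pose s := phi * F - drop_poly n.+1 (phi * E) * D.
have tD : t * D = phi + 'X^(n.+1) * s.
  have h : phi * E = t + drop_poly n.+1 (phi * E) * 'X^(n.+1) by rewrite poly_take_drop.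
  have -> : t = phi * E - drop_poly n.+1 (phi * E) * 'X^(n.+1) by rewrite {1}h addrK.
  rewrite mulrBl -mulrA [E * D]mulrC DF /s; ring.
have st : (size t <= n.+1)%N by exact: size_take_poly.
have sE l : s`_l = (t * D)`_(n.+1 + l).
  have h : (size phi <= n.+1 + l)%N by apply: leq_trans sphi _; exact: leq_addr.
  by rewrite tD coefD coefXnM ltnNge leq_addr/= addKn (nth_default 0 h) add0r.
(* The bound on phi at index n - j - i is (j + i + 2) / (n + 1), at most (j + 2)(i + 1)(i + 2) / (n
   + 1); the growth in i is absorbed by the decay of [del]. *)
have tn j : (j <= n)%N -> normc t`_(n - j) <= (j + 2)%:R * (M * K1) / n.+1%:R.
  move=> jn; rewrite coef_take_poly ltnS leq_subr coefMr.
  apply: (le_trans (normc_sum _ _ _)).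
  apply: (@le_trans _ _ (\sum_(i < (n - j).+1) (j + 2)%:R * M / n.+1%:R *
      ((i.+1 * i.+2)%:R * r ^+ i))).
    apply: ler_sum => i _; rewrite Normc.normcM.
    have ij : (i <= n - j)%N by rewrite -ltnS.
    have h1 := phin (n - j - i)%N (leq_trans (leq_subr _ _) (leq_subr _ _)).
    have h2 : normc E`_i <= M * r ^+ i.
      by rewrite coef_poly (leq_ltn_trans ij)// ltnS leq_subr.
    apply: (le_trans (ler_pM (normc_ge0 _) (normc_ge0 _) h1 h2)).
    have c0 : 0 <= n.+1%:R^-1 * (M * r ^+ i).
      by rewrite mulr_ge0 ?invr_ge0// mulr_ge0// exprn_ge0.
    rewrite [leLHS](_ : _ = n.+1%:R^-1 * (M * r ^+ i) * (n - (n - j - i) + 2)%:R); last by ring.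
    rewrite [leRHS](_ : _ = n.+1%:R^-1 * (M * r ^+ i) * ((j + 2) * (i.+1 * i.+2))%:R); last by ring.
    by rewrite ler_wpM2l// ler_nat; nia.
  rewrite -mulr_sumr -mulrA -[leRHS]mulrA -mulrA.
  rewrite [leRHS](_ : _ = (j + 2)%:R * (M * (n.+1%:R^-1 * K1))); last by ring.
  by rewrite !ler_wpM2l// ?invr_ge0.
exists t, s; split=> //.
  apply/leq_sizeP => l Dl; rewrite sE nth_default//.
  apply: leq_trans (size_polyMleq _ _) _; lia.
move=> l; rewrite sE coefMr.
apply: (le_trans (normc_sum _ _ _)).
have bnd i : (i <= n.+1 + l)%N -> (i < size D)%N ->
    normc (t`_(n.+1 + l - i) * D`_i) <=
    normc D`_i * ((size D + 2)%:R * (M * K1) / n.+1%:R).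
  move=> inl iD; rewrite Normc.normcM mulrC ler_wpM2l ?normc_ge0//.
  have [il|il] := leqP i l.
    have h : (size t <= n.+1 + l - i)%N by apply: leq_trans st _; lia.
    rewrite (nth_default 0 h) Normc.normc0.
    by apply: divr_ge0; [rewrite !mulr_ge0|exact: ltW n0].
  have -> : (n.+1 + l - i = n - (i - l - 1))%N by lia.
  apply: (le_trans (tn _ _)); first by lia.
  rewrite ler_wpM2r ?invr_ge0//.
  by rewrite ler_wpM2r ?mulr_ge0// ler_nat; lia.
rewrite -[leRHS]mulrA /S mulr_suml.
rewrite (big_ord_widen_cond (maxn (n.+1 + l).+1 (size D)) xpredT
   (fun i => normc (t`_(n.+1 + l - i) * D`_i)))/= ?leq_maxl//.
rewrite [leRHS](big_ord_widen_cond (maxn (n.+1 + l).+1 (size D)) xpredT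
   (fun i => normc D`_i * ((size D + 2)%:R * (M * K1) / n.+1%:R)))/= ?leq_maxr//.
rewrite big_mkcond [leRHS]big_mkcond/=; apply: ler_sum => i _.
have c0 : 0 <= (size D + 2)%:R * (M * K1) / n.+1%:R.
  by apply: divr_ge0; [rewrite !mulr_ge0|exact: ltW n0].
case: (ltnP i (size D)) => iD; last first.
  by case: ifP => // _; rewrite [D`_i]nth_default// mulr0 Normc.normc0.
by case: ifP => iln; [apply: bnd => //; rewrite -ltnS|rewrite mulr_ge0// normc_ge0].
Qed.

End PowerSeriesInverse.

(** * Spectral factors in the conjugate variable *)

Section ZeroFlipping.
Context {R : realType}.
Local Notation C := R[i].
Local Open Scope sesquilinear_scope.

Definition evmx m n (z : C) (M : 'M[{poly C}]_(m, n)) : 'M[C]_(m, n) :=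
  map_mx (horner_eval z) M.

Lemma det_evmx n (z : C) (M : 'M[{poly C}]_n) : \det (evmx z M) = (\det M).[z].
Proof. by rewrite /evmx det_map_mx. Qed.

Lemma adjmxM m n p (A : 'M[C]_(m, n)) (B : 'M[C]_(n, p)) :
  (A *m B)^t* = B^t* *m A^t*.
Proof. by rewrite trmx_mul map_mxM. Qed.

Lemma adjmxK m n (A : 'M[C]_(m, n)) : (A^t*)^t* = A.
Proof. by apply/matrixP => i j; rewrite !mxE conjCK. Qed.

Lemma adjmxZ m n (a : C) (A : 'M[C]_(m, n)) : (a *: A)^t* = a^* *: A^t*.
Proof. by apply/matrixP => i j; rewrite !mxE rmorphM. Qed.

Lemma adjmxD m n (A B : 'M[C]_(m, n)) : (A + B)^t* = A^t* + B^t*.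
Proof. by apply/matrixP => i j; rewrite !mxE rmorphD. Qed.

(** The matrix determinant lemma, by block elimination; the extra factor x on the left avoids
    division, so that it applies over a polynomial ring. *)
Lemma det_rank1_update (K : comRingType) (n : nat) (x y : K) (u : 'cV[K]_n) (v : 'rV[K]_n) :
  \det (x%:M + y *: (u *m v)) * x = x ^+ n * (x + y * (v *m u) 0 0).
Proof.
pose U := block_mx (1%:M : 'M[K]_n) 0 v (1%:M : 'M[K]_1).
pose A := block_mx (x%:M + y *: (u *m v)) (y *: u) 0 (x%:M : 'M[K]_1).
pose V := block_mx (1%:M : 'M[K]_n) 0 (- v) (1%:M : 'M[K]_1).
have dU : \det U = 1 by rewrite det_lblock !det1 mulr1.
have dV : \det V = 1 by rewrite det_lblock !det1 mulr1.
have dA : \det A = \det (x%:M + y *: (u *m v)) * x by rewrite det_ublock det_scalar1.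
have E : U *m A *m V = block_mx (x%:M) (y *: u) 0 (x%:M + y *: (v *m u)).
  rewrite /U /A /V !mulmx_block !mul1mx !mul0mx !mulmx0 !mulmx1 !addr0.
  congr block_mx.
  - by rewrite -scalemxAl mulmxN scalerN addrK.
  - by rewrite add0r.
  - rewrite mulmxDr mul_mx_scalar -scalemxAr mulmxA mulmxDl mul_scalar_mx.
    by rewrite -!scalemxAr -!scalemxAl !mulmxN !scalerN [X in _ + X]addrC addrACA !subrr addr0.
  - by rewrite add0r -scalemxAr addrC.
rewrite -dA -[LHS]mul1r -{1}dU -det_mulmx -[LHS]mulr1 -{1}dV -det_mulmx E.
rewrite det_ublock det_scalar; congr (_ * _).
by rewrite det_mx11 !mxE eqxx mulr1n.
Qed.

Lemma unit_kernel n (A : 'M[C]_n) : \det A = 0 ->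
  exists u : 'cV[C]_n, A *m u = 0 /\ u^t* *m u = 1%:M.
Proof.
move=> dA; have /det0P[v v0 vA] : \det A^T == 0 by rewrite det_tr dA.
pose s := \sum_i normc (v 0 i) ^+ 2.
have s0 : 0 < s.
  have /rV0Pn[i vi] := v0.
  rewrite /s (bigD1 i)//= ltr_pwDl//; last by apply: sumr_ge0 => j _; exact: sqr_ge0.
  by rewrite exprn_gt0// lt_neqAle eq_sym normc_eq0 vi normc_ge0.
pose c := (Num.sqrt s)^-1.
have cs : c ^+ 2 * s = 1.
  by rewrite /c exprVn sqr_sqrtr ?ltW// mulVf// gt_eqF.
exists (c%:C *: v^T); split.
  have Av : A *m v^T = 0 by apply/trmx_inj; rewrite trmx_mul trmxK vA trmx0.
  by rewrite -scalemxAr Av scaler0.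
apply/matrixP => i j; rewrite !ord1 !mxE eqxx mulr1n.
rewrite (eq_bigr (fun k => (c ^+ 2)%:C * (normc (v 0 k) ^+ 2)%:C)); last first.
  move=> k _; rewrite !mxE -mulc_conj.
  have cc : (c%:C)^* = c%:C :> C by rewrite conjE /= oppr0.
  have -> : (c%:C * v 0 k)^* = c%:C * (v 0 k)^* by rewrite rmorphM/= cc.
  by rewrite rmorphXn/=; ring.
by rewrite -mulr_sumr -rmorph_sum -rmorphM/= cs.
Qed.

Lemma root_1subXM (a z : C) : normc a < 1 -> normc z <= 1 ->
  ~~ root (1 - (a^*)%:P * 'X) z.
Proof.
move=> a1 z1; rewrite rootE !hornerE subr_eq0; apply/negP => /eqP h.
have : normc (a^* * z) = 1 by rewrite -h Normc.normc1.
rewrite Normc.normcM normc_conj; have := normc_ge0 a; have := normc_ge0 z; nra.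
Qed.

(** A zero a of the determinant inside the disk is traded for the factor 1 - conj(a) z by right
    multiplication with the Blaschke-Potapov factor I + ((1 - conj(a) z) / (z - a) - 1) u u^*, where
    u is a unit kernel vector of M at a. The product stays polynomial because M u vanishes at a, and
    the factor is unitary on the circle. *)
Lemma flip_zeros n (s : seq C) (P : {poly C}) (M : 'M[{poly C}]_n) :
  (forall a, a \in s -> normc a < 1) ->
  (forall z, normc z <= 1 -> ~~ root P z) ->
  \det M = P * \prod_(a <- s) ('X - a%:P) ->
  exists M' : 'M[{poly C}]_n,
    (forall z, normc z <= 1 -> ~~ root (\det M') z) /\
    (forall z, normc z = 1 ->
       evmx z M' *m (evmx z M')^t* = evmx z M *m (evmx z M)^t*).
Proof.
elim: s P M => [|a s ih] P M sP Pr dM.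
  by exists M; split=> // z z1; rewrite dM big_nil mulr1 Pr.
have a1 : normc a < 1 by apply: sP; rewrite inE eqxx.
have [u [Mu uu]] : exists u : 'cV[C]_n, evmx a M *m u = 0 /\ u^t* *m u = 1%:M.
  apply: unit_kernel; rewrite det_evmx dM big_cons.
  by rewrite hornerM hornerM hornerXsubC subrr mul0r mulr0.
pose up := map_mx polyC u; pose vp := map_mx polyC (u^t*).
have /choice[c cP] i : exists c : {poly C}, (M *m up) i 0 = c * ('X - a%:P).
  apply/factor_theorem; rewrite rootE; move/matrixP: Mu => /(_ i 0).
  rewrite !mxE => Mu; apply/eqP; rewrite -[RHS]Mu horner_sum.
  by apply: eq_bigr => k _; rewrite !mxE hornerM hornerC.
pose cp := \col_i c i.
have Mup : M *m up = ('X - a%:P) *: cp.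
  by apply/matrixP => i j; rewrite ord1 cP !mxE mulrC.
pose be : {poly C} := (1 - (a^*)%:P * 'X) - ('X - a%:P).
pose M' := M + be *: (cp *m vp).
have vu : (vp *m up) 0 0 = 1.
  by rewrite /vp /up -map_mxM uu !mxE eqxx mulr1n.
have XaM' : ('X - a%:P) *: M' = M *m (('X - a%:P)%:M + be *: (up *m vp)).
  rewrite mulmxDr mul_mx_scalar -scalemxAr mulmxA Mup -scalemxAl.
  by rewrite /M' scalerDr !scalerA mulrC.
have Xa0 : 'X - a%:P != 0 by rewrite polyXsubC_eq0.
have dM' : \det M' = (P * (1 - (a^*)%:P * 'X)) * \prod_(b <- s) ('X - b%:P).
  apply: (@mulfI _ (('X - a%:P) ^+ n * ('X - a%:P))).
    by rewrite mulf_neq0// expf_neq0.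
  have := congr1 determinant XaM'; rewrite detZ det_mulmx => h.
  have h2 := det_rank1_update ('X - a%:P) be up vp.
  rewrite mulrAC h -[LHS]mulrA h2 vu mulr1 dM big_cons /be; ring.
have [|z z1|M2 [M2r M2E]] := ih _ M' _ _ dM'.
- by move=> b bs; apply: sP; rewrite inE bs orbT.
- by rewrite rootM negb_or Pr ?root_1subXM.
exists M2; split=> // z z1; rewrite M2E//.
have evM' : evmx z M' = evmx z M + be.[z] *: (evmx z cp *m u^t*).
  rewrite /evmx /M' map_mxD map_mxZ map_mxM; congr (_ + _ *: (_ *m _)).
  by apply/matrixP => i j; rewrite !mxE; exact: hornerC.
have Mu' : evmx z M *m u = (z - a) *: evmx z cp.
  have -> : u = evmx z up.
    by apply/matrixP => i j; rewrite !mxE; exact/esym/hornerC.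
  by rewrite /evmx -map_mxM Mup map_mxZ/= /horner_eval !hornerE.
(* Unitarity on the circle amounts to |1 - conj(a) z| = |z - a|. *)
have scal : (z - a) * be.[z]^* + be.[z] * (z - a)^* + be.[z] * be.[z]^* = 0.
  have : (z - a + be.[z]) * (z - a + be.[z])^* = (z - a) * (z - a)^*.
    have bez : z - a + be.[z] = 1 - a^* * z.
      by rewrite /be !(hornerD, hornerN, hornerM, hornerC, hornerX); ring.
    rewrite bez.
    have zz : z * z^* = 1 by rewrite mulc_conj z1 expr1n.
    have -> : (1 - a^* * z)^* = 1 - a * z^* by rewrite rmorphB rmorph1 rmorphM/= conjCK.
    have -> : (z - a)^* = z^* - a^* by rewrite rmorphB.
    rewrite (_ : _ * _ = 1 - a^* * z - a * z^* + a^* * a * (z * z^*)); last by ring.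
    rewrite (_ : (z - a) * _ = z * z^* - a^* * z - a * z^* + a^* * a); last by ring.
    by rewrite zz; ring.
  rewrite rmorphD/= => h; apply: (@addrI _ ((z - a) * (z - a)^*)).
  by rewrite addr0 -[RHS]h; ring.
rewrite evM' adjmxD adjmxZ adjmxM adjmxK mulmxDl !mulmxDr -!scalemxAl -!scalemxAr.
rewrite [evmx z M *m (u *m _)]mulmxA Mu' -scalemxAl.
have -> : evmx z cp *m u^t* *m (evmx z M)^t* = (z - a)^* *: (evmx z cp *m (evmx z cp)^t*).
  by rewrite -mulmxA -adjmxM Mu' adjmxZ -scalemxAr.
have -> : evmx z cp *m u^t* *m (u *m (evmx z cp)^t*) = evmx z cp *m (evmx z cp)^t*.
  by rewrite mulmxA -(mulmxA _ (u^t*)) uu mulmx1.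
rewrite !scalerA -!addrA -!scalerDl -[RHS]addr0; congr (_ + _).
rewrite -[RHS](scale0r (evmx z cp *m (evmx z cp)^t*)); congr (_ *: _).
by rewrite -scal; ring.
Qed.

(** Reversing coefficients gives M(conj z) = conj(z)^L N(z) on the circle, hence the required
    product. The determinant of M has no zero on the circle but may have some inside the disk; these
    are flipped. *)
Lemma reversed_factor n (N : 'M[{poly C}]_n) :
  (forall z, normc z <= 1 -> ~~ root (\det N) z) ->
  exists M : 'M[{poly C}]_n,
    (forall z, normc z <= 1 -> ~~ root (\det M) z) /\
    (forall z, normc z = 1 ->
       evmx z^* M *m (evmx z^* M)^t* = evmx z N *m (evmx z N)^t*).
Proof.
move=> Nr; pose L := (\max_i \max_j size (N i j))%N.
have LN i j : (size (N i j) <= L.+1)%N.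
  apply: leqW; apply: leq_trans (leq_bigmax i).
  exact: (leq_bigmax (F := fun j => size (N i j))).
pose M : 'M[{poly C}]_n := \matrix_(i, j) \poly_(k < L.+1) (N i j)`_(L - k).
have zJ (z : C) : normc z = 1 -> z * z^* = 1 by move=> z1; rewrite mulc_conj z1 expr1n.
have MN (z : C) : normc z = 1 -> evmx z^* M = (z^*) ^+ L *: evmx z N.
  move=> z1; apply/matrixP => i j; rewrite !mxE /horner_eval horner_poly.
  rewrite (horner_coef_wide _ (LN i j)) mulr_sumr (reindex_inj rev_ord_inj)/=.
  apply: eq_bigr => k _; have kL : (k <= L)%N by rewrite -ltnS.
  have zL : (z^*) ^+ L = (z^*) ^+ (L - k) * (z^*) ^+ k by rewrite -exprD subnK.
  have zk : (z^*) ^+ k * z ^+ k = 1 by rewrite -exprMn [z^* * z]mulrC zJ// expr1n.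
  rewrite subSS subKn// zL.
  transitivity ((N i j)`_k * (z^*) ^+ (L - k) * ((z^*) ^+ k * z ^+ k)); first by rewrite zk mulr1.
  by ring.
have Mcirc (z : C) : normc z = 1 -> ~~ root (\det M) z.
  move=> z1; have zc : normc z^* = 1 by rewrite normc_conj.
  have z0 : z != 0 by rewrite -normc_eq0 z1 oner_eq0.
  rewrite rootE -det_evmx -{1}(conjCK z) MN// conjCK detZ mulf_neq0 ?expf_neq0//.
  by rewrite det_evmx; apply: Nr; rewrite zc.
have dM0 : \det M != 0.
  by apply: contraTneq (Mcirc 1 (Normc.normc1 _)) => ->; rewrite root0.
have [s Ds] := closed_field_poly_normal (\det M).
have lD : lead_coef (\det M) != 0 by rewrite lead_coef_eq0.
pose s1 := [seq a <- s | normc a < 1]; pose s2 := [seq a <- s | ~~ (normc a < 1)].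
pose P := lead_coef (\det M) *: \prod_(a <- s2) ('X - a%:P).
have dM : \det M = P * \prod_(a <- s1) ('X - a%:P).
  rewrite {1}Ds -scalerAl; congr (_ *: _); rewrite !big_filter mulrC.
  exact: (bigID (fun a : C => normc a < 1)).
have [|z z1|M' [M'r M'E]] := flip_zeros _ _ dM.
- by move=> a; rewrite mem_filter => /andP[].
- rewrite rootZ// root_prod_XsubC mem_filter -leNgt; apply/negP => /andP[z1' zs].
  have zn : normc z = 1 by apply/eqP; rewrite eq_le z1 z1'.
  by have := Mcirc _ zn; rewrite Ds rootZ// root_prod_XsubC zs.
exists M'; split=> // z z1; rewrite M'E ?normc_conj// MN// adjmxZ -scalemxAl -scalemxAr.
by rewrite scalerA rmorphXn/= conjCK -exprMn [z^* * z]mulrC zJ// expr1n scale1r.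
Qed.

End ZeroFlipping.

(** * Integrals against the weight *)

Section BoundedMeasurable.
Context {R : realType}.
Local Notation mu := (@lebesgue_measure R).
Implicit Types (f g : R -> R[i]) (d : R).

Definition bdmeas f := [/\ measurable_fun setT (CRe \o f),
  measurable_fun setT (CIm \o f) & exists M, forall t, normc (f t) <= M].

Lemma bdmeas_cst c : bdmeas (fun=> c).
Proof.
split; [exact: measurable_cst|exact: measurable_cst|].
by exists (normc c).
Qed.

Lemma bdmeasD f g : bdmeas f -> bdmeas g -> bdmeas (fun t => f t + g t).
Proof.
move=> [fr fi [M fM]] [gr gi [M' gM]]; split.
- by apply: eq_measurable_fun (measurable_funD fr gr) => t _ /=; rewrite CReD.
- by apply: eq_measurable_fun (measurable_funD fi gi) => t _ /=; rewrite CImD.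
- by exists (M + M') => t; rewrite (le_trans (normcD _ _))// lerD.
Qed.

Lemma bdmeasM f g : bdmeas f -> bdmeas g -> bdmeas (fun t => f t * g t).
Proof.
move=> [fr fi [M fM]] [gr gi [M' gM]]; split.
- apply: eq_measurable_fun (measurable_funB (measurable_funM fr gr) (measurable_funM fi gi)).
  by move=> t _ /=; rewrite CReM.
- apply: eq_measurable_fun (measurable_funD (measurable_funM fr gi) (measurable_funM fi gr)).
  by move=> t _ /=; rewrite CImM.
- by exists (M * M') => t; rewrite Normc.normcM ler_pM ?normc_ge0.
Qed.

Lemma bdmeas_conj f : bdmeas f -> bdmeas (fun t => (f t)^*).
Proof.
move=> [fr fi [M fM]]; split.
- by apply: eq_measurable_fun fr => t _ /=; rewrite conjE.
- apply: eq_measurable_fun (measurableT_comp (@oppr_measurable R setT) fi).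
  by move=> t _ /=; rewrite conjE.
- by exists M => t; rewrite normc_conj.
Qed.

Lemma bdmeasX f n : bdmeas f -> bdmeas (fun t => f t ^+ n).
Proof.
move=> bf; elim: n => [|n ih].
  by under eq_fun do rewrite expr0; exact: bdmeas_cst.
by under eq_fun do rewrite exprS; exact: bdmeasM.
Qed.

Lemma bdmeas_sum I (s : seq I) (P : pred I) (F : I -> R -> R[i]) :
  (forall i, P i -> bdmeas (F i)) -> bdmeas (fun t => \sum_(i <- s | P i) F i t).
Proof.
move=> bF; elim: s => [|i s ih].
  by under eq_fun do rewrite big_nil; exact: bdmeas_cst.
have [Pi|nPi] := boolP (P i); last by under eq_fun do rewrite big_cons (negbTE nPi).
by under eq_fun do rewrite big_cons Pi; apply: bdmeasD => //; exact: bF.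
Qed.

Lemma bdmeas_horner (p : {poly R[i]}) f : bdmeas f -> bdmeas (fun t => p.[f t]).
Proof.
move=> bf; under eq_fun do rewrite horner_coef.
by apply: bdmeas_sum => i _; apply: bdmeasM; [exact: bdmeas_cst|exact: bdmeasX].
Qed.

Lemma bdmeasV f (e : R) : 0 < e -> (forall t, e <= normc (f t)) -> bdmeas f ->
  bdmeas (fun t => (f t)^-1).
Proof.
move=> e0 fe [fr fi _].
pose v t := (CRe (f t) ^+ 2 + CIm (f t) ^+ 2)^-1.
have mv : measurable_fun setT v.
  have -> : v = (fun x => x `^ (-1)) \o (fun t => CRe (f t) ^+ 2 + CIm (f t) ^+ 2).
    by apply/funext => t; rewrite /v /= powR_inv1// addr_ge0 ?sqr_ge0.
  apply: measurableT_comp; first exact: measurable_powR.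
  by apply: measurable_funD; apply: measurable_funX.
split.
- apply: eq_measurable_fun (measurable_funM fr mv) => t _.
  by rewrite /v /=; case: (f t).
- apply: eq_measurable_fun (measurable_funM (measurableT_comp (@oppr_measurable R setT) fi) mv).
  by move=> t _; rewrite /v /=; case: (f t) => a b /=; rewrite mulNr.
- exists e^-1 => t; rewrite Normc.normcV lef_pV2 ?posrE//.
  exact: lt_le_trans (fe t).
Qed.

Lemma measurable_normc f : bdmeas f -> measurable_fun setT (fun t => normc (f t)).
Proof.
move=> [fr fi _].
have -> : (fun t => normc (f t)) =
    (fun x => x `^ 2^-1) \o (fun t => CRe (f t) ^+ 2 + CIm (f t) ^+ 2).
  apply/funext => t /=; rewrite -sqr_normcE powR12_sqrt ?sqr_ge0// sqrtr_sqr.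
  by rewrite ger0_norm// normc_ge0.
apply: measurableT_comp; first exact: measurable_powR.
by apply: measurable_funD; apply: measurable_funX.
Qed.

Lemma bdmeas_cis : bdmeas cis.
Proof.
split; [exact: continuous_measurable_fun (@continuous_cos R)|
  exact: continuous_measurable_fun (@continuous_sin R)|].
by exists 1 => t; rewrite normc_cis.
Qed.

End BoundedMeasurable.

(** * The weighted integral and its bounds *)

Section WeightedIntegral.
Context {R : realType}.
Local Notation mu := (@lebesgue_measure R).
Variable d : R.
Hypothesis d_itv : - 2^-1 < d < 2^-1.
Implicit Types (f g : R -> R[i]).

Definition wint f : R[i] := cintegral mu `[- pi, pi] (fun t => (wgt d t)%:C * f t).

Definition wmass : R := \int[mu]_(t in `[- pi, pi]) wgt d t.

Lemma wmass_ge0 : 0 <= wmass.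
Proof. by apply: Rintegral_ge0 => t _; exact: wgt_ge0. Qed.

Lemma cintegrable_w f : bdmeas f ->
  cintegrable mu `[- pi, pi] (fun t => (wgt d t)%:C * f t).
Proof. by move=> [fr fi [M fM]]; exact: cintegrable_wgtM fM. Qed.

Let mI : measurable (`[- pi, pi]%classic : set R). Proof. by []. Qed.

Lemma eq_wint f g : f =1 g -> wint f = wint g.
Proof. by move=> fg; apply: eq_cintegral => t _; rewrite fg. Qed.

Lemma wintD f g : bdmeas f -> bdmeas g ->
  wint (fun t => f t + g t) = wint f + wint g.
Proof.
move=> bf bg; rewrite /wint -cintegralD//; last 2 first.
- exact: cintegrable_w.
- exact: cintegrable_w.
by apply: eq_cintegral => t _; rewrite mulrDr.
Qed.

Lemma wintZ c f : bdmeas f -> wint (fun t => c * f t) = c * wint f.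
Proof.
move=> bf; rewrite /wint -cintegralZ//; last exact: cintegrable_w.
by apply: eq_cintegral => t _; rewrite mulrCA.
Qed.

Lemma wint_sum I (s : seq I) (P : pred I) (F : I -> R -> R[i]) :
  (forall i, P i -> bdmeas (F i)) ->
  wint (fun t => \sum_(i <- s | P i) F i t) = \sum_(i <- s | P i) wint (F i).
Proof.
move=> bF; rewrite /wint -cintegral_sum//; last by move=> i /bF; exact: cintegrable_w.
by apply: eq_cintegral => t _; rewrite mulr_sumr.
Qed.

Lemma wint_conj f : bdmeas f -> wint (fun t => (f t)^*) = (wint f)^*.
Proof.
move=> bf; rewrite /wint -cintegral_conj//; last exact: cintegrable_w.
apply: eq_cintegral => t _; rewrite rmorphM/=; congr (_ * _).
by rewrite conjE/= oppr0.
Qed.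

Lemma integrable_wnormc f : bdmeas f ->
  mu.-integrable `[- pi, pi] (EFin \o (fun t => wgt d t * normc (f t))).
Proof.
move=> bf; have [_ _ [M fM]] := bf.
apply: (@integrable_wgtM _ _ _ M) => //; first exact: measurable_normc.
by move=> t; rewrite ger0_norm ?normc_ge0.
Qed.

Lemma wint_le f : bdmeas f ->
  normc (wint f) <= 2 * \int[mu]_(t in `[- pi, pi]) (wgt d t * normc (f t)).
Proof.
move=> bf; apply: normc_cintegral => //; first exact: cintegrable_w.
  exact: integrable_wnormc.
move=> t _; rewrite Normc.normcM normc_real ger0_norm//; exact: wgt_ge0.
Qed.

Lemma wint_bound f M : bdmeas f -> (forall t, normc (f t) <= M) ->
  normc (wint f) <= 2 * (M * wmass).
Proof.
move=> bf fM; apply: (le_trans (wint_le bf)); rewrite ler_wpM2l//.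
rewrite /wmass -RintegralZl//; last exact: integrable_wgt.
apply: le_Rintegral => //.
- exact: integrable_wnormc.
- by apply: eq_integrable (integrableZl _ M (integrable_wgt d_itv)).
- by move=> t _; rewrite mulrC ler_wpM2r// wgt_ge0.
Qed.

Lemma wint_sqr f : bdmeas f ->
  wint (fun t => f t * (f t)^*) = (\int[mu]_(t in `[- pi, pi]) (wgt d t * normc (f t) ^+ 2))%:C.
Proof.
move=> bf; rewrite -cintegral_real//; apply: eq_cintegral => t _.
by rewrite mulc_conj -rmorphM.
Qed.

Lemma integrable_wsqr f : bdmeas f ->
  mu.-integrable `[- pi, pi] (EFin \o (fun t => wgt d t * normc (f t) ^+ 2)).
Proof.
move=> bf; have [_ _ [M fM]] := bf.
apply: (@integrable_wgtM _ _ _ (M ^+ 2)) => //.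
  by apply: measurable_funX; exact: measurable_normc.
move=> t; rewrite ger0_norm ?sqr_ge0// lerXn2r// ?nnegrE ?normc_ge0//.
exact: le_trans (normc_ge0 (f t)) _.
Qed.

(** AM-GM in the form |g| <= |g|^2 / (2 S) + S / 2 gives a bound linear in S; the halves cancel the
    factor 2 of [wint_le]. *)
Lemma wint_abs_le f g (S : R) : bdmeas f -> bdmeas g -> 0 < S ->
  CRe (wint (fun t => g t * (g t)^*)) <= S ^+ 2 ->
  forall M, (forall t, normc (f t) <= M) ->
  normc (wint (fun t => f t * (g t)^*)) <= M * S * (1 + wmass).
Proof.
move=> bf bg S0; rewrite wint_sqr//= => gS M fM.
have M0 : 0 <= M by apply: le_trans (fM 0); exact: normc_ge0.
have bfg : bdmeas (fun t => f t * (g t)^*) by apply: bdmeasM => //; exact: bdmeas_conj.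
have i1 := integrable_wnormc bg; have i2 := integrable_wsqr bg.
have iZ (c : R) (u : R -> R) : mu.-integrable `[- pi, pi] (EFin \o u) ->
    mu.-integrable `[- pi, pi] (EFin \o (fun t => c * u t)).
  by move=> iu; apply: eq_integrable (integrableZl _ c iu).
have iw := integrable_wgt d_itv.
apply: (le_trans (wint_le bfg)).
apply: (@le_trans _ _ (2 * \int[mu]_(t in `[- pi, pi])
    (M * ((2 * S)^-1 * (wgt d t * normc (g t) ^+ 2) + S / 2 * wgt d t)))).
  rewrite ler_wpM2l//; apply: le_Rintegral => //.
  - exact: integrable_wnormc.
  - apply: (iZ M (fun t => (2 * S)^-1 * (wgt d t * normc (g t) ^+ 2) + S / 2 * wgt d t)).
    by apply: eq_integrable (integrableD _ (iZ (2 * S)^-1 _ i2) (iZ (S / 2) _ iw)).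
  move=> t _; rewrite Normc.normcM normc_conj mulrCA.
  apply: (@le_trans _ _ (M * (wgt d t * normc (g t)))).
    by rewrite ler_wpM2r// mulr_ge0 ?wgt_ge0 ?normc_ge0.
  rewrite ler_wpM2l//.
  rewrite (_ : _ + _ = wgt d t * ((2 * S)^-1 * normc (g t) ^+ 2 + S / 2)); last by ring.
  rewrite ler_wpM2l ?wgt_ge0// -subr_ge0.
  rewrite (_ : _ - _ = (2 * S)^-1 * (normc (g t) - S) ^+ 2); last first.
    by field; rewrite gt_eqF.
  by rewrite mulr_ge0 ?sqr_ge0// invr_ge0 mulr_ge0// ltW.
have iA := iZ (2 * S)^-1 _ i2; have iB := iZ (S / 2) _ iw.
rewrite RintegralZl//; last by apply: eq_integrable (integrableD _ iA iB).
rewrite RintegralD// !RintegralZl// -/wmass.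
set J := \int[mu]_(t in _) _ in gS *.
rewrite [leLHS](_ : _ = M * (S^-1 * J + S * wmass)); last by field; rewrite gt_eqF.
rewrite -[leRHS]mulrA ler_wpM2l// mulrDr mulr1 lerD//.
by rewrite ler_pdivrMl// -expr2.
Qed.

End WeightedIntegral.

(** * Orthogonality on the circle, in both orientations *)

Section UnitCircle.
Context {R : realType}.
Local Notation C := R[i].
Local Notation mu := (@lebesgue_measure R).

(* The two orientations of the unit circle: forward and backward prediction. *)
Definition circle_param (zf : R -> C) := zf = cis \/ zf = (fun t => (cis t)^*).

Lemma circle_param_bdmeas zf : circle_param zf -> bdmeas zf.
Proof. by move=> [] ->; [|apply: bdmeas_conj]; exact: bdmeas_cis. Qed.

Lemma circle_param_normc zf t : circle_param zf -> normc (zf t) = 1.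
Proof. by move=> [] ->; rewrite ?normc_conj normc_cis. Qed.

(** The moments are real and even in the frequency, so both orientations of the circle share
    them. *)
Lemma wint_moments (d : R) : - 2^-1 < d < 2^-1 -> exists gam : nat -> R,
  (forall k, (k.+1%:R - d) * gam k.+1 = (k%:R + d) * gam k) /\
  forall zf, circle_param zf -> forall k l,
    wint d (fun t => zf t ^+ k * (zf t)^* ^+ l) = (gamZ gam (k%:Z - l%:Z))%:C.
Proof.
move=> dd; have [gam [gamE gam_rec]] := moment_real dd.
exists gam; split=> //.
have main k l : wint d (fun t => cis t ^+ k * (cis t)^* ^+ l) = (gamZ gam (k%:Z - l%:Z))%:C.
  have cisJ t : cis t * (cis t)^* = 1 :> C by rewrite mulc_conj normc_cis expr1n.
  have [lk|kl] := leqP l k.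
    rewrite subzn// /gamZ absz_nat -gamE; apply: eq_wint => t.
    by rewrite -{1}(subnK lk) exprD -mulrA -exprMn cisJ expr1n mulr1.
  rewrite -gamZN opprB subzn ?(ltnW kl)// /gamZ absz_nat.
  have <- : (wint d (fun t => cis t ^+ (l - k)))^* = (gam (l - k)%N)%:C.
    by rewrite /wint gamE conjE/= oppr0.
  rewrite -wint_conj//; last by apply: bdmeasX; exact: bdmeas_cis.
  apply: eq_wint => t; rewrite rmorphXn/= -{1}(subnK (ltnW kl)) exprD mulrCA -exprMn cisJ.
  by rewrite expr1n mulr1.
move=> zf [] -> k l; first exact: main.
rewrite -gamZN opprB -main; apply: eq_wint => t.
by rewrite conjCK mulrC.
Qed.

(** At d = 0 the moment recursion annihilates every nonzero frequency and so yields the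
    orthogonality of exponentials. *)
Lemma wint0_moments zf : circle_param zf -> forall k l,
  wint 0 (fun t => zf t ^+ k * (zf t)^* ^+ l) = (2 * pi * (k == l)%:R)%:C.
Proof.
have d0 : (- 2^-1 < (0 : R)) && ((0 : R) < 2^-1) by apply/andP; split; lra.
have [gam [gam_rec gamE]] := wint_moments d0.
have gS k : gam k.+1 = 0.
  elim: k => [|k ih].
    by have := gam_rec 0%N; rewrite subr0 mul1r addr0 mul0r.
  have := gam_rec k.+1; rewrite ih mulr0 subr0 => /eqP.
  by rewrite mulf_eq0 pnatr_eq0/= => /eqP.
have g0 : (gam 0%N)%:C = (2 * pi)%:C :> C.
  have cP : circle_param (cis : R -> C) by left.
  have := gamE _ cP 0%N 0%N; rewrite /gamZ subrr absz0 => <-.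
  rewrite /wint (_ : cintegral _ _ _ = cintegral mu `[- pi, pi] (fun=> (1 : R)%:C)); last first.
    by apply: eq_cintegral => t _; rewrite !expr0 !mulr1 /wgt oppr0 powRr0.
  rewrite cintegral_real// Rintegral_cst// mul1r.
  have h : mu `[(- pi)%R, pi] = (2 * pi)%:E.
    rewrite lebesgue_measure_itv/= lte_fin ifT; last by have := pi_gt0 R; lra.
    by rewrite -EFinD; congr EFin; ring.
  by congr (_%:C); exact: (congr1 fine h).
move=> zP k l; rewrite gamE//; have [->|kl] := eqVneq k l.
  by rewrite subrr /gamZ absz0 mulr1.
rewrite mulr0 /gamZ; case E : `|k%:Z - l%:Z|%N => [|m]; last by rewrite gS.
by move/eqP: kl; case; lia.
Qed.

Lemma sum_geom_rev_le (r : R) N m : 0 <= r -> r < 1 ->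
  \sum_(k < N | (k < m)%N) r ^+ (m - k.+1) <= (1 - r)^-1.
Proof.
move=> r0 r1; apply: (@le_trans _ _ (\sum_(k < m) r ^+ (m - k.+1))); last first.
  by rewrite (reindex_inj rev_ord_inj)/=; under eq_bigr => k _ do
    rewrite subnSK// subKn 1?ltnW//; exact: sum_geom_le.
rewrite (big_ord_widen_cond (maxn N m) (fun k => (k < m)%N) (fun k => r ^+ (m - k.+1)))
  ?leq_maxl//.
rewrite [leRHS](big_ord_widen (maxn N m) (fun k => r ^+ (m - k.+1))) ?leq_maxr//.
rewrite big_mkcond [leRHS]big_mkcond; apply: ler_sum => k _.
by case: (k < m)%N => //=; case: ifP => // _; exact: exprn_ge0.
Qed.

Section SzegoOnCircle.
Variables (d : R) (gam : nat -> R) (zf : R -> C).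
Hypothesis d_itv : - 2^-1 < d < 2^-1.
Hypothesis d_neq0 : d != 0.
Hypothesis gam_rec : forall k, (k.+1%:R - d) * gam k.+1 = (k%:R + d) * gam k.
Hypothesis zP : circle_param zf.
Hypothesis momE : forall k l,
  wint d (fun t => zf t ^+ k * (zf t)^* ^+ l) = (gamZ gam (k%:Z - l%:Z))%:C.

Definition szphi (n : nat) : {poly C} := \poly_(k < n.+1) (sz d n k)%:C.

Let bz : bdmeas zf := circle_param_bdmeas zP.

Let bp (p : {poly C}) : bdmeas (fun t => p.[zf t]) := bdmeas_horner p bz.

Let bpJ (p : {poly C}) : bdmeas (fun t => (p.[zf t])^*) := bdmeas_conj (bp p).

Lemma wint_szphiX n m :
  wint d (fun t => (szphi n).[zf t] * (zf t)^* ^+ m) = (szmom d gam n m)%:C.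
Proof.
have -> : wint d (fun t => (szphi n).[zf t] * (zf t)^* ^+ m) =
  wint d (fun t => \sum_(k < n.+1) (sz d n k)%:C * (zf t ^+ k * (zf t)^* ^+ m)).
  apply: eq_wint => t; rewrite horner_poly mulr_suml.
  by apply: eq_bigr => k _; rewrite mulrA.
have bk (k : nat) : bdmeas (fun t => zf t ^+ k * (zf t)^* ^+ m).
  by apply: bdmeasM; apply: bdmeasX => //; exact: bdmeas_conj.
rewrite wint_sum//; last by move=> k _; apply: bdmeasM; [exact: bdmeas_cst|].
rewrite /szmom rmorph_sum; apply: eq_bigr => k _.
by rewrite wintZ// momE rmorphM/= -gamZN opprB.
Qed.

Lemma wint_szphi_poly n (h : {poly C}) :
  wint d (fun t => (szphi n).[zf t] * (h.[zf t])^*) =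
  \sum_(m < size h) (h`_m)^* * (szmom d gam n m)%:C.
Proof.
have -> : wint d (fun t => (szphi n).[zf t] * (h.[zf t])^*) =
  wint d (fun t => \sum_(m < size h) (h`_m)^* * ((szphi n).[zf t] * (zf t)^* ^+ m)).
  apply: eq_wint => t; rewrite (horner_coef h) rmorph_sum mulr_sumr.
  by apply: eq_bigr => k _; rewrite rmorphM rmorphXn/= mulrCA.
have bk (k : nat) : bdmeas (fun t => (szphi n).[zf t] * (zf t)^* ^+ k).
  by apply: bdmeasM => //; apply: bdmeasX; exact: bdmeas_conj.
rewrite wint_sum//; last by move=> k _; apply: bdmeasM; [exact: bdmeas_cst|].
by apply: eq_bigr => m _; rewrite wintZ// wint_szphiX.
Qed.

(** Since h vanishes at 0 and [szphi n] is orthogonal to z, ..., z^n, only the degrees beyond n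
    contribute, with their O(1/n) pairings. *)
Lemma wint_szphi_tail n (h : {poly C}) (B r : R) : h`_0 = 0 -> 0 <= r ->
  (forall l, normc h`_(n.+1 + l) <= B * r ^+ l) ->
  forall K, (forall L, \sum_(l < L) (l.+1 * l.+2)%:R * r ^+ l <= K) ->
  normc (wint d (fun t => (szphi n).[zf t] * (h.[zf t])^*)) <=
    `|gam 0%N| * B * K / n.+1%:R.
Proof.
move=> h0 r0 hB K KP; rewrite wint_szphi_poly.
have B0 : 0 <= B by have := hB 0%N; rewrite expr0 mulr1; apply: le_trans; exact: normc_ge0.
have n0 : 0 <= n.+1%:R^-1 :> R by rewrite invr_ge0.
have ext : \sum_(m < size h) (h`_m)^* * (szmom d gam n m)%:C =
  \sum_(m < n.+1 + size h) (h`_m)^* * (szmom d gam n m)%:C.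
  rewrite addnC big_split_ord/= [X in _ = _ + X]big1 ?addr0// => i _.
  by rewrite nth_default ?leq_addr// rmorph0 mul0r.
rewrite ext big_split_ord/= big1 ?add0r; last first.
  move=> i _; have [i0|i0] := posnP i; first by rewrite i0 h0 rmorph0 mul0r.
  have := szmom_ortho d_itv d_neq0 gam_rec (n := n) (k := i).
  by rewrite i0 -ltnS ltn_ord => -> //; rewrite mulr0.
apply: (le_trans (normc_sum _ _ _)).
apply: (@le_trans _ _ (\sum_(l < size h) `|gam 0%N| * B / n.+1%:R *
   ((l.+1 * l.+2)%:R * r ^+ l))); last first.
  rewrite -mulr_sumr mulrAC ler_wpM2r// ler_wpM2l// mulr_ge0//.
apply: ler_sum => l _; rewrite Normc.normcM normc_conj normc_real.
have := szmom_tail_le d_itv d_neq0 gam_rec n l; rewrite -addSn => tl.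
apply: (le_trans (ler_pM (normc_ge0 _) (normr_ge0 _) (hB l) tl)).
by rewrite le_eqVlt; apply/orP; left; apply/eqP; ring.
Qed.

(** On the circle |z - a| >= |a| - 1 > 0 for each root a. *)
Lemma lin_poly_lower_bound (rho : {poly C}) : (forall z : C, normc z <= 1 -> ~~ root rho z) ->
  exists2 e : R, 0 < e & forall t, e <= normc rho.[zf t].
Proof.
move=> rr; have r0 : rho != 0.
  by apply: contraTneq (rr 0 _) => [->|]; rewrite ?root0// Normc.normc0.
have [s Ds] := closed_field_poly_normal rho.
have lD : lead_coef rho != 0 by rewrite lead_coef_eq0.
have sP z : z \in s -> 1 < normc z.
  move=> zs; rewrite ltNge; apply/negP => /rr; rewrite Ds rootZ// root_prod_XsubC.
  by rewrite zs.
have [e e0 eP] : exists2 e : R, 0 < e &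
    forall t, e <= normc (\prod_(z <- s) ('X - z%:P)).[zf t].
  elim: s sP {Ds} => [|a s ih] sP.
    by exists 1 => // t; rewrite big_nil hornerC Normc.normc1.
  have [|e e0 eP] := ih; first by move=> z zs; apply: sP; rewrite inE zs orbT.
  have a1 : 1 < normc a by apply: sP; rewrite inE eqxx.
  exists ((normc a - 1) * e); first by rewrite mulr_gt0// subr_gt0.
  move=> t; rewrite big_cons hornerM Normc.normcM ler_pM// ?subr_ge0 ?(ltW a1) ?(ltW e0)//.
  rewrite hornerXsubC -[normc (_ - _)]normcN opprB lerBlDr -(circle_param_normc t zP).
  by apply: le_trans (normcD _ _); rewrite subrK.
exists (normc (lead_coef rho) * e).
  by rewrite mulr_gt0// lt_neqAle eq_sym normc_eq0 lD normc_ge0.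
by move=> t; rewrite Ds hornerZ Normc.normcM -Ds ler_wpM2l// normc_ge0.
Qed.

Lemma bdmeas_rhoV (rho : {poly C}) : (forall z : C, normc z <= 1 -> ~~ root rho z) ->
  bdmeas (fun t => (rho.[zf t])^-1).
Proof. by move=> /lin_poly_lower_bound[e e0 eP]; exact: bdmeasV e0 eP (bp rho). Qed.

Lemma normc_horner_le (p : {poly C}) (B : R) n t : (size p <= n)%N ->
  (forall k, normc p`_k <= B) -> normc p.[zf t] <= n%:R * B.
Proof.
move=> pn pB; rewrite (horner_coef_wide _ pn); apply: (le_trans (normc_sum _ _ _)).
apply: (@le_trans _ _ (\sum_(i < n) B)).
  apply: ler_sum => i _.
  by rewrite Normc.normcM normcX circle_param_normc// expr1n mulr1.
by rewrite sumr_const card_ord mulr_natl.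
Qed.

(* Pairing with an analytic function [h / rho] vanishing at 0 only sees the
   coefficients beyond degree [n]; [1 / rho] is replaced by its Taylor
   polynomials, whose error tends to 0 uniformly on the circle. *)
Lemma wint_szphi_ratio (rho : {poly C}) (a : nat) :
  (forall z : C, normc z <= 1 -> ~~ root rho z) ->
  exists K, forall n (h : {poly C}) (M : R), h`_0 = 0 -> (size h <= n + a)%N ->
    (forall k, normc h`_k <= M) ->
    normc (wint d (fun t => (szphi n).[zf t] * (h.[zf t] / rho.[zf t])^*)) <=
      K * M / n.+1%:R.
Proof.
move=> rr; have [del [M1 [r1 [M10 r10 r11 Dd dM1]]]] := inv_series rr.
(* The rate is kept positive because its inverse power r^-a is needed. *)
pose r := Num.max r1 2^-1.
have r0 : 0 < r by rewrite lt_max invr_gt0 ltr0n orbT.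
have r1' : r < 1 by rewrite gt_max r11/=; lra.
have dM l : normc (del l) <= M1 * r ^+ l.
  apply: (le_trans (dM1 l)); rewrite ler_wpM2l// lerXn2r//.
  - by rewrite nnegrE ltW.
  by rewrite le_max lexx.
have [K KP] := sum_quad_geom (ltW r0) r1'.
pose A := M1 * r ^- a * (1 - r)^-1.
have A0 : 0 <= A by rewrite /A !mulr_ge0// ?invr_ge0 ?exprn_ge0 ?subr_ge0// ltW.
exists (`|gam 0%N| * A * K) => n h M h0 hn hM.
have M0 : 0 <= M by apply: le_trans (hM 0%N); exact: normc_ge0.
have brV := bdmeas_rhoV rr.
have rz t : rho.[zf t] != 0 by rewrite -rootE rr// circle_param_normc.
pose s := size rho; pose S := \sum_(i < s) normc rho`_i.
have S0 : 0 <= S by apply: sumr_ge0 => i _; exact: normc_ge0.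
pose E L := \poly_(i < L.+1) del i.
have EM L l : normc (E L)`_l <= M1 * r ^+ l.
  rewrite coef_poly; case: ifP => // _; rewrite Normc.normc0.
  by rewrite mulr_ge0// exprn_ge0// ltW.
(* The degree of h is below n + a, so the coefficient of index n + 1 + l involves [del] only from
   index l + 2 - a on. This costs r^-a and is uniform in L. *)
have hE L l : normc (h * E L)`_(n.+1 + l) <= (M * A) * r ^+ l.
  rewrite coefM; apply: (le_trans (normc_sum _ _ _)).
  apply: (@le_trans _ _ (\sum_(k < (n.+1 + l).+1 | (k < n + a)%N)
     M * (M1 * r ^- a * r ^+ l.+1 * r ^+ (n + a - k.+1)))).
    rewrite [leRHS]big_mkcond; apply: ler_sum => k _; case: ifP => ka; last first.
      by rewrite nth_default ?mul0r ?Normc.normc0// (leq_trans hn)// leqNgt ka.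
    rewrite Normc.normcM; apply: (le_trans (ler_pM (normc_ge0 _) (normc_ge0 _) (hM k) (EM _ _))).
    rewrite ler_wpM2l// -!mulrA ler_wpM2l// -exprD.
    rewrite ler_pdivlMl ?exprn_gt0// -exprD.
    rewrite (_ : (a + (n.+1 + l - k) = l.+1 + (n + a - k.+1) + 1)%N); last first.
      by move: (ltn_ord k) ka; clear; lia.
    by rewrite exprD expr1 ler_piMr ?exprn_ge0 ?ltW.
  rewrite -mulr_sumr -[leRHS]mulrA ler_wpM2l// -mulr_sumr -[leLHS]mulrA.
  have -> : A * r ^+ l = M1 * r ^- a * (r ^+ l * (1 - r)^-1) by rewrite /A mulrAC -mulrA.
  rewrite ler_wpM2l//; first by rewrite mulr_ge0// invr_ge0 exprn_ge0// ltW.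
  apply: ler_pM.
  - by rewrite exprn_ge0// ltW.
  - by apply: sumr_ge0 => i _; rewrite exprn_ge0// ltW.
  - by rewrite exprS ler_piMl ?exprn_ge0 ?ltW.
  exact: sum_geom_rev_le (ltW r0) r1'.
pose Z t := h.[zf t] / rho.[zf t].
have bZ : bdmeas Z by apply: bdmeasM.
have [B1 B1P] : exists B, forall t, normc (szphi n).[zf t] <= B by case: (bp (szphi n)).
have [B2 B2P] : exists B, forall t, normc (Z t) <= B by case: bZ.
(* The relative error of [E L] as an approximation of 1 / rho: z^(L+1) times a polynomial of bounded
   degree with coefficients O(r^L). *)
pose F L t := rho.[zf t] * (E L).[zf t] - 1.
have FL L t : normc (F L t) <= s%:R * (S * (M1 * r ^- s)) * r ^+ L.
  have [G DG] := series_inverse_poly L Dd.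
  have -> : F L t = zf t ^+ L.+1 * G.[zf t].
    rewrite /F -hornerM DG hornerD hornerC hornerM hornerXn; ring.
  rewrite Normc.normcM normcX circle_param_normc// expr1n mul1r -mulrA.
  have GE l : G`_l = (rho * E L)`_(L.+1 + l).
    by rewrite DG coefD coef1 coefXnM ltnNge leq_addr/= addKn add0r.
  have Gs : (size G <= s)%N.
    apply/leq_sizeP => l sl; rewrite GE nth_default//.
    apply: leq_trans (size_polyMleq _ _) _.
    have := size_poly L.+1 del; rewrite -/(E L) -/s; move: sl; move: (size (E L)) (s).
    by clear; lia.
  apply: normc_horner_le => // l; rewrite GE coefM.
  apply: (le_trans (normc_sum _ _ _)).
  apply: (@le_trans _ _ (\sum_(i < (L.+1 + l).+1 | (i < s)%N)
      normc rho`_i * (M1 * r ^- s * r ^+ L))).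
    rewrite [leRHS]big_mkcond; apply: ler_sum => k _; case: ifP => ks; last first.
      by rewrite nth_default ?mul0r ?Normc.normc0// leqNgt ks.
    rewrite Normc.normcM ler_wpM2l ?normc_ge0//.
    apply: (le_trans (EM _ _)); rewrite -mulrA ler_wpM2l//.
    rewrite ler_pdivlMl ?exprn_gt0// -exprD ler_wiXn2l ?(ltW r0) ?(ltW r1')//.
    by move: ks (ltn_ord k); clear; lia.
  rewrite -mulr_suml -!mulrA.
  have c0 : 0 <= M1 * (r ^- s * r ^+ L).
    by rewrite !mulr_ge0 ?invr_ge0 ?exprn_ge0 ?(ltW r0).
  rewrite ler_wpM2r//.
  rewrite (big_ord_widen_cond (maxn (L.+1 + l).+1 s) (fun k => (k < s)%N)
    (fun k => normc rho`_k)) ?leq_maxl//.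
  rewrite /S (big_ord_widen (maxn (L.+1 + l).+1 s) (fun k => normc rho`_k)) ?leq_maxr//.
  rewrite big_mkcond [leRHS]big_mkcond; apply: ler_sum => k _.
  by case: (k < s)%N => //=; case: ifP => // _; exact: normc_ge0.
have wm := wmass_ge0 d.
have B10 : 0 <= B1 by apply: le_trans (B1P 0); exact: normc_ge0.
have B20 : 0 <= B2 by apply: le_trans (B2P 0); exact: normc_ge0.
pose W := 2 * (B1 * (B2 * (s%:R * (S * (M1 * r ^- s)))) * wmass d).
have W0 : 0 <= W.
  by rewrite /W !mulr_ge0// invr_ge0 exprn_ge0// ltW.
have bnd L : normc (wint d (fun t => (szphi n).[zf t] * (Z t)^*)) <=
    `|gam 0%N| * A * K * M / n.+1%:R + W * r ^+ L.
  have bF : bdmeas (F L).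
    by apply: bdmeasD; [apply: bdmeasM|exact: bdmeas_cst].
  have bZF : bdmeas (fun t => Z t * F L t) by apply: bdmeasM.
  have -> : wint d (fun t => (szphi n).[zf t] * (Z t)^*) =
     wint d (fun t => (szphi n).[zf t] * ((h * E L).[zf t])^*) +
     (-1) * wint d (fun t => (szphi n).[zf t] * (Z t * F L t)^*).
    rewrite -wintZ//; last by apply: bdmeasM => //; exact: bdmeas_conj.
    rewrite -wintD//; last 2 first.
    - by apply: bdmeasM.
    - by apply: bdmeasM; [exact: bdmeas_cst|apply: bdmeasM => //; exact: bdmeas_conj].
    apply: eq_wint => t; rewrite mulN1r -mulrN -mulrDr -rmorphN -rmorphD; congr (_ * _^*).
    by rewrite /Z /F hornerM; field; exact: rz.
  rewrite mulN1r; apply: (le_trans (normcB _ _)); apply: lerD.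
    have hE0 : (h * E L)`_0 = 0 by rewrite coefM big_ord1 subn0 h0 mul0r.
    apply: (le_trans (wint_szphi_tail hE0 (ltW r0) (hE L) KP)).
    by rewrite le_eqVlt; apply/orP; left; apply/eqP; ring.
  have bPF : bdmeas (fun t => (szphi n).[zf t] * (Z t * F L t)^*).
    by apply: bdmeasM => //; exact: bdmeas_conj.
  have := wint_bound d_itv (M := B1 * (B2 * (s%:R * (S * (M1 * r ^- s)) * r ^+ L))) bPF.
  move=> /(_ _)/le_trans; apply.
    move=> t; rewrite Normc.normcM normc_conj Normc.normcM.
    by apply: ler_pM; rewrite ?mulr_ge0 ?normc_ge0//; apply: ler_pM; rewrite ?normc_ge0.
  by rewrite /W le_eqVlt; apply/orP; left; apply/eqP; ring.
rewrite -[leLHS]/(normc (wint d (fun t => (szphi n).[zf t] * (Z t)^*))).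
apply/ler_addgt0Pr => e e0.
have [L LP] : exists L, W * r ^+ L <= e.
  have h1 : 0 < 1 - r by rewrite subr_gt0.
  exists (Num.truncn (W * (1 - r)^-1 / e)).
  set L := Num.truncn _; have := natmul_geom_le L (ltW r0) r1'.
  have : W * (1 - r)^-1 / e <= L.+1%:R by exact: ltW (truncnS_gt _).
  rewrite ler_pdivrMr// => le1 le2.
  have L0 : 0 < L.+1%:R :> R by rewrite ltr0n.
  rewrite -(ler_pM2l L0) mulrCA; apply: le_trans le1.
  by rewrite ler_wpM2l.
by apply: (le_trans (bnd L)); rewrite lerD2l.
Qed.

End SzegoOnCircle.
End UnitCircle.

(** * Unweighted integrals controlled by the weighted norm *)

Section UnweightedBound.
Context {R : realType}.
Local Notation C := R[i].
Local Notation mu := (@lebesgue_measure R).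
Variable d : R.
Hypothesis d_itv : - 2^-1 < d < 2^-1.

Let dN_itv : - 2^-1 < - d < 2^-1.
Proof. by case/andP: d_itv => d1 d2; apply/andP; split; lra. Qed.

(* The weights [wgt d] and [wgt (- d)] are mutually inverse away from 0, so that
   AM-GM bounds an L^1 norm by a weighted L^2 norm. *)
Lemma wint0_abs_le (f g : R -> C) (S : R) : bdmeas f -> bdmeas g -> 0 < S ->
  CRe (wint d (fun t => g t * (g t)^*)) <= S ^+ 2 ->
  forall M, (forall t, normc (f t) <= M) ->
  normc (wint 0 (fun t => f t * g t)) <= M * S * (1 + wmass (- d)).
Proof.
move=> bf bg S0; rewrite wint_sqr//= => gS M fM.
have d00 : (- 2^-1 < (0 : R)) && ((0 : R) < 2^-1) by apply/andP; split; lra.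
have M0 : 0 <= M by apply: le_trans (fM 0); exact: normc_ge0.
have bfg : bdmeas (fun t => f t * g t) by apply: bdmeasM.
have i2 := integrable_wsqr d_itv bg; have iw := integrable_wgt dN_itv.
have iZ (c : R) (u : R -> R) : mu.-integrable `[- pi, pi] (EFin \o u) ->
    mu.-integrable `[- pi, pi] (EFin \o (fun t => c * u t)).
  by move=> iu; apply: eq_integrable (integrableZl _ c iu).
apply: (le_trans (wint_le d00 bfg)).
pose u t := M * ((2 * S)^-1 * (wgt d t * normc (g t) ^+ 2) + S / 2 * wgt (- d) t).
have iu : mu.-integrable `[- pi, pi] (EFin \o u).
  apply: (iZ M (fun t => (2 * S)^-1 * (wgt d t * normc (g t) ^+ 2) + S / 2 * wgt (- d) t)).
  by apply: eq_integrable (integrableD _ (iZ (2 * S)^-1 _ i2) (iZ (S / 2) _ iw)).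
have iF := integrable_wnormc d00 bfg.
(* The point 0, where [wgtM] does not apply, is removed from the interval. *)
have D0 (v : R -> R) : mu.-integrable `[- pi, pi] (EFin \o v) ->
    \int[mu]_(t in `[- pi, pi] `\ 0) v t = \int[mu]_(t in `[- pi, pi]) v t.
  move=> iv; congr fine; apply: integral_setD1 => //.
    by apply: measurableD => //; exact: measurable_set1.
  by apply: measurable_funS (measurable_int mu iv) => //; exact: subDsetl.
apply: (@le_trans _ _ (2 * \int[mu]_(t in `[- pi, pi]) u t)).
  rewrite ler_wpM2l// -(D0 _ iF) -(D0 _ iu).
  have mD : measurable (`[- pi, pi] `\ (0 : R) : set R).
    by apply: measurableD => //; exact: measurable_set1.
  have sD : `[- pi, pi]%classic `\ (0 : R) `<=` `[- pi, pi]%classic by exact: subDsetl.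
  apply: le_Rintegral => //.
  - exact: integrableS iF.
  - exact: integrableS iu.
  move=> t [tpi t0].
  have {}t0 : t != 0 by apply/eqP.
  have W1 : wgt d t * wgt (- d) t = 1.
    by apply: wgtM => //; move: tpi; rewrite /= in_itv.
  have W0 : wgt 0 t = 1 by rewrite /wgt oppr0 powRr0.
  have := wgt_ge0 d t; have := wgt_ge0 (- d) t.
  move: W1; rewrite /u W0 mul1r Normc.normcM.
  move: (wgt d t) (wgt (- d) t) => a b ab b0 a0.
  apply: (@le_trans _ _ (M * normc (g t))); first by rewrite ler_wpM2r ?normc_ge0.
  rewrite ler_wpM2l// -subr_ge0.
  rewrite (_ : _ - _ = (2 * S)^-1 * (a * (normc (g t) - S * b) ^+ 2) +
    (1 - a * b) * (S / 2 * b - normc (g t))); last first.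
    by field; rewrite gt_eqF.
  rewrite ab subrr mul0r addr0; apply: mulr_ge0; first by rewrite invr_ge0 mulr_ge0// ltW.
  by apply: mulr_ge0 => //; exact: sqr_ge0.
have iA := iZ (2 * S)^-1 _ i2; have iB := iZ (S / 2) _ iw.
rewrite RintegralZl//; last by apply: eq_integrable (integrableD _ iA iB).
rewrite RintegralD// !RintegralZl// -/(wmass (- d)).
set J := \int[mu]_(t in _) _ in gS *.
rewrite [leLHS](_ : _ = M * (S^-1 * J + S * wmass (- d))); last by field; rewrite gt_eqF.
rewrite -[leRHS]mulrA ler_wpM2l// mulrDr mulr1 lerD//.
by rewrite ler_pdivrMl// -expr2.
Qed.

End UnweightedBound.

(** * The trial predictor *)

Section TrialPolynomial.
Local Open Scope sesquilinear_scope.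
Context {R : realType}.
Local Notation C := R[i].
Local Notation mu := (@lebesgue_measure R).
Variables (d : R) (gam : nat -> R) (zf : R -> C) (q : nat).
Variables (N : 'M[{poly C}]_q) (rho : {poly C}).
Hypothesis d_itv : - 2^-1 < d < 2^-1.
Hypothesis d_neq0 : d != 0.
Hypothesis gam_rec : forall k, (k.+1%:R - d) * gam k.+1 = (k%:R + d) * gam k.
Hypothesis zP : circle_param zf.
Hypothesis momE : forall k l,
  wint d (fun t => zf t ^+ k * (zf t)^* ^+ l) = (gamZ gam (k%:Z - l%:Z))%:C.
Hypothesis rho_root : forall z : C, normc z <= 1 -> ~~ root rho z.
Hypothesis detN_root : forall z : C, normc z <= 1 -> ~~ root (\det N) z.

(** The rational part of the transfer function of the combination with coefficients f; the
    fractional part is carried by the weight in [wint]. *)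
Definition transfer (f : 'rV[{poly C}]_q) (l : 'I_q) (t : R) : C :=
  ((f *m N) 0 l).[zf t] / rho.[zf t].

(* [2 pi] times the inner product, in the spectral domain, of the random
   variables with coefficient polynomials [f] and [h]. *)
Definition spair (f h : 'rV[{poly C}]_q) : C :=
  \sum_l wint d (fun t => transfer f l t * (transfer h l t)^*).

Let bz : bdmeas zf := circle_param_bdmeas zP.

Let bp (p : {poly C}) : bdmeas (fun t => p.[zf t]) := bdmeas_horner p bz.

Lemma bdmeas_transfer f l : bdmeas (transfer f l).
Proof. by apply: bdmeasM => //; exact: bdmeas_rhoV. Qed.

Lemma transfer_sqr_le f S l : CRe (spair f f) <= S ->
  CRe (wint d (fun t => transfer f l t * (transfer f l t)^*)) <= S.
Proof.
apply: le_trans; rewrite /spair (bigD1 l)//= CReD lerDl CRe_sum.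
apply: sumr_ge0 => k _; rewrite wint_sqr//=; last exact: bdmeas_transfer.
by apply: Rintegral_ge0 => t _; rewrite mulr_ge0 ?wgt_ge0 ?sqr_ge0.
Qed.

Lemma wint0_coef (p : {poly C}) j :
  wint 0 (fun t => (zf t)^* ^+ j * p.[zf t]) = (2 * pi)%:C * p`_j.
Proof.
have d0 : (- 2^-1 < (0 : R)) && ((0 : R) < 2^-1) by apply/andP; split; lra.
have bk (k : nat) : bdmeas (fun t => zf t ^+ k * (zf t)^* ^+ j).
  by apply: bdmeasM; apply: bdmeasX => //; exact: bdmeas_conj.
have -> : wint 0 (fun t => (zf t)^* ^+ j * p.[zf t]) =
   wint 0 (fun t => \sum_(k < size p) p`_k * (zf t ^+ k * (zf t)^* ^+ j)).
  apply: eq_wint => t; rewrite horner_coef mulr_sumr.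
  by apply: eq_bigr => k _; rewrite mulrC mulrA.
rewrite (wint_sum d0); last by move=> k _; apply: bdmeasM; [exact: bdmeas_cst|].
under eq_bigr => k _ do rewrite (wintZ d0)// (wint0_moments zP).
have [jp|pj] := ltnP j (size p).
  rewrite (bigD1 (Ordinal jp))//= eqxx mulr1 big1 ?addr0 1?mulrC// => k kj.
  by rewrite (negbTE (_ : (k : nat) != j)) ?mulr0 ?mulr0//; apply: contraNneq kj => kj;
    exact/eqP/val_inj.
rewrite nth_default// mulr0 big1// => k _.
by rewrite ltn_eqF ?(leq_trans (ltn_ord k))// !mulr0.
Qed.

(** As f is its transfer function times the bounded matrix rho adj N / det N, each coefficient of f
    is an unweighted Fourier integral to which [wint0_abs_le] applies. The constant does not depend
    on the degree of f. *)
Lemma coef_bound : exists C0, 0 <= C0 /\ forall (f : 'rV[{poly C}]_q) S, 0 < S ->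
  CRe (spair f f) <= S ^+ 2 -> forall k j, normc (f 0 k)`_j <= C0 * S.
Proof.
pose A := rho *: \adj N.
have bE l k : bdmeas (fun t => (A l k).[zf t] / (\det N).[zf t]).
  by apply: bdmeasM => //; exact: bdmeas_rhoV.
have /choice[B0 B0P] : forall lk, exists B : R, forall t,
    normc ((A lk.1 lk.2).[zf t] / (\det N).[zf t]) <= B.
  by move=> lk; have [] := bE lk.1 lk.2.
pose B := \sum_lk `|B0 lk|.
have BP l k t : normc ((A l k).[zf t] / (\det N).[zf t]) <= B.
  apply: (le_trans (B0P (l, k) t)); apply: (le_trans (ler_norm _)).
  by rewrite /B (bigD1 (l, k))//= lerDl sumr_ge0.
have Bge0 : 0 <= B by apply: sumr_ge0.
have wm := wmass_ge0 (- d).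
exists ((2 * pi)^-1 * (q%:R * (B * (1 + wmass (- d))))); split.
  by rewrite !mulr_ge0 ?invr_ge0 ?mulr_ge0 ?pi_ge0 ?addr_ge0.
move=> f S S0 fS k j.
have pi0 : 0 < 2 * pi :> R by rewrite mulr_gt0 ?pi_gt0.
rewrite -mulrA ler_pdivlMl//.
have -> : 2 * pi * normc (f 0 k)`_j = normc ((2 * pi)%:C * (f 0 k)`_j).
  by rewrite Normc.normcM normc_real gtr0_norm.
rewrite -wint0_coef.
pose E l t := (zf t)^* ^+ j * ((A l k).[zf t] / (\det N).[zf t]).
have bEE l : bdmeas (E l).
  by apply: bdmeasM => //; apply: bdmeasX; exact: bdmeas_conj.
have -> : wint 0 (fun t => (zf t)^* ^+ j * (f 0 k).[zf t]) =
    wint 0 (fun t => \sum_l E l t * transfer f l t).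
  apply: eq_wint => t.
  have rz : rho.[zf t] != 0 by rewrite -rootE rho_root// circle_param_normc.
  have dz : (\det N).[zf t] != 0 by rewrite -rootE detN_root// circle_param_normc.
  have fE : (\det N * rho) * f 0 k = \sum_l (f *m N) 0 l * A l k.
    have -> : \sum_l (f *m N) 0 l * A l k = (f *m N *m A) 0 k by rewrite mxE.
    by rewrite /A -scalemxAr -mulmxA mul_mx_adj mul_mx_scalar !mxE mulrA [rho * _]mulrC.
  have {}fE : (f 0 k).[zf t] = ((\det N).[zf t] * rho.[zf t])^-1 *
     \sum_l ((f *m N) 0 l).[zf t] * (A l k).[zf t].
    have := congr1 (horner^~ (zf t)) fE; rewrite horner_sum !hornerM.
    under eq_bigr => l _ do rewrite hornerM.
    by move=> <-; rewrite mulKf// mulf_neq0.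
  rewrite fE mulr_sumr mulr_sumr; apply: eq_bigr => l _.
  by rewrite /E /transfer; field; rewrite rz dz.
have d0 : (- 2^-1 < (0 : R)) && ((0 : R) < 2^-1) by apply/andP; split; lra.
rewrite (wint_sum d0); last by move=> l _; apply: bdmeasM => //; exact: bdmeas_transfer.
apply: (le_trans (normc_sum _ _ _)).
apply: (@le_trans _ _ (\sum_(l < q) B * S * (1 + wmass (- d)))).
  apply: ler_sum => l _.
  apply: (wint0_abs_le d_itv _ (bdmeas_transfer f l) S0) => //.
    exact: transfer_sqr_le.
  move=> t; rewrite /E Normc.normcM normcX normc_conj circle_param_normc// expr1n mul1r.
  exact: BP.
by rewrite sumr_const card_ord le_eqVlt -mulr_natl; apply/orP; left; apply/eqP; ring.
Qed.

Definition lead_factor : 'M[C]_q := rho.[0]^-1 *: evmx 0 N.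

Let Phi (n : nat) (s : {poly C}) t := (szphi d n + 'X^(n.+1) * s).[zf t].

Let PhiE n s t : Phi n s t = (szphi d n).[zf t] + zf t ^+ n.+1 * s.[zf t].
Proof. by rewrite /Phi hornerD hornerM hornerXn. Qed.

Let bPhi n s : bdmeas (Phi n s). Proof. exact: bp. Qed.

Lemma wint_szphi_sqr n :
  wint d (fun t => (szphi d n).[zf t] * ((szphi d n).[zf t])^*) = (szmom d gam n 0)%:C.
Proof.
rewrite (wint_szphi_poly d_itv zP momE).
have phi0 : (szphi d n)`_0 = 1 by rewrite coef_poly/= sz0.
have := size_poly n.+1 (fun k => (sz d n k)%:C); rewrite -/(szphi d n).
case E : (size (szphi d n)) => [|k] kn.
  by have /eqP := phi0; rewrite nth_default ?E// eq_sym oner_eq0.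
rewrite big_ord_recl/= phi0 rmorph1 mul1r big1 ?addr0// => i _.
by rewrite szmom_ortho ?mulr0//= /bump/= add1n (leq_trans (ltn_ord i)).
Qed.

(** The added part has O(1/n) coefficients and meets [szphi n] only through O(1/n) pairings; the
    cross terms and its own square are therefore O(n^-2). *)
Lemma szphi_shift_le (L : nat) (K1 : R) : exists K, forall n (s : {poly C}),
  (size s <= L)%N -> (forall l, normc s`_l <= K1 / n.+1%:R) ->
  normc (wint d (fun t => Phi n s t * (Phi n s t)^*) - (szmom d gam n 0)%:C) <=
    K / n.+1%:R ^+ 2.
Proof.
have h0 : 0 <= 2^-1 :> R by rewrite invr_ge0.
have h1 : 2^-1 < 1 :> R by lra.
have [K2 K2P] := sum_quad_geom h0 h1.
exists (2 * (`|gam 0%N| * (K1 * 2 ^+ L) * K2) + 2 * ((L%:R * K1) ^+ 2 * wmass d)).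
move=> n s sL sK.
have n0 : 0 < n.+1%:R :> R by rewrite ltr0n.
have K10 : 0 <= K1 / n.+1%:R by apply: le_trans (sK 0%N); exact: normc_ge0.
pose psi : {poly C} := 'X^(n.+1) * s.
have bpsiJ : bdmeas (fun t => (psi.[zf t])^*) by exact: bdmeas_conj.
have bphiJ : bdmeas (fun t => ((szphi d n).[zf t])^*) by exact: bdmeas_conj.
pose c := wint d (fun t => (szphi d n).[zf t] * (psi.[zf t])^*).
pose e := wint d (fun t => psi.[zf t] * (psi.[zf t])^*).
have -> : wint d (fun t => Phi n s t * (Phi n s t)^*) - (szmom d gam n 0)%:C =
    c + c^* + e.
  rewrite -wint_szphi_sqr /c -wint_conj//; last by apply: bdmeasM.
  have b1 : bdmeas (fun t => (szphi d n).[zf t] * ((szphi d n).[zf t])^*) by apply: bdmeasM.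
  have b2 : bdmeas (fun t => (szphi d n).[zf t] * (psi.[zf t])^*) by apply: bdmeasM.
  have b3 : bdmeas (fun t => ((szphi d n).[zf t] * (psi.[zf t])^*)^*) by apply: bdmeas_conj.
  have b4 : bdmeas (fun t => psi.[zf t] * (psi.[zf t])^*) by apply: bdmeasM.
  rewrite /e -wintD// -wintD//; last by apply: bdmeasD.
  apply/(canLR (addrK _)); rewrite -wintD//; last by apply: bdmeasD => //; apply: bdmeasD.
  apply: eq_wint => t; rewrite /Phi -/psi hornerD.
  by rewrite rmorphM/= conjCK rmorphD/=; ring.
(* The tail estimate expects geometric decay; as s has at most L coefficients, the ratio 1/2 with
   the constant 2^L will do. *)
have cle : normc c <= `|gam 0%N| * (K1 / n.+1%:R * 2 ^+ L) * K2 / n.+1%:R.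
  apply: (wint_szphi_tail d_itv d_neq0 gam_rec zP momE _ h0) => //.
    by rewrite coefXnM.
  move=> l; rewrite coefXnM ltnNge leq_addr/= addKn.
  have [lL|Ll] := ltnP l L; last first.
    rewrite nth_default ?(leq_trans sL)// Normc.normc0.
    by apply: mulr_ge0; [apply: mulr_ge0|]; rewrite ?exprn_ge0.
  apply: (le_trans (sK l)); rewrite -mulrA ler_peMr// exprVn.
  by rewrite -exprB ?(ltnW lL) ?unitfE// exprn_ege1// ler1n.
have ele : normc e <= 2 * ((L%:R * (K1 / n.+1%:R)) ^+ 2 * wmass d).
  apply: wint_bound => //; first by apply: bdmeasM.
  move=> t; rewrite Normc.normcM normc_conj expr2.
  have : normc psi.[zf t] <= L%:R * (K1 / n.+1%:R).
    rewrite hornerM hornerXn Normc.normcM normcX circle_param_normc// expr1n mul1r.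
    exact: normc_horner_le.
  by move=> h; apply: ler_pM; rewrite ?normc_ge0.
apply: (le_trans (normcD _ _)); apply: (le_trans (lerD (normcD _ _) (lexx _))).
rewrite normc_conj; apply: (le_trans (lerD (lerD cle cle) ele)).
move: n0; move: (n.+1%:R : R) => x x0.
by rewrite le_eqVlt; apply/orP; left; apply/eqP; field; rewrite gt_eqF.
Qed.

Lemma sum_coef_le (r : {poly C}) n :
  \sum_(i < n) normc r`_i <= \sum_(i < size r) normc r`_i.
Proof.
have : \sum_(i < n + size r) normc r`_i = \sum_(i < size r) normc r`_i.
  rewrite addnC big_split_ord/= [X in _ + X]big1 ?addr0// => i _.
  by rewrite nth_default ?leq_addr// Normc.normc0.
move=> <-; rewrite big_split_ord/= lerDl; apply: sumr_ge0 => i _; exact: normc_ge0.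
Qed.

Lemma normc_coefM_le (p r : {poly C}) M j : (forall k, normc p`_k <= M) ->
  normc (p * r)`_j <= M * \sum_(i < size r) normc r`_i.
Proof.
move=> pM; have M0 : 0 <= M by apply: le_trans (pM 0%N); exact: normc_ge0.
rewrite coefMr; apply: (le_trans (normc_sum _ _ _)).
apply: (@le_trans _ _ (M * \sum_(i < j.+1) normc r`_i)).
  rewrite mulr_sumr; apply: ler_sum => i _.
  by rewrite Normc.normcM ler_wpM2r ?normc_ge0.
by rewrite ler_wpM2l// sum_coef_le.
Qed.

(* [p i] is the [i]-th row of [t *: (g0 *m rho *: \adj N)] with
   [t * \det N = szphi m + O(1/m)]: the transfer of [p i] is close to
   [szphi m] times the constant [g0]. *)
Lemma trial_polynomial : exists (K1 K2 : R) (a : nat), forall m,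
  exists p : 'I_q -> 'rV[{poly C}]_q,
  [/\ forall i j, (size (p i 0%R j) <= (m + a).+1)%N,
      forall i j, (p i 0 j)`_0 = (i == j)%:R,
      forall i j, normc (spair (p i) (p j) -
        (szmom d gam m 0)%:C * (lead_factor *m lead_factor^t* ) i j) <= K1 / m.+1%:R ^+ 2 &
      forall (i : 'I_q) (f : 'rV[{poly C}]_q) (S : R), (forall j, (size (f 0%R j) <= (m + a).+1)%N) ->
        (forall j, (f 0 j)`_0 = 0) -> 0 < S -> CRe (spair f f) <= S ^+ 2 ->
        normc (spair (p i) f) <= K2 * S / m.+1%:R].
Proof.
pose g0 := lead_factor; pose B := (map_mx polyC g0 : 'M[{poly C}]_q) *m (rho *: \adj N).
pose a := (\sum_i \sum_j size (B i j))%N.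
have aB i j : (size (B i j) <= a)%N.
  by rewrite /a (bigD1 i)//= (bigD1 j)//= -addnA leq_addr.
pose b := (\sum_i \sum_j size (N i j))%N.
have bN i j : (size (N i j) <= b)%N.
  by rewrite /b (bigD1 i)//= (bigD1 j)//= -addnA leq_addr.
have [K0 K0P] := truncated_quotient detN_root.
have [KS KSP] := szphi_shift_le (size (\det N)) K0.
have [KA KAP] := wint_szphi_ratio d_itv d_neq0 gam_rec zP momE (a + b).+1 rho_root.
have [C0 [C00 C0P]] := coef_bound.
pose W := \sum_l \sum_k \sum_(i < size (N k l)) normc (N k l)`_i.
pose X := KA * (C0 * W) + (size (\det N))%:R * K0 * (1 + wmass d).
pose G := \sum_i \sum_j normc (g0 i j).
exists (KS * \sum_i \sum_j normc ((g0 *m g0^t* ) i j)), (G * X), a => m.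
have [t [s [st ss tD sK]]] : exists t s : {poly C}, [/\ (size t <= m.+1)%N,
    (size s <= size (\det N))%N, t * \det N = szphi d m + 'X^(m.+1) * s &
    forall l, normc s`_l <= K0 / m.+1%:R].
  apply: K0P; first exact: size_poly.
  move=> k km; rewrite coef_poly ltnS km normc_real; exact: sz_le.
have K00 : 0 <= K0 / m.+1%:R by apply: le_trans (sK 0%N); exact: normc_ge0.
pose p i := t *: row i B; exists p.
have rho0 : rho.[0] != 0 by rewrite -rootE rho_root// Normc.normc0 ler01.
have trE i l u : transfer (p i) l u = g0 i l * Phi m s u.
  have rz : rho.[zf u] != 0 by rewrite -rootE rho_root// circle_param_normc.
  rewrite /transfer /Phi -tD /p -scalemxAl -row_mul /B -mulmxA -scalemxAl mul_adj_mx.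
  rewrite scale_scalar_mx mul_mx_scalar !mxE !hornerM hornerC.
  by field; rewrite ?rho0 rz.
have pE i j : p i 0 j = t * B i j by rewrite !mxE.
split.
- move=> i j; rewrite pE; apply: (leq_trans (size_polyMleq _ _)).
  by have := aB i j; move: (size _) (size _) st; clear; lia.
(* With g0 = N(0) / rho(0) one has B(0) = det N(0) I, while t(0) det N(0) = phi(0) = 1: the
   predicted variable keeps coefficient 1. *)
- move=> i j; rewrite pE -horner_coef0 hornerM.
  have -> : (B i j).[0] = (\det N).[0] * (i == j)%:R.
    have -> : (B i j).[0] = (evmx 0 B) i j by rewrite [RHS]mxE.
    have -> : evmx 0 B = g0 *m (rho.[0] *: evmx 0 (\adj N)).
      apply/matrixP => u v; rewrite !mxE /horner_eval horner_sum; apply: eq_bigr => k _.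
      by rewrite !mxE hornerM hornerC hornerM.
    rewrite /g0 /lead_factor -scalemxAr -scalemxAl scalerA mulfV// scale1r.
    have -> : evmx 0 N *m evmx 0 (\adj N) = evmx 0 (N *m \adj N).
      by rewrite /evmx map_mxM.
    by rewrite mul_mx_adj !mxE /horner_eval; case: eqP => _; rewrite ?mulr1n ?mulr0n ?horner0 ?mulr1 ?mulr0.
  rewrite mulrA -hornerM tD hornerD hornerM hornerXn expr0n mul0r addr0 horner_coef0.
  by rewrite coef_poly/= sz0 mul1r.
- move=> i j.
  have -> : spair (p i) (p j) = (g0 *m g0^t* ) i j * wint d (fun u => Phi m s u * (Phi m s u)^*).
    rewrite /spair mxE mulr_suml; apply: eq_bigr => l _.
    have -> : (g0^t* ) l j = (g0 j l)^* by rewrite !mxE.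
    rewrite -wintZ//; last first.
      by apply: bdmeasM => //; exact: bdmeas_conj.
    by apply: eq_wint => u; rewrite !trE rmorphM/=; ring.
  rewrite [X in _ - X]mulrC -mulrBr Normc.normcM mulrC.
  have h := KSP m s ss sK.
  have le1 : normc ((g0 *m g0^t* ) i j) <= \sum_i \sum_j normc ((g0 *m g0^t* ) i j).
    rewrite (bigD1 i)//= (bigD1 j)//= -addrA lerDl addr_ge0//; apply: sumr_ge0 => // k _.
      exact: normc_ge0.
    by apply: sumr_ge0 => *; exact: normc_ge0.
  apply: (le_trans (ler_pM (normc_ge0 _) (normc_ge0 _) h le1)).
  by rewrite le_eqVlt; apply/orP; left; apply/eqP; ring.
move=> i f S fs f0 S0 fS.
(* The [szphi] part is O(1/m) because f N vanishes at 0 and its degree exceeds m by a bounded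
   amount; the overshoot is O(1/m) in supremum norm. *)
have step l : normc (wint d (fun u => Phi m s u * (transfer f l u)^*)) <= X * S / m.+1%:R.
  have bf := bdmeas_transfer f l; have bfJ := bdmeas_conj bf.
  have -> : wint d (fun u => Phi m s u * (transfer f l u)^*) =
      wint d (fun u => (szphi d m).[zf u] * (transfer f l u)^*) +
      wint d (fun u => (zf u ^+ m.+1 * s.[zf u]) * (transfer f l u)^*).
    have b1 : bdmeas (fun u => zf u ^+ m.+1 * s.[zf u]).
      by apply: bdmeasM => //; exact: bdmeasX.
    rewrite -wintD//; [|by apply: bdmeasM|by apply: bdmeasM].
    by apply: eq_wint => u; rewrite PhiE mulrDl.
  apply: (le_trans (normcD _ _)); rewrite /X [leRHS]mulrAC mulrDl [leRHS]mulrDl; apply: lerD.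
    apply: (le_trans (KAP m ((f *m N) 0 l) (C0 * S * W) _ _ _)).
    - rewrite mxE coef_sum big1// => k _.
      by rewrite coefM big_ord1 f0 mul0r.
    - rewrite mxE; apply: (leq_trans (size_sum _ _ _)); apply/bigmax_leqP => k _.
      apply: (leq_trans (size_polyMleq _ _)); have := fs k; have := bN k l.
      by move: (size _) (size _); clear; lia.
    - move=> k; rewrite mxE coef_sum; apply: (le_trans (normc_sum _ _ _)).
      rewrite /W [X in _ <= _ * X](bigD1 l)//= mulrDr.
      apply: (@le_trans _ _ (C0 * S * \sum_k0 \sum_(i0 < size (N k0 l)) normc (N k0 l)`_i0)).
        rewrite mulr_sumr; apply: ler_sum => k0 _; apply: normc_coefM_le.
        exact: C0P S0 fS k0.
      rewrite lerDl mulr_ge0 ?mulr_ge0 ?(ltW S0)//.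
      by do 3 (apply: sumr_ge0 => * ); exact: normc_ge0.
    by rewrite le_eqVlt; apply/orP; left; apply/eqP; ring.
  have b1 : bdmeas (fun u => zf u ^+ m.+1 * s.[zf u]).
    by apply: bdmeasM => //; exact: bdmeasX.
  apply: (le_trans (wint_abs_le d_itv b1 bf S0 (transfer_sqr_le l fS)
    (M := (size (\det N))%:R * (K0 / m.+1%:R)) _)).
    move=> u; rewrite Normc.normcM normcX circle_param_normc// expr1n mul1r.
    exact: normc_horner_le.
  by rewrite le_eqVlt; apply/orP; left; apply/eqP; ring.
have X0 : 0 <= X * S / m.+1%:R by apply: le_trans (step i); exact: normc_ge0.
have -> : spair (p i) f = \sum_l g0 i l * wint d (fun u => Phi m s u * (transfer f l u)^*).
  rewrite /spair; apply: eq_bigr => l _; rewrite -wintZ//; last first.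
    by apply: bdmeasM => //; apply: bdmeas_conj; exact: bdmeas_transfer.
  by apply: eq_wint => u; rewrite trE mulrA.
apply: (le_trans (normc_sum _ _ _)); rewrite -!mulrA (mulrA X).
apply: (@le_trans _ _ (\sum_l normc (g0 i l) * (X * S / m.+1%:R))).
  by apply: ler_sum => l _; rewrite Normc.normcM ler_wpM2l ?normc_ge0.
rewrite -mulr_suml ler_wpM2r// /G [leRHS](bigD1 i)//= lerDl.
by do 2 (apply: sumr_ge0 => * ); exact: normc_ge0.
Qed.

End TrialPolynomial.

(** * Asymptotics of finite prediction *)

Section FinitePrediction.
Local Open Scope sesquilinear_scope.
Context {disp : measure_display} {T : measurableType disp} {R : realType}.
Local Notation C := R[i].
Variables (P : probability T R) (q : nat) (X : int -> T -> 'cV[R[i]]_q).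
Hypothesis LX : forall k i, L2 P (fun t => X k t i 0).
Implicit Types (sig : nat -> int) (f h : 'rV[{poly R[i]}]_q).

(** The coefficient of degree a multiplies the variable at time [sig a]: time [sig 0] is to be
    predicted from the times of [window sig n]. *)
Definition realize sig n f : T -> C := fun t =>
  \sum_(u : 'I_q * 'I_n.+1) (f 0 u.1)`_u.2 * X (sig u.2) t u.1 0.

Lemma realizeD sig n f h t :
  realize sig n (f + h) t = realize sig n f t + realize sig n h t.
Proof.
rewrite /realize -big_split/=; apply: eq_bigr => u _.
by rewrite mxE coefD mulrDl.
Qed.

Lemma realizeB sig n f h t :
  realize sig n (f - h) t = realize sig n f t - realize sig n h t.
Proof.
rewrite /realize -sumrB/=; apply: eq_bigr => u _.
by rewrite !mxE coefB mulrBl.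
Qed.

Lemma realize_monomial sig n c i (a : 'I_n.+1) t :
  realize sig n (\row_j if j == i then c *: 'X^a else 0) t = c * X (sig a) t i 0.
Proof.
rewrite /realize (bigD1 (i, a))//= big1 ?addr0.
  by rewrite mxE eqxx coefZ coefXn eqxx mulr1.
move=> [j b] /=; rewrite xpair_eqE mxE; case: (eqVneq j i) => _ /= ba; last first.
  by rewrite coef0 mul0r.
by rewrite coefZ coefXn (negbTE (_ : val b != val a)) ?mulr0 ?mul0r.
Qed.

Lemma realize_L2 sig n f : L2 P (realize sig n f).
Proof. by apply: L2_sum => u; exact: L2Z. Qed.

Definition window sig n : seq int := map sig (iota 1 n).

Lemma realize_lin_span sig n y : lin_span X [set` window sig n] y ->
  exists f, [/\ forall j, (size (f 0%R j) <= n.+1)%N, forall j, (f 0 j)`_0 = 0 &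
    y = realize sig n f].
Proof.
move=> /lin_spanP[s sK ->] {y}; elim: s sK => [|[c [k i]] s ih] sK.
  exists 0; split=> [j|j|]; rewrite ?mxE ?size_poly0 ?coef0//.
  apply/funext => t; rewrite big_nil /realize big1// => u _.
  by rewrite mxE coef0 mul0r.
have [|f [fs f0 fE]] := ih; first by move=> p ps; apply: sK; rewrite inE ps orbT.
have /mapP[a] : k \in window sig n by apply: (sK (c, (k, i))); rewrite inE eqxx.
rewrite mem_iota add1n => /andP[a0 an] ka.
exists ((\row_j if j == i then c *: 'X^(Ordinal an) else 0) + f); split=> [j|j|].
- rewrite !mxE; apply: (leq_trans (size_polyD _ _)); rewrite geq_max fs andbT.
  case: ifP => _; rewrite ?size_poly0//; apply: (leq_trans (size_scale_leq _ _)).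
  by rewrite size_polyXn.
- rewrite !mxE coefD f0 addr0; case: ifP => _; rewrite ?coef0// coefZ coefXn.
  by rewrite ltn_eqF ?mulr0.
apply/funext => t; rewrite big_cons realizeD realize_monomial/= ka; congr (_ + _).
exact: (congr1 (fun v => v t) fE).
Qed.

Lemma realize_ortho sig n y f : L2 P y -> (forall j, (f 0 j)`_0 = 0) ->
  (forall k i, k \in window sig n -> inner P y (fun t => X k t i 0) = 0) ->
  inner P y (realize sig n f) = 0.
Proof.
move=> Ly f0 yX; rewrite /realize (inner_sumr (index_enum _)
  (fun u : 'I_q * 'I_n.+1 => (f 0 u.1)`_u.2)
  (F := fun (u : 'I_q * 'I_n.+1) t => X (sig u.2) t u.1 0))//.
rewrite big1// => -[j [[|a] an]] _ /=; first by rewrite f0 rmorph0 mul0r.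
by rewrite yX ?mulr0//; apply/map_f; rewrite mem_iota add1n.
Qed.

Variables (d : R) (zf : R -> C) (N : 'M[{poly C}]_q) (rho : {poly C}) (kap : R).
Hypothesis d_itv : - 2^-1 < d < 2^-1.
Hypothesis zP : circle_param zf.
Hypothesis rho_root : forall z : C, normc z <= 1 -> ~~ root rho z.
Hypothesis kap_gt0 : 0 < kap.

(** The spectral representation along an indexing of time. Forward and backward prediction satisfy
    it with the two orientations of the circle, which makes them one problem. *)
Definition spectral_along sig := forall a b i j,
  inner P (fun t => X (sig a) t i 0) (fun t => X (sig b) t j 0) =
  kap%:C * wint d (fun u => zf u ^+ a * (zf u)^* ^+ b *
    \sum_l ((N i l).[zf u] / rho.[zf u]) * ((N j l).[zf u] / rho.[zf u])^*).

Local Notation spair := (spair d zf N rho).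
Local Notation transfer := (transfer zf N rho).

(** The Kolmogorov isomorphism, restricted to finite combinations. *)
Lemma inner_realize sig n f h : spectral_along sig ->
  (forall j, (size (f 0%R j) <= n.+1)%N) -> (forall j, (size (h 0%R j) <= n.+1)%N) ->
  inner P (realize sig n f) (realize sig n h) = kap%:C * spair f h.
Proof.
move=> sigP fs hs; have bz := circle_param_bdmeas zP.
have bE i l : bdmeas (fun t => (N i l).[zf t] / rho.[zf t]).
  by apply: bdmeasM; [exact: bdmeas_horner|exact: bdmeas_rhoV].
pose E (u : 'I_q * 'I_n.+1) l t := zf t ^+ u.2 * ((N u.1 l).[zf t] / rho.[zf t]).
have bEu u l : bdmeas (E u l) by apply: bdmeasM => //; exact: bdmeasX.
have trE (g : 'rV[{poly C}]_q) l t : (forall j, (size (g 0%R j) <= n.+1)%N) ->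
    transfer g l t = \sum_(u : 'I_q * 'I_n.+1) (g 0 u.1)`_u.2 * E u l t.
  move=> gs; rewrite /transfer mxE horner_sum mulr_suml.
  rewrite -(pair_bigA _ (fun j (a : 'I_n.+1) => (g 0 j)`_a * E (j, a) l t))/=.
  apply: eq_bigr => j _; rewrite hornerM (horner_coef_wide _ (gs j)) !mulr_suml.
  by apply: eq_bigr => a _; rewrite /E/= !mulrA.
rewrite {1}/realize (inner_suml (index_enum _)
  (fun u : 'I_q * 'I_n.+1 => (f 0 u.1)`_u.2)
  (F := fun (u : 'I_q * 'I_n.+1) t => X (sig u.2) t u.1 0))//; last exact: realize_L2.
have -> : spair f h = \sum_(u : 'I_q * 'I_n.+1) (f 0 u.1)`_u.2 *
    \sum_(v : 'I_q * 'I_n.+1) ((h 0 v.1)`_v.2)^* * wint d (fun t => \sum_l E u l t * (E v l t)^*).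
  rewrite /spair; under eq_bigr => l _.
    rewrite (@eq_wint _ _ _ (fun t => \sum_(u : 'I_q * 'I_n.+1) (f 0 u.1)`_u.2 *
      (\sum_(v : 'I_q * 'I_n.+1) ((h 0 v.1)`_v.2)^* * (E u l t * (E v l t)^* )))); last first.
      move=> t; rewrite !trE// mulr_suml; apply: eq_bigr => u _.
      rewrite -mulrA rmorph_sum mulr_sumr; congr (_ * _); apply: eq_bigr => v _.
      by rewrite rmorphM/= mulrCA.
    have b1 u v : bdmeas (fun t => E u l t * (E v l t)^*).
      by apply: bdmeasM => //; exact: bdmeas_conj.
    have b2 (u v : 'I_q * 'I_n.+1) : bdmeas (fun t => ((h 0 v.1)`_v.2)^* * (E u l t * (E v l t)^*)).
      by apply: bdmeasM => //; exact: bdmeas_cst.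
    have b3 (u : 'I_q * 'I_n.+1) : bdmeas (fun t => \sum_(v : 'I_q * 'I_n.+1) ((h 0 v.1)`_v.2)^* * (E u l t * (E v l t)^*)).
      exact: bdmeas_sum.
    rewrite wint_sum//; last by move=> u _; apply: bdmeasM => //; exact: bdmeas_cst.
    under eq_bigr => u _.
      rewrite wintZ// wint_sum//; under eq_bigr => v _ do rewrite wintZ//.
      over.
    over.
  rewrite exchange_big/=; apply: eq_bigr => u _; rewrite -mulr_sumr; congr (_ * _).
  rewrite exchange_big/=; apply: eq_bigr => v _; rewrite -mulr_sumr; congr (_ * _).
  by rewrite wint_sum// => l _; apply: bdmeasM => //; exact: bdmeas_conj.
rewrite mulr_sumr; apply: eq_bigr => u _; rewrite mulrCA; congr (_ * _).
rewrite {1}/realize (inner_sumr (index_enum _)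
  (fun u : 'I_q * 'I_n.+1 => (h 0 u.1)`_u.2)
  (F := fun (u : 'I_q * 'I_n.+1) t => X (sig u.2) t u.1 0))//.
rewrite mulr_sumr; apply: eq_bigr => v _; rewrite mulrCA; congr (_ * _).
rewrite sigP; congr (_ * _); apply: eq_wint => t; rewrite mulr_sumr.
by apply: eq_bigr => l _; rewrite /E !rmorphM rmorphXn/=; ring.
Qed.

(* The error of the trial predictor [p i] is an element of the span which is
   almost orthogonal to [p i] itself, hence small: testing against it gives
   [|e|^2 = <p i, e> <= B |e|]. *)
Lemma error_cov_trial sig n (p : 'I_q -> 'rV[{poly C}]_q) (B : R) : spectral_along sig ->
  (forall i j, (size (p i 0%R j) <= n.+1)%N) -> (forall i j, (p i 0 j)`_0 = (i == j)%:R) ->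
  (forall (i : 'I_q) f (S : R), (forall j, (size (f 0%R j) <= n.+1)%N) ->
    (forall j, (f 0 j)`_0 = 0) -> 0 < S -> CRe (spair f f) <= S ^+ 2 ->
    normc (spair (p i) f) <= B * S) ->
  forall i j, normc (error_cov P X [set` window sig n] (sig 0%N) i j -
    kap%:C * spair (p i) (p j)) <= kap * B ^+ 2.
Proof.
move=> sigP ps p0 pB; pose K := [set` window sig n].
pose x i t := X (sig 0%N) t i 0.
have /choice[y yP] : forall i, exists y, fin_residual P X K (x i) y.
  by move=> i; apply: (fin_residual_exists LX); exact: LX.
have xT i : lin_span X setT (x i) by apply: lin_span_gen.
have yR i : is_residual P X K (x i) (y i) by apply: fin_residualW.
have Ly i : L2 P (y i).
  by apply: (lin_span_L2 LX (K := setT)); exact: fin_residual_lin_span (@subsetT _ K) (xT i) (yP i).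
rewrite (error_covE LX yR) => i j; rewrite mxE.
have /choice[f fP] : forall i, exists f, [/\ forall j, (size (f 0%R j) <= n.+1)%N,
    forall j, (f 0 j)`_0 = 0 & forall t, realize sig n f t = realize sig n (p i) t - y i t].
  move=> {}i; have [xyK _] := yP i; have [f [fs f0 fE]] := realize_lin_span xyK.
  (* The constant polynomial that realizes [x i]. The error p - y is split as (x - y) + (p - x), and
     both parts have coefficient polynomials vanishing at 0. *)
  pose e := \row_j if j == i then 1 *: 'X^(@ord0 n) else 0 : {poly C}.
  exists (f + (p i - e)); split.
  - move=> k; rewrite !mxE; apply: (leq_trans (size_polyD _ _)); rewrite geq_max fs/=.
    apply: (leq_trans (size_polyD _ _)); rewrite geq_max ps/= size_polyN.
    by case: ifP => _; rewrite ?size_poly0// scale1r expr0 size_poly1.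
  - move=> k; rewrite !mxE !coefD f0 add0r p0 coefN eq_sym.
    by case: ifP => _; rewrite ?coef0 ?subr0// scale1r expr0 coef1 subrr.
  move=> t; rewrite realizeD realizeB realize_monomial mul1r -fE /x/=; ring.
pose e i := realize sig n (f i).
have Le k : L2 P (e k) by exact: realize_L2.
have fs k l : (size (f k 0%R l) <= n.+1)%N by have [] := fP k.
have f0 k l : (f k 0 l)`_0 = 0 by have [] := fP k.
have pE k : realize sig n (p k) = fun t => y k t + e k t.
  by apply/funext => t; have [_ _ fE] := fP k; rewrite /e fE addrC subrK.
have ye k l : inner P (y k) (e l) = 0.
  by apply: realize_ortho => // m i' mK; have [_] := yP k; exact.
have ey k l : inner P (e l) (y k) = 0 by rewrite innerC// ye rmorph0.
have eE k l : inner P (e k) (e l) = kap%:C * spair (f k) (f l).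
  exact: inner_realize.
have main k : nrm2 P (e k) <= kap * B ^+ 2.
  have nE : nrm2 P (e k) = kap * CRe (spair (f k) (f k)).
    by rewrite /nrm2 eE CReM/= mul0r subr0.
  have pe : inner P (realize sig n (p k)) (e k) = inner P (e k) (e k).
    by rewrite pE innerDl// ye add0r.
  have pE' : spair (p k) (f k) = spair (f k) (f k).
    move: pe; rewrite eE (inner_realize sigP (ps k) (fs k)); apply: mulfI.
    by rewrite real_complex_eq0 gt_eqF.
  have D0 : 0 <= CRe (spair (f k) (f k)).
    by rewrite -(pmulr_rge0 _ kap_gt0) -nE nrm2_ge0.
  rewrite nE; apply: (ler_wpM2l (ltW kap_gt0)).
  have [->|Dn0] := eqVneq (CRe (spair (f k) (f k))) 0; first exact: sqr_ge0.
  set S := Num.sqrt (CRe (spair (f k) (f k))).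
  have S0 : 0 < S by rewrite sqrtr_gt0 lt_neqAle eq_sym Dn0.
  have SE : S ^+ 2 = CRe (spair (f k) (f k)) by rewrite sqr_sqrtr.
  have := pB k (f k) S (fs k) (f0 k) S0; rewrite SE lexx pE' => /(_ isT) le1.
  have : S * S <= B * S.
    rewrite -expr2 SE; apply: le_trans le1; apply: le_trans (Re_le_normc _); exact: ler_norm.
  rewrite (ler_pM2r S0) => SB; have B0 := le_trans (ltW S0) SB.
  by rewrite -SE; apply: lerXn2r; rewrite ?nnegrE ?(ltW S0).
have -> : inner P (y i) (y j) - kap%:C * spair (p i) (p j) = - inner P (e i) (e j).
  rewrite -(inner_realize sigP (ps i) (ps j)) !pE innerDl//; last exact: L2D.
  have innerDr (u v w : T -> C) : L2 P u -> L2 P v -> L2 P w ->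
      inner P w (fun t => u t + v t) = inner P w u + inner P w v.
    move=> Lu Lv Lw; rewrite innerC//; last exact: L2D.
    by rewrite innerDl// rmorphD/= -!innerC.
  by rewrite !innerDr// ye ey addr0 add0r opprD addNKr.
rewrite normcN -ler_sqr ?nnegrE ?normc_ge0//; last by rewrite mulr_ge0 ?sqr_ge0// ltW.
apply: (le_trans (inner_CS (Le i) (Le j))); rewrite [leRHS]expr2.
by apply: ler_pM; rewrite ?nrm2_ge0.
Qed.

End FinitePrediction.

(** * The expansion for finite windows, uniformly in the indexing of time *)

Section PredictionAsymptotics.
Local Open Scope sesquilinear_scope.
Context {disp : measure_display} {T : measurableType disp} {R : realType}.
Local Notation C := R[i].
Variables (P : probability T R) (q : nat) (X : int -> T -> 'cV[R[i]]_q).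
Hypothesis LX : forall k i, L2 P (fun t => X k t i 0).
Variables (d : R) (zf : R -> C) (N : 'M[{poly C}]_q) (rho : {poly C}) (kap : R).
Hypothesis d_itv : - 2^-1 < d < 2^-1.
Hypothesis d_neq0 : d != 0.
Hypothesis zP : circle_param zf.
Hypothesis rho_root : forall z : C, normc z <= 1 -> ~~ root rho z.
Hypothesis detN_root : forall z : C, normc z <= 1 -> ~~ root (\det N) z.
Hypothesis kap_gt0 : 0 < kap.

(** The matrix [A] and the constants come before [sig], so indexings that move with n and the fixed
    one that leads to the infinite error share the same limit. *)
Lemma error_cov_asymptotics : exists (A : 'M[C]_q) (M : R) (n0 : nat), forall n sig,
  (n0 < n)%N -> spectral_along P X d zf N rho kap sig ->
  forall i j, normc (error_cov P X [set` window sig n] (sig 0%N) i j -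
    (1 + d ^+ 2 / n%:R)%:C * A i j) <= M / n%:R ^+ 2.
Proof.
have [gam [gam_rec gamE]] := wint_moments d_itv; have momE := gamE _ zP.
have [K1 [K2 [a trial]]] := trial_polynomial d_itv d_neq0 gam_rec zP momE rho_root detN_root.
have [c [M0 vE]] := product_asymptotics d_itv (szmom0_rec d_itv d_neq0 gam_rec).
pose g0 := lead_factor N rho; pose G := g0 *m g0^t*.
pose Gs := \sum_i \sum_j normc (G i j).
have Gs_ge0 : 0 <= Gs by do 2 (apply: sumr_ge0 => * ); exact: normc_ge0.
have GG i j : normc (G i j) <= Gs.
  rewrite /Gs (bigD1 i)//= (bigD1 j)//= -addrA lerDl addr_ge0//; apply: sumr_ge0 => // k _.
    exact: normc_ge0.
  by apply: sumr_ge0 => *; exact: normc_ge0.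
exists ((kap * c)%:C *: G).
exists (kap * (4 * K2 ^+ 2) + (kap * (4 * `|K1|) +
  kap * (4 * `|M0| + `|c| * (2 * a%:R * d ^+ 2)) * Gs)), (2 * a)%N.
move=> n sig an sigP i j.
(* The trial predictor built on [szphi] of degree m + 1 has degree at most m + 1 + a = n. The
   threshold n > 2 a gives n <= 2 (m + 1), hence comparable inverse squares. *)
have [m nE] : exists m, n = (m.+1 + a)%N by exists (n - a).-1; lia.
have [p [ps p0 pp pf]] := trial m.+1.
have x0 : 0 < m.+1%:R :> R by rewrite ltr0n.
have xS : m.+1%:R <= m.+2%:R :> R by rewrite ler_nat.
have y0 : 0 < n%:R :> R by rewrite nE ltr0n.
have yx : n%:R = m.+1%:R + a%:R :> R by rewrite nE natrD.
have y2 : n%:R <= 2 * m.+1%:R :> R by rewrite -natrM ler_nat; lia.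
have a0 : 0 <= a%:R :> R by [].
have kap0 := ltW kap_gt0.
have inv2 : (m.+1%:R ^+ 2)^-1 <= 4 / n%:R ^+ 2 :> R.
  rewrite ler_pdivlMr ?exprn_gt0// ler_pdivrMl ?exprn_gt0//.
  rewrite mulrC (_ : 4 * _ = (2 * m.+1%:R) ^+ 2); last by ring.
  by rewrite lerXn2r// nnegrE ltW// mulr_gt0.
have inv2S : (m.+2%:R ^+ 2)^-1 <= 4 / n%:R ^+ 2 :> R.
  apply: le_trans inv2; rewrite lef_pV2 ?posrE ?exprn_gt0//.
  by rewrite lerXn2r ?nnegrE.
have h1 := error_cov_trial LX d_itv zP rho_root kap_gt0 (n := n) (p := p)
  (B := K2 / m.+2%:R) sigP.
have {h1} : normc (error_cov P X [set` window sig n] (sig 0%N) i j -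
    kap%:C * spair d zf N rho (p i) (p j)) <= kap * (K2 / m.+2%:R) ^+ 2.
  apply: h1 => //; first by rewrite nE.
  move=> k f S fs f0 S0 fS; rewrite mulrAC; apply: pf => //.
  by rewrite -nE.
have {pp} h2 := pp i j.
have h3 := vE m.+1 isT.
(* Since n - (m + 1) = a is fixed, exchanging m + 1 for n in the first-order term costs O(n^-2). *)
have h4 : `|d ^+ 2 / m.+1%:R - d ^+ 2 / n%:R| <= 2 * a%:R * d ^+ 2 / n%:R ^+ 2.
  rewrite (_ : _ - _ = d ^+ 2 * a%:R / n%:R * m.+1%:R^-1); last first.
    by rewrite yx; field; apply/andP; split; apply/eqP; lra.
  have nn : 0 <= d ^+ 2 * a%:R / n%:R.
    by apply: divr_ge0; [apply: mulr_ge0; [exact: sqr_ge0|]|exact: ltW].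
  rewrite ger0_norm; last by apply: mulr_ge0 => //; rewrite invr_ge0 ltW.
  rewrite (_ : _ / n%:R ^+ 2 = d ^+ 2 * a%:R / n%:R * (2 / n%:R)); last first.
    by field; rewrite gt_eqF.
  apply: (ler_wpM2l nn).
  by rewrite ler_pdivlMr// ler_pdivrMl// mulrC.
move: h2 h3; set v := szmom _ _ _ _; set s := spair _ _ _ _ _ _ => h2 h3 h1.
set e := error_cov _ _ _ _ _ _ in h1 *.
have -> : e - (1 + d ^+ 2 / n%:R)%:C * ((kap * c)%:C *: G) i j =
    (e - kap%:C * s) + (kap%:C * (s - v%:C * G i j) +
      (kap * ((v - c * (1 + d ^+ 2 / m.+1%:R)) +
        c * (d ^+ 2 / m.+1%:R - d ^+ 2 / n%:R)))%:C * G i j).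
  rewrite mxE.
  rewrite (_ : kap * (_ + _) = kap * v - kap * c * (1 + d ^+ 2 / n%:R)); last by ring.
  by rewrite rmorphB !rmorphM/=; ring.
apply: (le_trans (normcD _ _)).
rewrite [leRHS]mulrDl; apply: lerD.
  apply: (le_trans h1); rewrite -[leRHS]mulrA ler_wpM2l// mulrAC exprMn exprVn.
  by rewrite [4 / _ * _]mulrC ler_wpM2l ?sqr_ge0.
apply: (le_trans (normcD _ _)); rewrite [leRHS]mulrDl; apply: lerD.
  rewrite Normc.normcM normc_real ger0_norm// -[leRHS]mulrA ler_wpM2l//.
  apply: (le_trans h2); apply: (@le_trans _ _ (`|K1| / m.+2%:R ^+ 2)).
    by rewrite ler_wpM2r ?invr_ge0 ?sqr_ge0// ler_norm.
  by rewrite mulrAC [leRHS]mulrC ler_wpM2l.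
rewrite [leRHS]mulrAC Normc.normcM normc_real normrM ger0_norm//.
apply: ler_pM => //; rewrite ?normc_ge0// ?mulr_ge0//.
rewrite -[leRHS]mulrA ler_wpM2l//.
apply: (le_trans (ler_normD _ _)); rewrite mulrDl; apply: lerD.
  apply: (le_trans h3); apply: (@le_trans _ _ (`|M0| / m.+1%:R ^+ 2)).
    by rewrite ler_wpM2r ?invr_ge0 ?sqr_ge0// ler_norm.
  by rewrite mulrAC [leRHS]mulrC ler_wpM2l.
by rewrite normrM -[leRHS]mulrA ler_wpM2l.
Qed.

End PredictionAsymptotics.

(** * Rational spectral factors over a common denominator *)

Section Rational.
Local Open Scope sesquilinear_scope.
Context {R : realType}.
Local Notation C := R[i].

Lemma common_denominator q (g : C -> 'M[C]_q) :
  (forall i j, rational_on_closed_disk (fun z => g z i j)) ->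
  exists (N : 'M[{poly C}]_q) (rho : {poly C}),
    (forall z, normc z <= 1 -> ~~ root rho z) /\
    forall z, normc z <= 1 -> evmx z N = rho.[z] *: g z.
Proof.
move=> gr.
have /choice[pr prP] : forall u : 'I_q * 'I_q, exists pr : {poly C} * {poly C},
    (forall z, normc z <= 1 -> ~~ root pr.2 z) /\
    forall z, normc z <= 1 -> g z u.1 u.2 = pr.1.[z] / pr.2.[z].
  move=> [i j]; have [p [r [_ rr gE]]] := gr i j; exists (p, r).
  have rr' z : normc z <= 1 -> ~~ root r z by move=> z1; apply: rr; rewrite normr_normc lecR.
  by split=> // z /rr'; exact: gE.
exists (\matrix_(i, j) ((pr (i, j)).1 * \prod_(u | u != (i, j)) (pr u).2)), (\prod_u (pr u).2).
split=> z z1.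
  rewrite rootE horner_prod; apply/prodf_neq0 => u _; rewrite -rootE.
  by have [+ _] := prP u; exact.
apply/matrixP => i j; have [rr] := prP (i, j); move=> /= gE.
rewrite !mxE /horner_eval hornerM !horner_prod [X in _ = X * _](bigD1 (i, j))//= gE//.
have nz : (pr (i, j)).2.[z] != 0 by rewrite -rootE rr.
by rewrite [RHS]mulrC mulrA divfK.
Qed.

Lemma rational_entryM q (N : 'M[{poly C}]_q) (rho : {poly C}) z i j :
  \sum_l ((N i l).[z] / rho.[z]) * ((N j l).[z] / rho.[z])^* =
  (evmx z N *m (evmx z N)^t* ) i j / (rho.[z] * (rho.[z])^*).
Proof.
rewrite mxE mulr_suml; apply: eq_bigr => l _; rewrite !mxE /horner_eval.
by rewrite rmorphM/= fmorphV invfM; ring.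
Qed.

Lemma conj_poly_horner (p : {poly C}) z :
  (map_poly Num.conj p).[z^*] = (p.[z])^*.
Proof. by rewrite horner_map. Qed.

End Rational.

(** * From entrywise bounds to limits and Landau notation *)

Section Limits.
Context {R : realType}.
Local Notation C := R[i].

(** The expansion forces e to tend to A, while its convergence to E is known from the projections:
    the infinite error is identified without being computed. *)
Lemma asymptotics_limit (e : nat -> C) (E A : C) (c M : R) (n0 : nat) :
  (forall del : R, 0 < del -> exists n1, forall n, (n1 <= n)%N -> normc (e n - E) <= del) ->
  (forall n, (n0 < n)%N -> normc (e n - (1 + c / n%:R)%:C * A) <= M / n%:R ^+ 2) ->
  E = A.
Proof.
move=> eE eA; apply/eqP; rewrite -subr_eq0 -normc_eq0 eq_le normc_ge0 andbT.
apply/ler_addgt0Pr => del del0; rewrite add0r.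
have del2 : 0 < del / 2 by rewrite divr_gt0.
have [n1 n1P] := eE _ del2.
pose B := `|M| + `|c| * normc A.
have B0 : 0 <= B by rewrite addr_ge0 ?mulr_ge0 ?normc_ge0.
pose n := maxn n0.+1 (maxn n1 (Num.truncn (B / (del / 2))).+1).
have nn0 : (n0 < n)%N by rewrite leq_max leqnn.
have nn1 : (n1 <= n)%N by rewrite !leq_max leqnn orbT.
have npos : 0 < n%:R :> R by rewrite ltr0n (leq_trans _ nn0).
have n1' : 1 <= n%:R :> R by rewrite ler1n (leq_trans _ nn0).
have Bn : B / n%:R <= del / 2.
  rewrite ler_pdivrMr// mulrC -ler_pdivrMr// ltW//.
  apply: (lt_le_trans (truncnS_gt _)); rewrite ler_nat.
  by rewrite /n !leq_max leqnn !orbT.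
have -> : E - A = (e n - (1 + c / n%:R)%:C * A) + (c / n%:R)%:C * A - (e n - E).
  by rewrite rmorphD/= rmorph1; ring.
rewrite [leRHS]splitr; apply: (le_trans (normcB _ _)).
apply: lerD; last exact: n1P.
apply: le_trans Bn; rewrite /B mulrDl; apply: (le_trans (normcD _ _)).
apply: lerD.
  apply: (le_trans (eA n nn0)); apply: (@le_trans _ _ (`|M| / n%:R ^+ 2)).
    by rewrite ler_wpM2r ?ler_norm// invr_ge0 sqr_ge0.
  rewrite ler_wpM2l// lef_pV2 ?posrE ?exprn_gt0//.
  by rewrite expr2 ler_peMl// ltW.
by rewrite Normc.normcM normc_real normrM normfV (gtr0_norm npos) mulrAC.
Qed.

Lemma mx_norm_le m n (x : 'M[C]_(m, n)) (b : C) : 0 <= b ->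
  (forall i j, `|x i j| <= b) -> `|x| <= b.
Proof.
move=> b0 xb; rewrite [leLHS]/Num.Def.normr/=.
by have [->//|/mx_norm_neq0[i ->]] := eqVneq (mx_norm x) 0.
Qed.

Lemma eqaddO_entries m n (f g : nat -> 'M[C]_(m, n)) (M : R) (n0 : nat) :
  (forall k, (n0 < k)%N -> forall i j, normc (f k i j - g k i j) <= M / k%:R ^+ 2) ->
  f = g +O_\oo (fun k : nat => (k%:R ^- 2 : R[i]^o)).
Proof.
move=> fg; apply/eqaddOP/bigO_exP; exists (`|M| + 1)%:C.
  by rewrite ltcR ltr_wpDl.
exists n0.+1 => // k /= nk; have k0 : (0 < k)%N by exact: leq_trans nk.
have kE : `|(k%:R ^- 2 : C)| = (k%:R ^- 2 : R)%:C.
  by rewrite ger0_norm ?invr_ge0 ?exprn_ge0// fmorphV rmorphXn/= rmorph_nat.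
apply: mx_norm_le => [|i j].
  by rewrite mulr_ge0// lecR addr_ge0.
rewrite kE -rmorphM normr_normc lecR !mxE; apply: (le_trans (fg k nk i j)).
rewrite ler_wpM2r ?invr_ge0 ?sqr_ge0//.
by rewrite (le_trans (ler_norm _))// lerDl.
Qed.

End Limits.

(** * The FARIMA spectrum along both directions of time *)

Section FarimaSpectrum.
Local Open Scope sesquilinear_scope.
Context {disp : measure_display} {T : measurableType disp} {R : realType}.
Local Notation C := R[i].
Variables (P : probability T R) (q : nat) (X : int -> T -> 'cV[R[i]]_q).
Variables (d : R) (g : C -> 'M[C]_q) (N : 'M[{poly C}]_q) (rho : {poly C}).
Hypothesis rho_root : forall z : C, normc z <= 1 -> ~~ root rho z.
Hypothesis gE : forall z, normc z <= 1 -> evmx z N = rho.[z] *: g z.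
Hypothesis X_density : has_spectral_density P X (farima_density d g).

Lemma cis_intM (a b : nat) (m : int) (t : R) : m = b%:Z - a%:Z ->
  cis (- (m%:~R * t)) = cis t ^+ a * (cis t)^* ^+ b.
Proof.
by move=> ->; rewrite -cisN !cisX -cisD rmorphB/=; congr cis; rewrite -!pmulrn; ring.
Qed.

Lemma farima_densityE t i j : farima_density d g (cis t) i j =
  (wgt d t)%:C * \sum_l ((N i l).[cis t] / rho.[cis t]) * ((N j l).[cis t] / rho.[cis t])^*.
Proof.
have t1 : normc (cis t) <= 1 by rewrite normc_cis.
have rz : rho.[cis t] != 0 by rewrite -rootE rho_root.
rewrite /farima_density wgtE mxE; congr (_ * _).
rewrite rational_entryM gE// adjmxZ -scalemxAl -scalemxAr scalerA [X in _ = X / _]mxE.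
by rewrite [RHS]mulrC mulKf// mulf_neq0// fmorph_eq0.
Qed.

Lemma farima_inner m n i j :
  inner P (fun t => X m t i 0) (fun t => X n t j 0) = ((2 * pi)^-1)%:C *
  wint d (fun t => cis (- ((m - n)%:~R * t)) *
    \sum_l ((N i l).[cis t] / rho.[cis t]) * ((N j l).[cis t] / rho.[cis t])^*).
Proof.
have [_ _ /(_ m n)/matrixP/(_ i j)] := X_density; rewrite !mxE => XE.
transitivity (cintegral P setT (fun t => (X m t *m (X n t)^t* ) i j)).
  by apply: eq_cintegral => t _; rewrite mxE big_ord1 !mxE.
rewrite XE; congr (_ * _); apply: eq_cintegral => t _.
by rewrite mxE farima_densityE mulrCA.
Qed.

(** The kernel e^(-i(m-n)t) turns steps back in time into positive powers of e^(it), the variable in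
    which the factor g is analytic. *)
Lemma spectral_along_fwd :
  spectral_along P X d cis N rho (2 * pi)^-1 (fun a => - a%:Z).
Proof.
move=> a b i j; rewrite farima_inner; congr (_ * _); apply: eq_wint => t.
by rewrite (@cis_intM a b)// opprK addrC.
Qed.

(* Time reversal conjugates [cis], so the spectral factor is replaced by one
   analytic in the conjugate variable. *)
Lemma spectral_along_bwd (N' : 'M[{poly C}]_q) c :
  (forall z, normc z = 1 ->
     evmx z^* N' *m (evmx z^* N')^t* = evmx z N *m (evmx z N)^t* ) ->
  spectral_along P X d (fun t => (cis t)^*) N' (map_poly Num.conj rho) (2 * pi)^-1
    (fun a => a%:Z + c).
Proof.
move=> NE a b i j; rewrite farima_inner; congr (_ * _); apply: eq_wint => t.
rewrite (@cis_intM b a); last by ring.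
rewrite !rational_entryM NE ?normc_cis// conj_poly_horner !conjCK.
by congr (_ * (_ / _)); rewrite mulrC.
Qed.

End FarimaSpectrum.

(** * Infinite prediction as a limit of finite windows *)

Section PredictionLimit.
Context {disp : measure_display} {T : measurableType disp} {R : realType}.
Local Notation C := R[i].
Variables (P : probability T R) (q : nat) (X : int -> T -> 'cV[R[i]]_q).
Hypothesis LX : forall k i, L2 P (fun t => X k t i 0).

Lemma error_cov_limit (sig : nat -> int) (K : set int) k (A : 'M[C]_q) (c M : R) (n0 : nat) :
  K = \bigcup_n [set` window sig n] ->
  (forall n, (n0 < n)%N -> forall i j, normc (error_cov P X [set` window sig n] k i j -
    (1 + c / n%:R)%:C * A i j) <= M / n%:R ^+ 2) ->
  error_cov P X K k = A.
Proof.
move=> KE eA; have mono m n : (m <= n)%N -> {subset window sig m <= window sig n}.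
  move=> mn _ /mapP[a am ->]; apply: map_f; move: am; rewrite !mem_iota !add1n.
  by case/andP => -> am; rewrite (leq_trans am).
apply/matrixP => i j; apply: (asymptotics_limit (c := c) (M := M) (n0 := n0)
  (e := fun n => error_cov P X [set` window sig n] k i j)).
  move=> del del0; have [n1 n1P] := error_cov_cvg LX k mono KE del0.
  by exists n1 => n nn; exact: n1P.
by move=> n nn; exact: eA.
Qed.

End PredictionLimit.

Theorem theorem6p5 (R : realType) (disp : measure_display)
    (T : measurableType disp) (P : probability T R)
    (q : nat) (q_gt0 : (0 < q)%N) (d : R) (g : R[i] -> 'M[R[i]]_q)
    (X : int -> T -> 'cV[R[i]]_q)
    (d_itv : - 2^-1 < d < 2^-1) (d_neq0 : d != 0)
    (g_rational : forall i j, rational_on_closed_disk (fun z => g z i j))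
    (g_det : forall z : R[i], `|z| <= 1 -> \det (g z) != 0)
    (X_stationary : stationary_process P X)
    (X_density : has_spectral_density P X (farima_density d g)) :
  fwd_cov P X =
    (fun n : nat => fwd_cov_infty P X + (d ^+ 2 / n%:R)%:C *: fwd_cov_infty P X)
      +O_\oo (fun n : nat => (n%:R ^- 2 : R[i]^o)) /\
  bwd_cov P X =
    (fun n : nat => bwd_cov_infty P X + (d ^+ 2 / n%:R)%:C *: bwd_cov_infty P X)
      +O_\oo (fun n : nat => (n%:R ^- 2 : R[i]^o)).
Proof.
have LX k i : L2 P (fun t => X k t i 0) by case: X_stationary.
have kap0 : 0 < (2 * pi)^-1 :> R by rewrite invr_gt0 mulr_gt0// pi_gt0.
have [N [rho [rho_root gE]]] := common_denominator g_rational.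
have detN z : normc z <= 1 -> ~~ root (\det N) z.
  move=> z1; rewrite rootE -det_evmx gE// detZ mulf_neq0 ?expf_neq0//.
    by rewrite -rootE rho_root.
  by apply: g_det; rewrite normr_normc lecR.
have entry (A : 'M[R[i]]_q) (n : nat) i j :
    (A + (d ^+ 2 / n%:R)%:C *: A) i j = (1 + d ^+ 2 / n%:R)%:C * A i j.
  by rewrite !mxE rmorphD/= rmorph1 mulrDl mul1r.
split.
  have [A [M [n0 AE]]] :=
    error_cov_asymptotics LX d_itv d_neq0 (or_introl erefl) rho_root detN kap0.
  pose sig a : int := - a%:Z.
  have sigP := spectral_along_fwd rho_root gE X_density.
  have {}AE n : (n0 < n)%N -> forall i j, normc (error_cov P X [set` window sig n] 0 i j -
      (1 + d ^+ 2 / n%:R)%:C * A i j) <= M / n%:R ^+ 2.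
    by move=> nn i j; have := AE n sig nn sigP i j; rewrite /sig oppr0.
  have winE n : [set k : int | - n%:Z <= k <= -1] = [set` window sig n].
    apply/seteqP; split=> k /=.
      move=> kn; apply/mapP; exists `|k|%N; rewrite ?mem_iota /sig; move: kn; clear; lia.
    by move=> /mapP[a]; rewrite mem_iota /sig => an ->; move: an; clear; lia.
  have EA : fwd_cov_infty P X = A.
    apply: (error_cov_limit LX _ AE); apply/seteqP; split=> k /=.
      move=> k1; exists `|k|%N => //; rewrite -winE/=; move: k1; clear; lia.
    by move=> [n _]; rewrite -winE/=; clear; lia.
  apply: (@eqaddO_entries _ _ _ _ _ M n0) => n nn i j.
  by rewrite EA entry /fwd_cov winE; exact: AE.
have [N' [detN' NE]] := reversed_factor detN.
(* Only |rho| enters the spectrum, and on the circle the conjugate of rho(z) is this polynomial at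
   conj z; it has no zero on the closed disk either. *)
pose rho' := map_poly Num.conj rho.
have rho'_root z : normc z <= 1 -> ~~ root rho' z.
  move=> z1; rewrite rootE -[z]conjCK conj_poly_horner fmorph_eq0 -rootE.
  by rewrite rho_root// normc_conj.
have [A [M [n0 AE]]] :=
  error_cov_asymptotics LX d_itv d_neq0 (or_intror erefl) rho'_root detN' kap0.
have sigP c := spectral_along_bwd rho_root gE X_density (N' := N') c NE.
(* Backward times are counted upwards from -(n + 1), so this indexing moves with n; the infinite
   future [1, oo) is exhausted with the fixed indexing [sig] below. *)
have winE n : [set k : int | - n%:Z <= k <= -1] =
    [set` window (fun a => a%:Z - n.+1%:Z) n].
  apply/seteqP; split=> k /=.
    move=> kn; apply/mapP; exists (absz (k + n.+1%:Z)); rewrite ?mem_iota; move: kn; clear; lia.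
  by move=> /mapP[a]; rewrite mem_iota => an ->; move: an; clear; lia.
pose sig a : int := a%:Z + 0.
have EA : bwd_cov_infty P X = A.
  apply: (error_cov_limit LX (sig := sig) (c := d ^+ 2) (M := M) (n0 := n0)).
    apply/seteqP; split=> k /=.
      move=> k1; exists `|k|%N => //; apply/mapP; exists `|k|%N;
        rewrite ?mem_iota /sig; move: k1; clear; lia.
    by move=> [n _ /mapP[a]]; rewrite mem_iota /sig => an ->; move: an; clear; lia.
  by move=> n nn i j; have := AE n sig nn (sigP 0) i j; rewrite /sig addr0.
apply: (@eqaddO_entries _ _ _ _ _ M n0) => n nn i j.
rewrite EA entry /bwd_cov winE.
by have := AE n _ nn (sigP (- n.+1%:Z)) i j; rewrite add0r.
Qed.
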